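(* Let $M^n$ be a compact Riemannian manifold with locally convex boundary. In $M\times\mathbb{R}$ consider a product weight $e^{\psi(p,t)}:=e^{h(p)}\,e^{v(t)}$, where $h\in C^\infty(M)$ and $v\in C^\infty(\mathbb{R})$. Suppose that $\mathrm{Ric}_v\leq c\leq\mathrm{Ric}_h$ for some constant $c\in\mathbb{R}$. If $\Sigma$ is an entire horizontal graph with constant $\psi$-mean curvature and free boundary in $\partial M\times\mathbb{R}$, then $\Sigma=M_s$ for some $s\in\mathbb{R}$.
   Context: $M$ is a connected, oriented $n$-dimensional Riemannian manifold with smooth boundary $\partial M$; $M\times\mathbb{R}$ is the Riemannian product with the standard line, and $M_s:=M\times\{s\}$ is the horizontal slice at height $s$. An entire horizontal graph is a set $\{(p,\varphi(p)):p\in M\}$ with $\varphi\in C^\infty(M)$, with the downward unit normal $N=(\nabla_M\varphi,-1)/\sqrt{1+|\nabla_M\varphi|^2}$. For a weight $e^\psi$ on a Riemannian manifold, the Bakry-Émery-Ricci tensor is $\mathrm{Ric}_\psi:=\mathrm{Ric}-\nabla^2\psi$. $\mathrm{Ric}_h$ is the corresponding tensor of $M$ with weight $e^h$, and $\mathrm{Ric}_v$ that of $\mathbb{R}$ with weight $e^v$. Thus $c\leq\mathrm{Ric}_h$ means $\mathrm{Ric}_p(w,w)-(\nabla^2h)_p(w,w)\geq c\,|w|^2$ for all $p\in M$, $w\in T_pM$, and $\mathrm{Ric}_v\leq c$ means $-v''(t)\leq c$ for all $t\in\mathbb{R}$. For a hypersurface $\Sigma$ (possibly with smooth boundary $\partial\Sigma$)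 with unit normal $N$, the $\psi$-mean curvature is $H_\psi:=-\operatorname{div}_\Sigma N-\langle\nabla\psi,N\rangle$. A hypersurface with $\partial\Sigma\neq\emptyset$ has free boundary in $\partial M\times\mathbb{R}$ if $\partial\Sigma=\Sigma\cap(\partial M\times\mathbb{R})$ and $\Sigma$ is orthogonal to $\partial M\times\mathbb{R}$ along $\partial\Sigma$. $\partial M$ is locally convex if its second fundamental form with respect to the inner unit normal $\eta$, $\langle D_XY,\eta\rangle$ with $D$ the Levi-Civita connection, is positive semidefinite. *)

(* Defs.v *)
From HB Require Import structures.
From mathcomp Require Export all_boot all_order all_algebra.
From mathcomp Require Export all_classical all_reals all_analysis.
Export Order.TTheory GRing.Theory Num.Theory numFieldNormedType.Exports.

Set Implicit Arguments.
Unset Strict Implicit.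
Unset Printing Implicit Defensive.

Local Open Scope classical_set_scope.
Local Open Scope ring_scope.

Definition half_space (R : realType) (m : nat) : set 'rV[R]_m.+1 :=
  [set x | 0 <= x 0 ord0].

Definition iter_partial (R : realType) (m : nat) (s : seq 'I_m.+1)
    (f : 'rV[R]_m.+1 -> R) : 'rV[R]_m.+1 -> R :=
  foldr (fun a g => 'D_(delta_mx 0 a) g) f s.

Definition smooth_open (R : realType) (m : nat) (O : set 'rV[R]_m.+1)
    (f : 'rV[R]_m.+1 -> R) : Prop :=
  forall (s : seq 'I_m.+1) x, O x ->
    {for x, continuous (iter_partial s f)} /\
    (forall a, derivable (iter_partial s f) x (delta_mx 0 a)).

(* A may fail to be open: smooth functions on A are those which extend, near
   each point of A, to a smooth function on an open set. *)
Definition smooth_on (R : realType) (m : nat) (A : set 'rV[R]_m.+1)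
    (f : 'rV[R]_m.+1 -> R) : Prop :=
  forall x, A x -> exists (O : set 'rV[R]_m.+1) (g : 'rV[R]_m.+1 -> R),
    [/\ open O, O x, smooth_open O g & forall y, O y -> A y -> f y = g y].

Definition smooth_row_on (R : realType) (m k : nat) (A : set 'rV[R]_m.+1)
    (F : 'rV[R]_m.+1 -> 'rV[R]_k) : Prop :=
  forall b, smooth_on A (fun x => F x 0 b).

Definition smooth_line (R : realType) (v : R -> R) : Prop :=
  forall k t, derivable (derive1n k v) t 1.

(* The a-th partial derivative of a function on the half-space: the increment
   is restricted to stay in the half-space, so that this is the usual partial
   derivative at interior points (and in the directions a != 0), and the right
   derivative in the direction 0 at points of the boundary hyperplane.  It
   coincides there with the partial derivative of any smooth extension. *)
Definition pd (R : realType) (m : nat) (a : 'I_m.+1) (f : 'rV[R]_m.+1 -> R)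
    (x : 'rV[R]_m.+1) : R :=
  lim (h^-1 * (f (x + h *: delta_mx 0 a) - f x)
       @[h --> within [set h | @half_space R m (x + h *: delta_mx 0 a)] 0^']).

(* Below, g is the Gram matrix of the metric in a chart; tangent vectors are row
   vectors of components in the coordinate frame. *)

Definition inner (R : realType) (m : nat) (g : 'rV[R]_m.+1 -> 'M[R]_m.+1)
    (x u w : 'rV[R]_m.+1) : R := (u *m g x *m w^T) 0 0.

Definition grad (R : realType) (m : nat) (g : 'rV[R]_m.+1 -> 'M[R]_m.+1)
    (f : 'rV[R]_m.+1 -> R) (x : 'rV[R]_m.+1) : 'rV[R]_m.+1 :=
  (\row_a pd a f x) *m invmx (g x).

(* christoffel g a b k is $\Gamma^k_{ab}$. *)
Definition christoffel (R : realType) (m : nat)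
    (g : 'rV[R]_m.+1 -> 'M[R]_m.+1) (a b k : 'I_m.+1) (x : 'rV[R]_m.+1) : R :=
  2^-1 * \sum_l invmx (g x) k l *
    (pd a (fun y => g y b l) x + pd b (fun y => g y a l) x
     - pd l (fun y => g y a b) x).

(* The vector field $D_X Y$ of the Levi-Civita connection. *)
Definition covariant (R : realType) (m : nat)
    (g : 'rV[R]_m.+1 -> 'M[R]_m.+1) (X Y : 'rV[R]_m.+1 -> 'rV[R]_m.+1)
    (x : 'rV[R]_m.+1) : 'rV[R]_m.+1 :=
  \row_k (\sum_a X x 0 a * pd a (fun y => Y y 0 k) x
          + \sum_a \sum_b christoffel g a b k x * X x 0 a * Y x 0 b).

(* curvature g a b c d is the d-th component of $R(\partial_a,\partial_b)\partial_c$,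
   where $R(X,Y) = [D_X, D_Y] - D_{[X,Y]}$. *)
Definition curvature (R : realType) (m : nat)
    (g : 'rV[R]_m.+1 -> 'M[R]_m.+1) (a b c d : 'I_m.+1) (x : 'rV[R]_m.+1) : R :=
  pd a (christoffel g b c d) x - pd b (christoffel g a c d) x
  + \sum_e (christoffel g a e d x * christoffel g b c e x
            - christoffel g b e d x * christoffel g a c e x).

(* Ric(Y, Z) is the trace of X |-> R(X, Y) Z. *)
Definition ricci (R : realType) (m : nat) (g : 'rV[R]_m.+1 -> 'M[R]_m.+1)
    (x u w : 'rV[R]_m.+1) : R :=
  \sum_b \sum_c (\sum_a curvature g a b c a x) * u 0 b * w 0 c.

Definition hessian (R : realType) (m : nat) (g : 'rV[R]_m.+1 -> 'M[R]_m.+1)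
    (f : 'rV[R]_m.+1 -> R) (x u w : 'rV[R]_m.+1) : R :=
  \sum_a \sum_b
    (pd a (pd b f) x - \sum_k christoffel g a b k x * pd k f x)
    * u 0 a * w 0 b.

Definition bakry_emery (R : realType) (m : nat)
    (g : 'rV[R]_m.+1 -> 'M[R]_m.+1) (f : 'rV[R]_m.+1 -> R)
    (x u w : 'rV[R]_m.+1) : R := ricci g x u w - hessian g f x u w.

(* x is on the boundary hyperplane, whose tangent space is {w | w_0 = 0}. *)
Definition inner_unit_normal (R : realType) (m : nat)
    (g : 'rV[R]_m.+1 -> 'M[R]_m.+1) (x eta : 'rV[R]_m.+1) : Prop :=
  [/\ forall w : 'rV[R]_m.+1, w 0 ord0 = 0 -> inner g x eta w = 0,
      inner g x eta eta = 1 & 0 < eta 0 ord0].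

(* Below, F is a local parametrization of a hypersurface of a chart domain with
   metric g, and N is a vector field along F. *)

Definition tangent (R : realType) (k m : nat)
    (F : 'rV[R]_k.+1 -> 'rV[R]_m.+1) (a : 'I_k.+1) (x : 'rV[R]_k.+1) :
    'rV[R]_m.+1 := \row_j pd a (fun y => F y 0 j) x.

Definition first_form (R : realType) (k m : nat)
    (g : 'rV[R]_m.+1 -> 'M[R]_m.+1) (F : 'rV[R]_k.+1 -> 'rV[R]_m.+1)
    (x : 'rV[R]_k.+1) : 'M[R]_k.+1 :=
  \matrix_(a, b) inner g (F x) (tangent F a x) (tangent F b x).

(* The derivative of N in the direction of the tangent vector [tangent F a]. *)
Definition covariant_along (R : realType) (k m : nat)
    (g : 'rV[R]_m.+1 -> 'M[R]_m.+1) (F N : 'rV[R]_k.+1 -> 'rV[R]_m.+1)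
    (a : 'I_k.+1) (x : 'rV[R]_k.+1) : 'rV[R]_m.+1 :=
  \row_l (pd a (fun y => N y 0 l) x
          + \sum_i \sum_j
              christoffel g i j l (F x) * tangent F a x 0 i * N x 0 j).

(* $\mathrm{div}_\Sigma N = \sum_k \langle D_{e_k} N, e_k\rangle$ for orthonormal
   $e_k$, written in the frame [tangent F]. *)
Definition div_along (R : realType) (k m : nat)
    (g : 'rV[R]_m.+1 -> 'M[R]_m.+1) (F N : 'rV[R]_k.+1 -> 'rV[R]_m.+1)
    (x : 'rV[R]_k.+1) : R :=
  \sum_a \sum_b invmx (first_form g F x) a b
    * inner g (F x) (covariant_along g F N a x) (tangent F b x).

Definition weighted_mean_curvature (R : realType) (k m : nat)
    (g : 'rV[R]_m.+1 -> 'M[R]_m.+1) (psi : 'rV[R]_m.+1 -> R)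
    (F N : 'rV[R]_k.+1 -> 'rV[R]_m.+1) (x : 'rV[R]_k.+1) : R :=
  - div_along g F N x - inner g (F x) (grad g psi (F x)) (N x).

(* On the product with the line, the coordinates of (p, t) are those of p followed by t. *)

Definition product_metric (R : realType) (m : nat)
    (g : 'rV[R]_m.+1 -> 'M[R]_m.+1) (z : 'rV[R]_(m.+1 + 1)) :
    'M[R]_(m.+1 + 1) := block_mx (g (lsubmx z)) 0 0 1%:M.

Definition graph_param (R : realType) (m : nat) (f : 'rV[R]_m.+1 -> R)
    (x : 'rV[R]_m.+1) : 'rV[R]_(m.+1 + 1) := row_mx x (const_mx (f x)).

Definition graph_normal (R : realType) (m : nat)
    (g : 'rV[R]_m.+1 -> 'M[R]_m.+1) (f : 'rV[R]_m.+1 -> R)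
    (x : 'rV[R]_m.+1) : 'rV[R]_(m.+1 + 1) :=
  (Num.sqrt (1 + inner g x (grad g f x) (grad g f x)))^-1
    *: row_mx (grad g f x) (const_mx (-1)).

(* A smooth manifold with (possibly empty) boundary, of dimension n.+1, given
   by a smooth atlas.  The chart i is the map [coord i] restricted to [dom i],
   with inverse [param i]; outside of the relevant sets the values of these
   functions are irrelevant. *)
Record manifold (R : realType) (n : nat) := Manifold {
  carrier :> topologicalType;
  manifold_hausdorff : hausdorff_space carrier;
  manifold_second_countable : @second_countable carrier;
  chart : Type;
  dom : chart -> set carrier;
  coord : chart -> carrier -> 'rV[R]_n.+1;
  param : chart -> 'rV[R]_n.+1 -> carrier;
  dom_open : forall i, open (dom i);
  dom_cover : forall p, exists i, dom i p;
  coord_image_open : forall i, exists2 O : set 'rV[R]_n.+1,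
    open O & coord i @` dom i = O `&` @half_space R n;
  coordK : forall i p, dom i p -> param i (coord i p) = p;
  coord_continuous : forall i, {within dom i, continuous (coord i)};
  param_continuous : forall i,
    {within coord i @` dom i, continuous (param i)};
  transition_smooth : forall i j, smooth_row_on
    [set x | (coord i @` dom i) x /\ dom j (param i x)]
    (fun x => coord j (param i x)) }.

Definition chart_image (R : realType) (n : nat) (M : manifold R n)
    (i : chart M) : set 'rV[R]_n.+1 := coord i @` dom i.

Definition overlap (R : realType) (n : nat) (M : manifold R n)
    (i j : chart M) : set 'rV[R]_n.+1 :=
  [set x | chart_image i x /\ dom j (param i x)].

(* The differential of the change of coordinates is u |-> u *m jacobian i j x. *)
Definition transition_jacobian (R : realType) (n : nat) (M : manifold R n)
    (i j : chart M) (x : 'rV[R]_n.+1) : 'M[R]_n.+1 :=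
  \matrix_(a, b) pd a (fun y => coord j (param i y) 0 b) x.

Definition boundary (R : realType) (n : nat) (M : manifold R n) : set M :=
  [set p | exists i : chart M, dom i p /\ coord i p 0 ord0 = 0].
Arguments boundary {R n} M _.

Definition smooth_fun (R : realType) (n : nat) (M : manifold R n)
    (f : M -> R) : Prop :=
  forall i : chart M, smooth_on (chart_image i) (f \o param i).

(* A continuous choice of orientations of the tangent spaces: o i p tells
   whether the frame of the chart i at p is positive.  Asking instead for an
   atlas with positive Jacobians would exclude the interval, since its two ends
   are modelled on the same half-line. *)
Definition orientation (R : realType) (n : nat) (M : manifold R n)
    (o : chart M -> M -> bool) : Prop :=
  (forall i p, dom i p -> \forall q \near p, o i q = o i p) /\
  (forall i j x, overlap i j x ->
     o j (param i x) =
     (if 0 < \det (transition_jacobian i j x) then o i (param i x)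
      else ~~ o i (param i x))).

Record riemannian_metric (R : realType) (n : nat) (M : manifold R n) :=
  RiemannianMetric {
  gram :> chart M -> 'rV[R]_n.+1 -> 'M[R]_n.+1;
  gram_smooth : forall i a b,
    smooth_on (chart_image i) (fun x => gram i x a b);
  gram_sym : forall i x, chart_image i x -> (gram i x)^T = gram i x;
  gram_posdef : forall i x u, chart_image i x -> u != 0 ->
    0 < inner (gram i) x u u;
  gram_change : forall i j x, overlap i j x ->
    gram i x = transition_jacobian i j x *m gram j (coord j (param i x))
               *m (transition_jacobian i j x)^T }.

(* Positivity of the second fundamental form <D_X Y, eta> of the boundary; X
   ranges over the vector fields which are tangent to the boundary along it. *)
Definition locally_convex_boundary (R : realType) (n : nat) (M : manifold R n)
    (g : riemannian_metric M) : Prop :=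
  forall (i : chart M) (X : 'rV[R]_n.+1 -> 'rV[R]_n.+1),
    smooth_row_on (chart_image i) X ->
    (forall y, chart_image i y -> y 0 ord0 = 0 -> X y 0 ord0 = 0) ->
    forall x eta, chart_image i x -> x 0 ord0 = 0 ->
      inner_unit_normal (g i) x eta ->
      0 <= inner (g i) x (covariant (g i) X X x) eta.

(* c <= Ric_f, for the weight e^f on M *)
Definition bakry_emery_ge (R : realType) (n : nat) (M : manifold R n)
    (g : riemannian_metric M) (f : M -> R) (c : R) : Prop :=
  forall (i : chart M) x w, chart_image i x ->
    c * inner (g i) x w w <= bakry_emery (g i) (f \o param i) x w w.

(* Ric_v <= c, for the weight e^v on the line, where Ric = 0 *)
Definition bakry_emery_line_le (R : realType) (v : R -> R) (c : R) : Prop :=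
  forall t, - derive1n 2 v t <= c.

Definition graph (R : realType) (n : nat) (M : manifold R n) (phi : M -> R) :
  set (M * R) := [set z | z.2 = phi z.1].

Definition slice (R : realType) (n : nat) (M : manifold R n) (s : R) :
  set (M * R) := [set z | z.2 = s].
Arguments slice {R n} M s _.

(* The boundary of the graph as a manifold, parametrized by p |-> (p, phi p). *)
Definition graph_boundary (R : realType) (n : nat) (M : manifold R n)
    (phi : M -> R) : set (M * R) :=
  (fun p => (p, phi p)) @` boundary M.

(* The expression in the product chart i of a function on M x R. *)
Definition product_local (R : realType) (n : nat) (M : manifold R n)
    (psi : M * R -> R) (i : chart M) (z : 'rV[R]_(n.+1 + 1)) : R :=
  psi (param i (lsubmx z), rsubmx z 0 0).

(* H_psi at the point of the graph over the point x of the chart i. *)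
Definition graph_mean_curvature (R : realType) (n : nat) (M : manifold R n)
    (g : riemannian_metric M) (psi : M * R -> R) (phi : M -> R)
    (i : chart M) (x : 'rV[R]_n.+1) : R :=
  weighted_mean_curvature (product_metric (g i)) (product_local psi i)
    (graph_param (phi \o param i)) (graph_normal (g i) (phi \o param i)) x.

Definition constant_mean_curvature (R : realType) (n : nat)
    (M : manifold R n) (g : riemannian_metric M) (psi : M * R -> R)
    (phi : M -> R) : Prop :=
  exists H : R, forall (i : chart M) x, chart_image i x ->
    graph_mean_curvature g psi phi i x = H.

(* Free boundary in (boundary M) x R, vacuous when M has no boundary.
   Orthogonality means that the normals of the two hypersurfaces are
   orthogonal. *)
Definition free_boundary (R : realType) (n : nat) (M : manifold R n)
    (g : riemannian_metric M) (phi : M -> R) : Prop :=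
  graph_boundary phi = graph phi `&` (boundary M `*` setT) /\
  forall (i : chart M) x eta, chart_image i x -> x 0 ord0 = 0 ->
    inner_unit_normal (product_metric (g i))
      (graph_param (phi \o param i) x) eta ->
    inner (product_metric (g i)) (graph_param (phi \o param i) x)
      (graph_normal (g i) (phi \o param i) x) eta = 0.

(* Main.v *)
From HB Require Import structures.
Require Import Defs.
From mathcomp Require Import all_boot all_order all_algebra.
From mathcomp Require Import all_classical all_reals all_analysis.
From mathcomp Require Import ring lra.
Set Implicit Arguments.
Unset Strict Implicit.
Unset Printing Implicit Defensive.
Local Open Scope classical_set_scope.
Local Open Scope ring_scope.

(* Write $X = \nabla\varphi$, $u = |X|^2$, $W = \sqrt{1+u}$ and $s = u/2$.  The
   equation $H_\psi = H$ reads
     $\mathrm{div} X - X(s)/W^2 + X(h) = v'(\varphi) - H W$.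
   Let $F = s + \varepsilon e^{K\varphi}$ and consider a point of $M$ where $F$ is
   maximal.  If it is on the boundary, $X$ is tangent to the boundary by the
   free boundary condition, and local convexity gives
     $\langle\nabla F,\eta\rangle = \langle D_X X,\eta\rangle \geq 0$,
   so that $\nabla F = 0$ at the maximum in every case; the Hessian of $F$ is then
   nonpositive there, in all directions, and no Hopf lemma is needed.  As
   $\nabla F = 0$, the vector $X$ is an eigenvector of $\nabla^2\varphi$, and the
   Bochner formula, combined with the derivative along $X$ of the equation above,
   gives for $a = g^{-1} - X \otimes X/W^2$
     $0 \geq a^{ij}F_{ij}
        \geq \varepsilon K e^{K\varphi} (v'(\varphi) - H/W + K u/W^2)$.
   If $u$ is positive somewhere, then for $\varepsilon$ small depending on $K$ it
   is bounded below at the maximum by a positive constant independent of $K$, and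
   a large $K$ yields a contradiction.  So $u = 0$, and $\varphi$ is constant. *)

(** Without the term $\varepsilon e^{K\varphi}$, a maximum of $s$ would only show that a sum of
    nonnegative terms is at most $0$, which is no contradiction. The exponential supplies the
    strictness that a strong maximum principle would otherwise provide: differentiated twice it
    contributes a multiple of $K u/W^2$, of definite sign, and this dominates $v'(\varphi) - H/W$,
    whose sign is unknown but which is bounded on the compact $M$.

    The two curvature bounds enter through $\mathrm{Ric}_h(X,X) + v''(\varphi)u \geq 0$ alone, the
    term $v''(\varphi)u$ being the derivative of $v'(\varphi)$ along $X$. The term $X(X(s))$, which
    contains third derivatives of $\varphi$, cancels between $a^{ij}F_{ij}$ and the differentiated
    equation. With $\chi = \varepsilon K e^{K\varphi}$, the remaining terms quadratic in $\chi$ may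
    be negative; they are absorbed by $|\nabla^2\varphi|^2 \geq \chi^2$, which holds because $-\chi$
    is an eigenvalue of $\nabla^2\varphi$ at the maximum. *)

(** * Differential calculus in normed spaces: mean values, $C^1$ functions, symmetry of second
    derivatives, maxima along rays *)

Lemma is_derive_line (R : realType) (V : normedModType R) (f : V -> R)
    (x v : V) (t : R) :
  derivable f (x + t *: v) v ->
  is_derive t 1 (fun r => f (x + r *: v)) ('D_v f (x + t *: v)).
Proof.
have E : (fun h : R => h^-1 *: (f (x + (h *: 1 + t) *: v) - f (x + t *: v)))
    = (fun h => h^-1 *: (f (h *: v + (x + t *: v)) - f (x + t *: v))).
  apply/funext => h; congr (_ *: (f _ - _)).
  by rewrite scalerDl [h *: 1]mulr1 addrCA.
by move=> df; apply: DeriveDef; rewrite /derivable /derive /= E.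
Qed.

(** The segment is parametrized by $[0,1]$, so that [s] may be negative or zero, as the coordinates
    of an arbitrary increment are. *)
Lemma mvt_line (R : realType) (V : normedModType R) (f : V -> R) (x v : V)
    (s : R) :
  (forall t, 0 <= t <= 1 -> derivable f (x + (t * s) *: v) v) ->
  exists2 t, 0 < t < 1 &
    f (x + s *: v) - f x = s * 'D_v f (x + (t * s) *: v).
Proof.
move=> df.
have dk (t : R) : 0 <= t <= 1 -> is_derive t 1 (fun r => f (x + r *: (s *: v)))
    (s * 'D_v f (x + (t * s) *: v)).
  move=> /df dft.
  have := @is_derive_line R V f x v (t * s) dft.
  move=> H.
  have H1 : is_derive t (1 : R) (fun r : R => r * s) s.
    by apply: is_derive_eq; rewrite scaler0 add0r /GRing.scale /= mulr1.
  have := is_derive1_comp (f := fun r => f (x + r *: v)) (g := fun r => r * s).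
  move=> /(_ _ _ _ H H1) /=.
  rewrite (_ : _ \o _ = fun r => f (x + r *: (s *: v))) ?[s * _]mulrC//.
  by apply/funext => r /=; rewrite scalerA.
have [||t t01 E] := @MVT R (fun r => f (x + r *: (s *: v)))
  (fun t => s * 'D_v f (x + (t * s) *: v)) 0 1 ltr01.
- by move=> t; rewrite in_itv /= => /andP[t0 t1]; apply: dk; rewrite !ltW.
- apply: derivable_within_continuous => t; rewrite in_itv /= => t01.
  exact: (ex_derive (is_derive := dk _ t01)).
exists t; first by move: t01; rewrite in_itv.
by move: E; rewrite scale1r scale0r addr0 subr0 mulr1.
Qed.

Lemma coord_le_norm (R : realType) (m n : nat) (x : 'M[R]_(m.+1, n.+1)) i j :
  `|x i j| <= `|x|.
Proof.
by rewrite [leRHS]mx_normrE (le_bigmax _ (fun ij => `|x ij.1 ij.2|) (i, j)).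
Qed.

Lemma norm_le_coord (R : realType) (m n : nat) (x : 'M[R]_(m.+1, n.+1)) (e : R) :
  0 <= e -> (forall i j, `|x i j| <= e) -> `|x| <= e.
Proof. by move=> e0 xe; rewrite [leLHS]mx_normrE; apply: bigmax_le. Qed.

(** Go from [x] to [x + w] along the coordinate axes, one coordinate at a time. The mean value
    theorem on each edge produces a partial derivative at a point near [x], and continuity at [x]
    replaces it by the one at [x]. *)
Lemma C1_differentiable (R : realType) (m : nat) (f : 'rV[R]_m.+1 -> R) x :
  (\forall y \near x, forall a, derivable f y (delta_mx 0 a)) ->
  (forall a, {for x, continuous ('D_(delta_mx 0 a) f)}) ->
  differentiable f x /\
  forall w, 'D_w f x = \sum_a w 0 a * 'D_(delta_mx 0 a) f x.
Proof.
move=> df cf.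
pose L (w : 'rV[R]_m.+1) : R := \sum_a w 0 a * 'D_(delta_mx 0 a) f x.
have Llin : linear L.
  move=> k u w; rewrite /L scaler_sumr -big_split /=; apply: eq_bigr => a _.
  by rewrite !mxE /GRing.scale /=; ring.
pose Lm := GRing.isLinear.Build _ _ _ _ L Llin.
pose Ll : {linear 'rV[R]_m.+1 -> R} := HB.pack L Lm.
have Lc : continuous Ll.
  apply: continuous_big => [|a _ w]; first exact: add_continuous.
  apply: (@continuousM _ _ (fun w : 'rV[R]_m.+1 => w 0 a)
    (cst ('D_(delta_mx 0 a) f x))); last exact: cst_continuous.
  exact: matrix_normedtype.coord_continuous.
have main : f \o shift x = cst (f x) + (Ll : _ -> _) +o_ 0 id.
  apply/eqaddoP => e e0.
  (* Each of the [m.+1] edges of the path gets an equal share of the error. *)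
  pose e' := e / m.+1%:R.
  have e'0 : 0 < e' by rewrite divr_gt0.
  have Dn : \forall y \near x, forall a,
      `|'D_(delta_mx 0 a) f x - 'D_(delta_mx 0 a) f y| < e'.
    apply: (@filter_forall _ _ (fun a y => `|_ - _| < e') (nbhs x) (nbhs_filter x)) => a.
    by have /cvgrPdist_lt/(_ e' e'0) := cf a.
  have /nbhs_ballP [r /= r0 Br] : \forall y \near x,
      (forall a, derivable f y (delta_mx 0 a)) /\ forall a,
      `|'D_(delta_mx 0 a) f x - 'D_(delta_mx 0 a) f y| < e'.
    by near=> y; split; near: y.
  apply/nbhs_ballP; exists r => //= w; rewrite -ball_normE /= sub0r normrN => wr.
  (* The [k]-th vertex of the path: the first [k] coordinates have been moved. *)
  pose p (k : nat) : 'rV[R]_m.+1 := x + \row_b (if (b < k)%N then w 0 b else 0).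
  have pS (a : 'I_m.+1) : p a.+1 = p a + w 0 a *: delta_mx 0 a.
    rewrite /p -addrA; congr (_ + _); apply/rowP => b.
    rewrite !mxE ltnS leq_eqVlt eqxx /=.
    have [->|] := eqVneq b a; rewrite ?eqxx ?ltnn ?mulr1 ?add0r //= => /negbTE.
    by rewrite -val_eqE /= => ->; rewrite mulr0 addr0.
  have near_p (a : 'I_m.+1) t : 0 <= t <= 1 ->
      ball x r (p a + (t * w 0 a) *: delta_mx 0 a).
    move=> /andP[t0 t1]; rewrite -ball_normE /= distrC /p.
    rewrite -[x + _ + _]addrA [_ - x]addrC addKr.
    apply: le_lt_trans wr; apply: norm_le_coord => // i b; rewrite !mxE (ord1 i) eqxx /=.
    have [->|ba] := eqVneq b a.
      rewrite ltnn mulr1 add0r normrM ger0_norm//.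
      by rewrite (le_trans _ (coord_le_norm w 0 a))// ler_piMl.
    rewrite mulr0 addr0; case: ifP => _; last by rewrite normr0.
    exact: coord_le_norm.
  have -> : (f \o shift x - (cst (f x) + (Ll : _ -> _))) w
      = \sum_(a < m.+1) (f (p a.+1) - f (p a) - w 0 a * 'D_(delta_mx 0 a) f x).
    rewrite sumrB -(big_mkord xpredT (fun a => f (p a.+1) - f (p a))).
    rewrite telescope_sumr//.
    have -> : p 0%N = x.
      by rewrite /p (_ : \row__ _ = 0) ?addr0//; apply/rowP => b; rewrite !mxE.
    have -> : p m.+1 = w + x.
      by rewrite /p addrC; congr (_ + _); apply/rowP => b; rewrite !mxE ltn_ord.
    by rewrite -addrA -opprD.
  apply: (le_trans (ler_norm_sum _ _ _)).
  have -> : e * `|id w| = \sum_(a < m.+1) e' * `|w|.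
    by rewrite sumr_const card_ord -mulrnAl -mulr_natr /e' divfK ?pnatr_eq0.
  apply: ler_sum => a _; rewrite pS.
  have [|t /andP[/ltW t0 /ltW t1] ->] := @mvt_line R _ f (p a) (delta_mx 0 a) (w 0 a).
    by move=> t t01; have [+ _] := Br _ (near_p a t t01); exact.
  rewrite -mulrBr normrM mulrC ler_pM//; last exact: coord_le_norm.
  rewrite distrC ltW//.
  by have [_ +] := Br _ (near_p a t (introT andP (conj t0 t1))); exact.
have E := diff_unique Lc main.
have dfx : differentiable f x.
  by apply/diff_locallyP; rewrite E; split.
by split => // w; rewrite deriveE// E.
Unshelve. all: by end_near. Qed.

Lemma derive_translate (R : realType) (V : normedModType R) (f : V -> R)
    (c y w : V) :
  derivable f (y + c) w -> is_derive y w (fun z => f (z + c)) ('D_w f (y + c)).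
Proof.
have E : (fun h : R => h^-1 *: (f (h *: w + y + c) - f (y + c)))
    = (fun h => h^-1 *: (f (h *: w + (y + c)) - f (y + c))).
  by apply/funext => h; rewrite addrA.
by move=> df; apply: DeriveDef; rewrite /derivable /derive /= E.
Qed.

(** Two applications of the mean value theorem, in direction [w] to $y \mapsto f(y+sv)-f(y)$ and
    then in direction [v] to $D_w f$, make the second difference equal to $s^2 D_v D_w f$ at a point
    of the parallelogram. *)
Lemma second_difference (R : realType) (V : normedModType R) (f : V -> R)
    (x v w : V) (e : R) :
  (\forall y \near x, derivable f y w) ->
  (\forall y \near x, derivable ('D_w f) y v) ->
  {for x, continuous ('D_v ('D_w f))} -> 0 < e ->
  \forall s \near 0^'+,
    `|f (x + s *: w + s *: v) - f (x + s *: w) - f (x + s *: v) + f x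
      - s ^+ 2 * 'D_v ('D_w f) x| <= e * s ^+ 2.
Proof.
move=> df ddf cf e0.
have De : \forall y \near x, `|'D_v ('D_w f) x - 'D_v ('D_w f) y| < e.
  by move/cvgrPdist_lt: cf => /(_ e e0).
have /nbhs_ballP [r /= r0 Br] : \forall y \near x, [/\ derivable f y w,
    derivable ('D_w f) y v & `|'D_v ('D_w f) x - 'D_v ('D_w f) y| < e].
  by apply: filterS3 df ddf De => y; split.
have vw0 : 0 < `|v| + `|w| + 1 by rewrite ltr_wpDl// addr_ge0.
(* The whole parallelogram lies in the ball; the summand 1 keeps the denominator positive when [v]
   and [w] vanish. *)
have inB (s a b : R) : 0 < s < r / (`|v| + `|w| + 1) -> 0 <= a <= 1 ->
    0 <= b <= 1 -> ball x r (x + (a * s) *: w + (b * s) *: v).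
  move=> /andP[s0]; rewrite ltr_pdivlMr// => sr /andP[a0 a1] /andP[b0 b1].
  rewrite -ball_normE /= distrC -[x + _ + _]addrA [_ - x]addrC addKr.
  apply: le_lt_trans (ler_normD _ _) _; apply: le_lt_trans sr.
  rewrite !normrZ !(ger0_norm (ltW s0)) (ger0_norm a0) (ger0_norm b0).
  have := ler_piMl (mulr_ge0 (ltW s0) (normr_ge0 w)) a1.
  have := ler_piMl (mulr_ge0 (ltW s0) (normr_ge0 v)) b1.
  rewrite -!mulrA; nra.
near=> s.
have s0r : 0 < s < r / (`|v| + `|w| + 1).
  apply/andP; split; near: s; first exact: nbhs_right_gt.
  by apply: nbhs_right_lt; exact: divr_gt0.
have s0 : 0 < s by case/andP: s0r.
pose k y := f (y + s *: v) - f y.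
have dk t : 0 <= t <= 1 -> is_derive (x + (t * s) *: w) w k
   ('D_w f (x + (t * s) *: w + s *: v) - 'D_w f (x + (t * s) *: w)).
  move=> t01.
  have [d1 _ _] := Br _ (inB s t 1 s0r t01 ltac:(by rewrite ler01 lexx)).
  have [d2 _ _] := Br _ (inB s t 0 s0r t01 ltac:(by rewrite ler01 lexx)).
  rewrite mul1r in d1; rewrite mul0r scale0r addr0 in d2.
  apply: is_deriveB; last exact: DeriveDef.
  exact: derive_translate.
have [|t /andP[/ltW t0 /ltW t1] E] := @mvt_line R V k x w s.
  by move=> t /dk dkt; exact: ex_derive.
have t01 : 0 <= t <= 1 by rewrite t0 t1.
have [|t' /andP[/ltW t'0 /ltW t'1] E'] :=
    @mvt_line R V ('D_w f) (x + (t * s) *: w) v s.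
  by move=> t' t'01; have [] := Br _ (inB s t t' s0r t01 t'01).
have t'01 : 0 <= t' <= 1 by rewrite t'0 t'1.
have [_ _ L] := Br _ (inB s t t' s0r t01 t'01).
have -> : f (x + s *: w + s *: v) - f (x + s *: w) - f (x + s *: v) + f x
  = k (x + s *: w) - k x by rewrite /k; ring.
rewrite E (derive_val (is_derive := dk t t01)) E'.
rewrite mulrA -expr2 -mulrBr normrM [leRHS]mulrC ger0_norm ?exprn_ge0 ?(ltW s0)//.
apply: ler_wpM2l; first exact/exprn_ge0/ltW.
by rewrite distrC; exact: ltW L.
Unshelve. all: by end_near. Qed.

(** The second difference is symmetric in [v] and [w], and approximates both mixed derivatives. With
    the error [e] equal to a third of their distance this distance $3e$ would be at most $2e$. *)
Lemma derive_comm (R : realType) (V : normedModType R) (f : V -> R) (x v w : V) :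
  (\forall y \near x, derivable f y w) ->
  (\forall y \near x, derivable f y v) ->
  (\forall y \near x, derivable ('D_w f) y v) ->
  (\forall y \near x, derivable ('D_v f) y w) ->
  {for x, continuous ('D_v ('D_w f))} ->
  {for x, continuous ('D_w ('D_v f))} ->
  'D_v ('D_w f) x = 'D_w ('D_v f) x.
Proof.
move=> dw dv dvw dwv cvw cwv; apply/eqP/negPn/negP => ne.
pose a := 'D_v ('D_w f) x; pose b := 'D_w ('D_v f) x; pose e := `|a - b| / 3.
have e0 : 0 < e by rewrite divr_gt0// normr_gt0 subr_eq0.
have A := second_difference dw dvw cvw e0.
have B := second_difference dv dwv cwv e0.
have [s [{}A {}B s0]] : exists s, [/\ `|f (x + s *: w + s *: v) - f (x + s *: w)
      - f (x + s *: v) + f x - s ^+ 2 * 'D_v ('D_w f) x| <= e * s ^+ 2,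
    `|f (x + s *: v + s *: w) - f (x + s *: v) - f (x + s *: w) + f x
      - s ^+ 2 * 'D_w ('D_v f) x| <= e * s ^+ 2 & 0 < s].
  have [s sP] := filter_ex (filterI (filterI A B) (nbhs_right_gt (0 : R))).
  by case: sP => -[sA sB] s0; exists s; exact: And3 sA sB s0.
have s20 : 0 < s ^+ 2 by rewrite exprn_gt0.
rewrite -/a in A; rewrite -/b in B.
have key (a' b' D e' s2 : R) : 0 < s2 -> `|D - s2 * a'| <= e' * s2 ->
    `|D - s2 * b'| <= e' * s2 -> `|a' - b'| <= 2 * e'.
  move=> s2_0 A' B'; rewrite -(ler_pM2r s2_0) -[X in _ * X]gtr0_norm// -normrM.
  rewrite (_ : (a' - b') * s2 = (D - s2 * b') - (D - s2 * a')); last by ring.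
  by apply: (le_trans (ler_normB _ _)); rewrite -mulrA mulr_natl mulr2n lerD.
have ED : f (x + s *: v + s *: w) - f (x + s *: v) - f (x + s *: w) + f x
    = f (x + s *: w + s *: v) - f (x + s *: w) - f (x + s *: v) + f x.
  by rewrite [x + _ + _ in LHS]addrAC [_ - _ - _ in LHS]addrAC.
rewrite ED in B; have := key _ _ _ _ _ s20 A B.
have -> : `|a - b| = 3 * e by rewrite /e mulrC divfK ?pnatr_eq0.
by rewrite ler_pM2r// ler_nat.
Qed.


(** Only the ray in direction [w] is constrained, which is all that is available at a boundary
    point; hence an inequality. *)
Lemma first_order_max (R : realType) (V : normedModType R) (f : V -> R)
    (x w : V) :
  derivable f x w -> (\forall t \near 0^'+, f (x + t *: w) <= f x) ->
  'D_w f x <= 0.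
Proof.
move=> df fx.
have c : h^-1 *: (f (h *: w + x) - f x) @[h --> 0^'+] --> 'D_w f x.
  exact: cvg_dnbhs_at_right df.
apply: (cvgr_to_le c); apply: filterS2 fx (nbhs_right_gt (0 : R)) => t fxt t0.
by apply: mulr_ge0_le0; [rewrite invr_ge0 ltW|rewrite subr_le0 addrC].
Qed.

(** If the second derivative were positive, $D_w f$, which vanishes at [x], would be positive on a
    short ray, and [f] would increase along it. A maximum along a single ray does not give $D_w f(x)
    = 0$, which is therefore assumed. *)
Lemma second_order_max (R : realType) (V : normedModType R) (f : V -> R)
    (x w : V) :
  (\forall y \near x, derivable f y w) -> derivable ('D_w f) x w ->
  (\forall t \near 0^'+, f (x + t *: w) <= f x) ->
  'D_w f x = 0 -> 'D_w ('D_w f) x <= 0.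
Proof.
move=> df ddf fx d0; rewrite leNgt; apply/negP => L0.
have c : h^-1 *: ('D_w f (h *: w + x) - 'D_w f x) @[h --> 0^'+]
    --> 'D_w ('D_w f) x.
  exact: cvg_dnbhs_at_right ddf.
have Q := @cvgr_gt _ _ _ (at_right_proper_filter 0) _ _ c _ L0.
have near_line : \forall t \near (0 : R)^'+, derivable f (x + t *: w) w.
  have line : (x + t *: w) @[t --> (0 : R)^'+] --> x.
    rewrite -[X in _ --> X]addr0 -(scale0r w); apply: cvgD; first exact: cvg_cst.
    by apply: cvgZr_tmp; apply: cvg_at_right_filter; exact: cvg_id.
  exact: line df.
have [r /= r0 Br] := filterI near_line Q.
have [t [[ft tr] t0]] := filter_ex (filterI (filterI fx (nbhs_right_lt r0))
  (nbhs_right_gt (0 : R))).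
have inr s : 0 < s <= 1 -> `|0 - s * t| < r.
  move=> /andP[s0 s1]; rewrite sub0r normrN gtr0_norm ?mulr_gt0//.
  by apply: le_lt_trans tr; rewrite ler_piMl// ltW.
have [s /andP[]|s s01 E] := @mvt_line R V f x w t.
  rewrite le_eqVlt => /predU1P[<- _|s0 s1].
    by rewrite mul0r scale0r addr0; exact: nbhs_singleton df.
  have s01 : 0 < s <= 1 by rewrite s0.
  by have [+ _] := Br _ (inr s s01) (mulr_gt0 s0 t0); exact.
have /andP[s0 /ltW s1] := s01.
have [_ /=] := Br _ (inr s (introT andP (conj s0 s1))) (mulr_gt0 s0 t0).
rewrite d0 subr0 [_ *: _ + x]addrC -[_ *: (_ : R)]/(_ * _).
rewrite pmulr_rgt0 ?invr_gt0 ?mulr_gt0// => d1.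
have : f (x + t *: w) - f x <= 0 by rewrite subr_le0.
by rewrite E pmulr_rle0// leNgt d1.
Qed.

(* Working with differentiable extensions instead of the one-sided increments of
   [pd] gives the chain rule in several variables; [has_partials_pd] recovers
   [pd]. *)
Definition has_partials (R : realType) (m : nat) (f : 'rV[R]_m.+1 -> R)
    (x : 'rV[R]_m.+1) (d : 'I_m.+1 -> R) : Prop :=
  exists g, [/\ differentiable g x,
    \forall y \near x, @half_space R m y -> f y = g y &
    forall a, 'D_(delta_mx 0 a) g x = d a].

Lemma half_space_segment (R : realType) (m : nat) (x : 'rV[R]_m.+1) a (h : R) :
  @half_space R m x -> 0 <= h -> @half_space R m (x + h *: delta_mx 0 a).
Proof.
rewrite /half_space /= => x0 h0; rewrite !mxE addr_ge0// mulr_ge0//.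
Qed.

(** Small positive increments stay in the half-space, so the filter in [pd] is proper and its limit
    unique; the two-sided derivative of the extension restricts to it. *)
Lemma has_partials_pd (R : realType) (m : nat) (f : 'rV[R]_m.+1 -> R) x d a :
  @half_space R m x -> has_partials f x d -> pd a f x = d a.
Proof.
move=> Hx [g [dg fg <-]].
set S := [set h : R | @half_space R m (x + h *: delta_mx 0 a)].
have FS : ProperFilter (within S (0 : R)^').
  apply: Build_ProperFilter => -[r /= r0 rS].
  have r20 : 0 < r / 2 by rewrite divr_gt0.
  apply: (rS (r / 2)).
  - by rewrite /= sub0r normrN gtr0_norm// ltr_pdivrMr// ltr_pMr// ltr1n.
  - by rewrite gt_eqF.
  - by apply: half_space_segment => //; exact: ltW.
rewrite /pd -/S; apply/cvg_lim => //.
have dgx : h^-1 *: (g (h *: delta_mx 0 a + x) - g x) @[h --> within S 0^']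
    --> 'D_(delta_mx 0 a) g x.
  apply: cvg_within_filter; exact: (@diff_derivable _ _ _ g x (delta_mx 0 a) dg).
apply: cvg_trans dgx; apply: near_eq_cvg; rewrite near_withinE.
have xh : (x + h *: delta_mx 0 a) @[h --> (0 : R)^'] --> x.
  rewrite -[X in _ --> X]addr0 -(scale0r (delta_mx 0 a)).
  apply: cvgD; first exact: cvg_cst.
  by apply: cvgZr_tmp; apply: cvg_within_filter; exact: cvg_id.

have fgh : \forall h \near (0 : R)^', S h ->
    f (x + h *: delta_mx 0 a) = g (x + h *: delta_mx 0 a) by exact: xh fg.
apply: filterS fgh => h fgh Sh.
by rewrite [_ + x]addrC fgh// (nbhs_singleton fg).
Qed.

Lemma has_partials_ext (R : realType) (m : nat) (f g : 'rV[R]_m.+1 -> R) x d e :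
  (\forall y \near x, @half_space R m y -> f y = g y) -> d =1 e ->
  has_partials f x d -> has_partials g x e.
Proof.
move=> fg de [k [dk fk kd]]; exists k; split=> //; last by move=> a; rewrite kd de.
by apply: filterS2 fg fk => y fgy fky Hy; rewrite -fgy// fky.
Qed.

Lemma has_partials_cst (R : realType) (m : nat) (c : R) (x : 'rV[R]_m.+1) :
  has_partials (fun=> c) x (fun=> 0).
Proof.
exists (cst c); split => [|//|a]; first exact: differentiable_cst.
  exact: filterE.
exact: derive_cst.
Qed.

Lemma has_partialsD (R : realType) (m : nat) (f g : 'rV[R]_m.+1 -> R) x d e :
  has_partials f x d -> has_partials g x e ->
  has_partials (fun y => f y + g y) x (fun a => d a + e a).
Proof.
move=> [f' [df ff' fd]] [g' [dg gg' ge]]; exists (f' + g'); split.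
- exact: differentiableD.
- by apply: filterS2 ff' gg' => y ff' gg' Hy; rewrite ff'// gg'.
- by move=> a; rewrite deriveD ?fd ?ge//; exact: diff_derivable.
Qed.

Lemma has_partialsM (R : realType) (m : nat) (f g : 'rV[R]_m.+1 -> R) x d e :
  @half_space R m x -> has_partials f x d -> has_partials g x e ->
  has_partials (fun y => f y * g y) x (fun a => d a * g x + f x * e a).
Proof.
move=> Hx [f' [df ff' fd]] [g' [dg gg' ge]]; exists (f' * g'); split.
- exact: differentiableM.
- by apply: filterS2 ff' gg' => y ff' gg' Hy; rewrite ff'// gg'.
- move=> a; rewrite deriveM ?fd ?ge; try exact: diff_derivable.
  rewrite (nbhs_singleton ff')// (nbhs_singleton gg')//.
  by rewrite /GRing.scale /= addrC [_ * d a]mulrC.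
Qed.

Lemma differentiable_comp1 (R : realType) (V : normedModType R) (p : R -> R)
    (f : V -> R) (x : V) (e : R) :
  differentiable f x -> is_derive (f x) 1 p e ->
  differentiable (p \o f) x /\ forall w, 'D_w (p \o f) x = e * 'D_w f x.
Proof.
move=> df [dp pe].
have dp' : differentiable p (f x) by exact/derivable1_diffP.
have dpf : differentiable (p \o f) x by exact: differentiable_comp.
split => // w; rewrite !deriveE// diff_comp//= -pe -derive1E deriv1E//.
by rewrite /GRing.scale /= mulrC.
Qed.

Lemma has_partials_comp1 (R : realType) (m : nat) (p : R -> R)
    (f : 'rV[R]_m.+1 -> R) x d e :
  @half_space R m x -> has_partials f x d -> is_derive (f x) 1 p e ->
  has_partials (p \o f) x (fun a => e * d a).
Proof.
move=> Hx [f' [df ff' fd]] pe.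
rewrite (nbhs_singleton ff')// in pe.
have [dpf E] := differentiable_comp1 df pe.
exists (p \o f'); split=> // [|a]; last by rewrite E fd.
by apply: filterS ff' => y ff' Hy /=; rewrite ff'.
Qed.

Lemma has_partials_coord (R : realType) (m : nat) (j : 'I_m.+1) (x : 'rV[R]_m.+1) :
  has_partials (fun y => y 0 j) x (fun a => (a == j)%:R).
Proof.
exists (fun y : 'rV[R]_m.+1 => y 0 j); split.
- exact: differentiable_coord.
- exact: filterE.
- move=> a; rewrite deriveE; last exact: differentiable_coord.
  pose c := fun y : 'rV[R]_m.+1 => y 0 j.
  have clin : linear c by move=> k u w; rewrite /c !mxE.
  pose cm := GRing.isLinear.Build _ _ _ _ c clin.
  pose cl : {linear 'rV[R]_m.+1 -> R} := HB.pack c cm.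
  have := @diff_lin _ _ _ cl x (@matrix_normedtype.coord_continuous R 1 m.+1 0 j).
  by move=> ->; rewrite /cl /= /c mxE eqxx eq_sym.
Qed.

Lemma differentiable_row (R : realType) (k m : nat)
    (G : 'I_m.+1 -> 'rV[R]_k.+1 -> R) (x : 'rV[R]_k.+1) :
  (forall j, differentiable (G j) x) ->
  differentiable (fun y => \row_j G j y) x /\
  forall w, 'd (fun y => \row_j G j y) x w = \row_j 'd (G j) x w.
Proof.
move=> dG.
have -> : (fun y => \row_j G j y) = \sum_j (fun y => G j y *: delta_mx 0 j).
  apply/funext => y; rewrite fct_sumE; apply/rowP => b; rewrite mxE summxE.
  rewrite (bigD1 b)//= big1 => [|j jb]; rewrite !mxE eqxx /=.
    by rewrite eqxx mulr1 addr0.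
  by rewrite eq_sym (negbTE jb) mulr0.
have dS j : differentiable (fun y => G j y *: (delta_mx 0 j : 'rV[R]_m.+1)) x.
  exact: differentiableZl.
have D : differentiable (\sum_j (fun y => G j y *: (delta_mx 0 j : 'rV[R]_m.+1))) x.
  exact: differentiable_sum.
split=> // w; rewrite -deriveE// derive_sum; last by move=> j; exact: diff_derivable.
apply/rowP => b; rewrite mxE summxE (bigD1 b)//= big1 => [|j jb].
  by rewrite deriveE// diffZl// !mxE !eqxx mulr1 addr0.
by rewrite deriveE// diffZl// !mxE eqxx eq_sym (negbTE jb) mulr0.
Qed.

(** Chain rule. The map [F] must preserve the half-spaces, because [f] agrees with its extension
    only there. *)
Lemma has_partials_comp (R : realType) (k m : nat) (f : 'rV[R]_m.+1 -> R)
    (F : 'rV[R]_k.+1 -> 'rV[R]_m.+1) x d (J : 'I_k.+1 -> 'I_m.+1 -> R) :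
  @half_space R k x ->
  has_partials f (F x) d ->
  (forall j, has_partials (fun y => F y 0 j) x (J^~ j)) ->
  (\forall y \near x, @half_space R k y -> @half_space R m (F y)) ->
  has_partials (f \o F) x (fun a => \sum_j J a j * d j).
Proof.
move=> Hx [f' [df ff' fd]] hF HF.
have [G GP] := choice hF.
pose G' y := \row_j G j y.
have [|dG dGE] := @differentiable_row R k m G x; first by move=> j; have [] := GP j.
have FG : \forall y \near x, @half_space R k y -> F y = G' y.
  have : \forall y \near x, forall j, @half_space R k y -> F y 0 j = G j y.
    apply: (@filter_forall _ _ (fun j y => half_space y -> F y 0 j = G j y)
      (nbhs x) (nbhs_filter x)) => j.
    by have [] := GP j.
  by apply: filterS => y E Hy; apply/rowP => j; rewrite mxE E.
have FGx : F x = G' x by exact: (nbhs_singleton FG).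
rewrite FGx in df ff' fd.
exists (f' \o G'); split.
- exact: differentiable_comp.
- have Gc : {for x, continuous G'} by exact: differentiable_continuous.
  apply: filterS3 FG HF (Gc _ ff') => y FG HF ff'' Hy /=.
  by rewrite FG//; apply: ff''; rewrite -FG//; exact: HF.
- move=> a; rewrite deriveE; last exact: differentiable_comp.
  rewrite diff_comp//= dGE.
  rewrite (_ : \row__ _ = \row_j J a j); last first.
    apply/rowP => j; rewrite !mxE; have [dGj _ <-] := GP j.
    by rewrite deriveE.
  rewrite [\row__ _]row_sum_delta raddf_sum; apply: eq_bigr => j _.
  by rewrite [LHS]linearZ_LR mxE -deriveE ?fd.
Qed.

(** * Smooth functions on open sets *)

(** Peeling off the derivative that is taken first permits inductions on the order for products,
    inverses and exponentials, which the lists of directions in [smooth_open] do not offer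
    directly. *)
Fixpoint Ck (R : realType) (m k : nat) (O : set 'rV[R]_m.+1)
    (f : 'rV[R]_m.+1 -> R) : Prop :=
  (forall x, O x -> {for x, continuous f}) /\
  if k is k'.+1 then
    (forall x a, O x -> derivable f x (delta_mx 0 a)) /\
    forall a, Ck k' O ('D_(delta_mx 0 a) f)
  else True.

Lemma iter_partial_rcons (R : realType) (m : nat) s a (f : 'rV[R]_m.+1 -> R) :
  iter_partial (rcons s a) f = iter_partial s ('D_(delta_mx 0 a) f).
Proof. by rewrite /iter_partial foldr_rcons. Qed.

Lemma smooth_open_Ck (R : realType) (m : nat) (O : set 'rV[R]_m.+1) f :
  smooth_open O f <-> forall k, Ck k O f.
Proof.
split=> [fO k|fO s].
  elim: k f fO => [|k IH] f fO /=.
    by split=> // x Ox; have [] := fO [::] x Ox.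
  split; first by move=> x Ox; have [] := fO [::] x Ox.
  split=> [x a Ox|a]; first by have [_] := fO [::] x Ox; apply.
  by apply: IH => s x Ox; rewrite -iter_partial_rcons; exact: fO.
(* [iter_partial] differentiates first in the last direction of the list, hence the induction from
   the end. *)
elim/last_ind: s f fO => [|s a IH] f fO x Ox.
  by have [fc [df _]] := fO 1%N; split=> [|a]; [exact: fc|exact: df].
rewrite iter_partial_rcons; apply: IH => // k.
by have [_ [_]] := fO k.+1; apply.
Qed.

Lemma CkW (R : realType) (m k : nat) (O : set 'rV[R]_m.+1) f :
  Ck k.+1 O f -> Ck k O f.
Proof.
elim: k f => [|k IH] f; first by case.
by move=> [fc [df Df]]; split=> //; split=> // a; exact/IH/Df.
Qed.

Lemma near_open (T : topologicalType) (O : set T) (P : T -> Prop) (x : T) :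
  open O -> O x -> (forall y, O y -> P y) -> \forall y \near x, P y.
Proof. by move=> oO Ox OP; exact: (filterS OP (open_nbhs_nbhs (conj oO Ox))). Qed.

Lemma Ck_ext (R : realType) (m k : nat) (O : set 'rV[R]_m.+1) f g :
  open O -> (forall x, O x -> f x = g x) -> Ck k O f -> Ck k O g.
Proof.
move=> oO.
have cont (f' g' : 'rV[R]_m.+1 -> R) : (forall x, O x -> f' x = g' x) ->
    (forall x, O x -> {for x, continuous f'}) ->
    forall x, O x -> {for x, continuous g'}.
  move=> fg fc x Ox; rewrite /prop_for /continuous_at -fg//.
  apply: cvg_trans (fc x Ox).
  apply: (@near_eq_cvg _ _ (nbhs x) (nbhs_filter x)).
  exact: (near_open oO Ox fg).
elim: k f g => [|k IH] f g fg [fc fk]; split; try exact: cont fg fc.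
  by [].
move: fk => [df Df]; split=> [x a Ox|a].
  by apply: near_eq_derivable (df x a Ox); exact: near_open oO Ox fg.
apply: IH (Df a) => x Ox; apply: near_eq_derive; exact: near_open oO Ox fg.
Qed.

Lemma Ck_differentiable (R : realType) (m k : nat) (O : set 'rV[R]_m.+1) f x :
  open O -> Ck k.+1 O f -> O x -> differentiable f x /\
  forall w, 'D_w f x = \sum_a w 0 a * 'D_(delta_mx 0 a) f x.
Proof.
move=> oO [_ [df Df]] Ox; apply: C1_differentiable.
  by apply: near_open oO Ox _ => y Oy a; exact: df.
by move=> a; case: k Df => [|k] /(_ a)[+ _]; exact.
Qed.

Lemma Ck_cst (R : realType) (m k : nat) (O : set 'rV[R]_m.+1) (c : R) :
  Ck k O (fun=> c).
Proof.
elim: k c => [|k IH] c; first by split=> // x Ox; exact: cst_continuous.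
split=> [x Ox|]; first exact: cst_continuous.
split=> [x a Ox|a]; first exact: derivable_cst.
rewrite (_ : 'D__ _ = fun=> 0); first exact: IH.
by apply/funext => x; exact: derive_cst.
Qed.

Lemma CkD (R : realType) (m k : nat) (O : set 'rV[R]_m.+1) f g :
  open O -> Ck k O f -> Ck k O g -> Ck k O (fun x => f x + g x).
Proof.
move=> oO; elim: k f g => [|k IH] f g [fc fk] [gc gk]; split; try by
  move=> x Ox; apply: (@continuousD _ _ _ f g); [exact: fc|exact: gc].
  by [].
move: fk gk => [df Df] [dg Dg]; split=> [x a Ox|a].
  by apply: (@derivableD _ _ _ f g); [exact: df|exact: dg].
apply: Ck_ext (IH _ _ (Df a) (Dg a)) => // x Ox.
by rewrite (@deriveD _ _ _ f g)//; [exact: df|exact: dg].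
Qed.

Lemma CkM (R : realType) (m k : nat) (O : set 'rV[R]_m.+1) f g :
  open O -> Ck k O f -> Ck k O g -> Ck k O (fun x => f x * g x).
Proof.
move=> oO; elim: k f g => [|k IH] f g fk gk.
  case: fk gk => [fc _] [gc _]; split=> // x Ox.
  by apply: (@continuousM _ _ f g); [exact: fc|exact: gc].
have [fc [df Df]] := fk; have [gc [dg Dg]] := gk.
split=> [x Ox|]; first by apply: (@continuousM _ _ f g); [exact: fc|exact: gc].
split=> [x a Ox|a].
  by apply: (@derivableM _ _ f g); [exact: df|exact: dg].
apply: Ck_ext (CkD oO (IH _ _ (CkW fk) (Dg a)) (IH _ _ (CkW gk) (Df a))) => //.
move=> x Ox; rewrite (@deriveM _ _ f g)//; [exact: df|exact: dg].
Qed.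

Lemma CkV (R : realType) (m k : nat) (O : set 'rV[R]_m.+1) f :
  open O -> (forall x, O x -> f x != 0) -> Ck k O f ->
  Ck k O (fun x => (f x)^-1).
Proof.
move=> oO f0; elim: k f f0 => [|k IH] f f0 fk.
  case: fk => [fc _]; split=> // x Ox.
  by apply: (@continuousV _ _ f); [exact: f0|exact: fc].
have [fc [df Df]] := fk.
split=> [x Ox|]; first by apply: (@continuousV _ _ f); [exact: f0|exact: fc].
have f1 := IH _ f0 (CkW fk).
split=> [x a Ox|a].
  by apply: (@derivableV _ _ f); [exact: f0|exact: df].
apply: Ck_ext (CkM oO (CkM oO (Ck_cst k O (-1)) (CkM oO f1 f1)) (Df a)) => //.
move=> x Ox; rewrite (@deriveV _ _ f)//; [|exact: f0|exact: df].
by rewrite /GRing.scale /= mulN1r -exprVn expr2.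
Qed.

Lemma Ck_expR (R : realType) (m k : nat) (O : set 'rV[R]_m.+1) f :
  open O -> Ck k O f -> Ck k O (fun x => expR (f x)).
Proof.
move=> oO.
have cont f' : (forall x, O x -> {for x, continuous f'}) ->
    forall x, O x -> {for x, continuous (fun x => expR (f' x))}.
  by move=> fc x Ox; apply: continuous_comp; [exact: fc|exact: continuous_expR].
elim: k f => [|k IH] f fk; first by case: fk => [fc _]; split=> //; exact: cont.
have [fc [df Df]] := fk; split; first exact: cont.
have dexp x : O x -> differentiable (expR \o f) x /\
    forall w, 'D_w (expR \o f) x = expR (f x) * 'D_w f x.
  move=> Ox; have [dfx _] := Ck_differentiable oO fk Ox.
  by apply: differentiable_comp1.
split=> [x a Ox|a].
  by have [+ _] := dexp x Ox; exact: diff_derivable.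
apply: Ck_ext (CkM oO (IH _ (CkW fk)) (Df a)) => // x Ox.
by have [_ ->] := dexp x Ox.
Qed.

(** * Smooth functions on relatively open subsets of the half-space, the model of chart images *)

Definition rel_open (R : realType) (m : nat) (A : set 'rV[R]_m.+1) : Prop :=
  exists2 O : set 'rV[R]_m.+1, open O & A = O `&` @half_space R m.

(** Shrinking by the open set that defines [A] makes the extension agree with [f] at all points of
    the half-space in [O], as [has_partials] requires. *)
Lemma smooth_on_extension (R : realType) (m : nat) (A : set 'rV[R]_m.+1) f x :
  rel_open A -> smooth_on A f -> A x ->
  exists (O : set 'rV[R]_m.+1) g, [/\ open O, O x, forall k, Ck k O g,
    O `&` @half_space R m `<=` A &
    forall y, O y -> @half_space R m y -> f y = g y].
Proof.
move=> [U oU ->] sf Ax; have [ O [g [oO Ox sg fg]]] := sf x Ax.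
exists (O `&` U), g; split.
- exact: openI.
- by split=> //; case: Ax.
- by apply/smooth_open_Ck => s y [Oy _]; exact: sg.
- by move=> y [[_ Uy] Hy].
- by move=> y [Oy Uy] Hy; exact: fg.
Qed.

Lemma smooth_on_half_space (R : realType) (m : nat) (A : set 'rV[R]_m.+1) x :
  rel_open A -> A x -> @half_space R m x.
Proof. by move=> [ O _ ->] []. Qed.

Lemma rel_open_near (R : realType) (m : nat) (A : set 'rV[R]_m.+1) x :
  rel_open A -> A x -> \forall y \near x, @half_space R m y -> A y.
Proof. by move=> [ O oO ->] [Ox Hx]; apply: (near_open oO Ox) => y Oy Hy. Qed.

Lemma extension_has_partials (R : realType) (m k : nat) (O : set 'rV[R]_m.+1)
    f g x :
  open O -> Ck k.+1 O g -> (forall y, O y -> @half_space R m y -> f y = g y) ->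
  O x -> has_partials f x (fun a => 'D_(delta_mx 0 a) g x).
Proof.
move=> oO gk fg Ox; have [dg _] := Ck_differentiable oO gk Ox.
by exists g; split=> //; exact: (near_open oO Ox).
Qed.

Lemma extension_pd (R : realType) (m k : nat) (O : set 'rV[R]_m.+1) f g x a :
  open O -> Ck k.+1 O g -> (forall y, O y -> @half_space R m y -> f y = g y) ->
  O x -> @half_space R m x -> pd a f x = 'D_(delta_mx 0 a) g x.
Proof.
move=> oO gk fg Ox Hx.
exact: has_partials_pd Hx (extension_has_partials oO gk fg Ox).
Qed.

(** A local form, for the overlaps of charts: only the shape of [B] near [x] is required. *)
Lemma near_has_partials (R : realType) (m : nat) (B : set 'rV[R]_m.+1) f x :
  smooth_on B f -> B x -> half_space x ->
  (\forall y \near x, @half_space R m y -> B y) ->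
  has_partials f x (fun a => pd a f x).
Proof.
move=> sf Bx Hx nB; have [U [k [oU Ux /smooth_open_Ck sk fk]]] := sf x Bx.
have [dk _] := Ck_differentiable oU (sk 1%N) Ux.
have hf : has_partials f x (fun a => 'D_(delta_mx 0 a) k x).
  exists k; split => //.
  apply: filterS2 nB (open_nbhs_nbhs (conj oU Ux)) => y BY Uy Hy.
  by apply: fk => //; exact: BY.
apply: (has_partials_ext _ _ hf) => [|a]; first exact: filterE.
by rewrite (has_partials_pd _ Hx hf).
Qed.

Lemma smooth_on_has_partials (R : realType) (m : nat) (A : set 'rV[R]_m.+1) f x :
  rel_open A -> smooth_on A f -> A x -> has_partials f x (fun a => pd a f x).
Proof.
move=> rA sf Ax; have Hx := smooth_on_half_space rA Ax.
exact: near_has_partials sf Ax Hx (rel_open_near rA Ax).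
Qed.

Lemma smooth_on_pd (R : realType) (m : nat) (A : set 'rV[R]_m.+1) f a :
  rel_open A -> smooth_on A f -> smooth_on A (pd a f).
Proof.
move=> rA sf x Ax; have [ O [g [oO Ox gk OA fg]]] := smooth_on_extension rA sf Ax.
exists O, ('D_(delta_mx 0 a) g); split=> //.
  by apply/smooth_open_Ck => k; have [_ [_]] := gk k.+1; exact.
move=> y Oy Ay; apply: (extension_pd _ oO (gk 1%N) fg Oy).
exact: smooth_on_half_space Ay.
Qed.

(** Both sides are mixed derivatives of one smooth extension, so the symmetry persists at boundary
    points. *)
Lemma pdC (R : realType) (m : nat) (A : set 'rV[R]_m.+1) f a b x :
  rel_open A -> smooth_on A f -> A x -> pd a (pd b f) x = pd b (pd a f) x.
Proof.
move=> rA sf Ax; have [ O [g [oO Ox gk OA fg]]] := smooth_on_extension rA sf Ax.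
have Hx := smooth_on_half_space rA Ax.
have DE c e : pd e (pd c f) x = 'D_(delta_mx 0 e) ('D_(delta_mx 0 c) g) x.
  apply: (@extension_pd _ _ 0 O) => //.
    by have [_ [_]] := gk 2%N; exact.
  by move=> y Oy Hy; exact: (extension_pd _ oO (gk 1%N) fg).
have d1 c : \forall y \near x, derivable g y (delta_mx 0 c).
  by apply: (near_open oO Ox) => y Oy; have [_ [+ _]] := gk 1%N; exact.
have d2 c e : \forall y \near x, derivable ('D_(delta_mx 0 c) g) y (delta_mx 0 e).
  apply: (near_open oO Ox) => y Oy; have [_ [_ Dg]] := gk 2%N.
  by have [_ [+ _]] := Dg c; exact.
have c2 c e : {for x, continuous ('D_(delta_mx 0 e) ('D_(delta_mx 0 c) g))}.
  have [_ [_ Dg]] := gk 2%N; have [_ [_ DDg]] := Dg c.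
  by have [+ _] := DDg e; exact.
by rewrite !DE; exact: derive_comm.
Qed.

Lemma smooth_on_ext (R : realType) (m : nat) (A : set 'rV[R]_m.+1) f g :
  (forall x, A x -> f x = g x) -> smooth_on A f -> smooth_on A g.
Proof.
move=> fg sf x Ax; have [ O [k [oO Ox sk fk]]] := sf x Ax.
by exists O, k; split=> // y Oy Ay; rewrite -fg// fk.
Qed.

Lemma smooth_on_cst (R : realType) (m : nat) (A : set 'rV[R]_m.+1) c :
  smooth_on A (fun=> c).
Proof.
move=> x Ax; exists setT, (fun=> c); split=> //; first exact: openT.
by apply/smooth_open_Ck => k; exact: Ck_cst.
Qed.

Lemma smooth_onD (R : realType) (m : nat) (A : set 'rV[R]_m.+1) f g :
  smooth_on A f -> smooth_on A g -> smooth_on A (fun x => f x + g x).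
Proof.
move=> sf sg x Ax; have [ O [f' [oO Ox sf' ff']]] := sf x Ax.
have [U [g' [oU Ux sg' gg']]] := sg x Ax.
exists (O `&` U), (fun y => f' y + g' y); split=> //; first exact: openI.
  apply/smooth_open_Ck => k; apply: CkD; first exact: openI.
    by apply/smooth_open_Ck: k => s y [Oy Uy]; exact: sf'.
  by apply/smooth_open_Ck: k => s y [Oy Uy]; exact: sg'.
by move=> y [Oy Uy] Ay; rewrite ff'// gg'.
Qed.

Lemma smooth_onM (R : realType) (m : nat) (A : set 'rV[R]_m.+1) f g :
  smooth_on A f -> smooth_on A g -> smooth_on A (fun x => f x * g x).
Proof.
move=> sf sg x Ax; have [ O [f' [oO Ox sf' ff']]] := sf x Ax.
have [U [g' [oU Ux sg' gg']]] := sg x Ax.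
exists (O `&` U), (fun y => f' y * g' y); split=> //; first exact: openI.
  apply/smooth_open_Ck => k; apply: CkM; first exact: openI.
    by apply/smooth_open_Ck: k => s y [Oy Uy]; exact: sf'.
  by apply/smooth_open_Ck: k => s y [Oy Uy]; exact: sg'.
by move=> y [Oy Uy] Ay; rewrite ff'// gg'.
Qed.

Lemma smooth_onN (R : realType) (m : nat) (A : set 'rV[R]_m.+1) f :
  smooth_on A f -> smooth_on A (fun x => - f x).
Proof.
move=> sf; apply: smooth_on_ext (smooth_onM (@smooth_on_cst _ _ A (-1)) sf).
by move=> x _; rewrite mulN1r.
Qed.

Lemma smooth_onV (R : realType) (m : nat) (A : set 'rV[R]_m.+1) f :
  (forall x, A x -> f x != 0) -> smooth_on A f -> smooth_on A (fun x => (f x)^-1).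
Proof.
move=> f0 sf x Ax; have [ O [f' [oO Ox /smooth_open_Ck sf' ff']]] := sf x Ax.
(* Off [A] the extension may vanish; it is restricted to the open set where it does not. *)
pose U := O `&` [set y | f' y != 0].
have fc y : O y -> {for y, continuous f'} by have [+ _] := sf' 0%N; exact.
have oU : open U.
  rewrite openE => y [Oy f'y]; apply: filterI; first exact: open_nbhs_nbhs.
  have n0 : nbhs (f' y) [set z : R | z != 0].
    by apply: open_nbhs_nbhs; split => //; exact: open_neq.
  exact: (fc y Oy _ n0).
have UO : U `<=` O by move=> y [].
have UCk k : Ck k U f'.
  by apply/smooth_open_Ck: k => s y /UO; move/smooth_open_Ck: sf'; exact.
exists U, (fun y => (f' y)^-1); split=> //.
- by split=> //=; rewrite -ff'//; exact: f0.
- by apply/smooth_open_Ck => k; apply: CkV => // y [].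
- by move=> y [Oy _] Ay; rewrite ff'.
Qed.

Lemma smooth_on_expR (R : realType) (m : nat) (A : set 'rV[R]_m.+1) f :
  smooth_on A f -> smooth_on A (fun x => expR (f x)).
Proof.
move=> sf x Ax; have [ O [f' [oO Ox /smooth_open_Ck sf' ff']]] := sf x Ax.
exists O, (fun y => expR (f' y)); split=> //.
  by apply/smooth_open_Ck => k; exact: Ck_expR.
by move=> y Oy Ay; rewrite ff'.
Qed.

Lemma smooth_on_sum (R : realType) (m : nat) (A : set 'rV[R]_m.+1)
    (I : Type) (r : seq I) (P : pred I) (f : I -> 'rV[R]_m.+1 -> R) :
  (forall i, P i -> smooth_on A (f i)) ->
  smooth_on A (fun x => \sum_(i <- r | P i) f i x).
Proof.
move=> sf; elim: r => [|i r IH].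
  by apply: smooth_on_ext (@smooth_on_cst _ _ A 0) => x _; rewrite big_nil.
case Pi: (P i).
  apply: smooth_on_ext (smooth_onD (sf i Pi) IH) => x _.
  by rewrite big_cons Pi.
by apply: smooth_on_ext IH => x _; rewrite big_cons Pi.
Qed.

Lemma smooth_on_prod (R : realType) (m : nat) (A : set 'rV[R]_m.+1)
    (I : Type) (r : seq I) (P : pred I) (f : I -> 'rV[R]_m.+1 -> R) :
  (forall i, P i -> smooth_on A (f i)) ->
  smooth_on A (fun x => \prod_(i <- r | P i) f i x).
Proof.
move=> sf; elim: r => [|i r IH].
  by apply: smooth_on_ext (@smooth_on_cst _ _ A 1) => x _; rewrite big_nil.
case Pi: (P i).
  apply: smooth_on_ext (smooth_onM (sf i Pi) IH) => x _.
  by rewrite big_cons Pi.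
by apply: smooth_on_ext IH => x _; rewrite big_cons Pi.
Qed.

Lemma smooth_on_det (R : realType) (m k : nat) (A : set 'rV[R]_m.+1)
    (g : 'rV[R]_m.+1 -> 'M[R]_k) :
  (forall i j, smooth_on A (fun x => g x i j)) ->
  smooth_on A (fun x => \det (g x)).
Proof.
move=> sg; apply: smooth_on_sum => s _.
by apply: smooth_onM; [exact: smooth_on_cst|apply: smooth_on_prod].
Qed.

(** Cramer's rule: the adjugate divided by the determinant. *)
Lemma smooth_on_invmx (R : realType) (m k : nat) (A : set 'rV[R]_m.+1)
    (g : 'rV[R]_m.+1 -> 'M[R]_k) :
  (forall i j, smooth_on A (fun x => g x i j)) ->
  (forall x, A x -> g x \in unitmx) ->
  forall i j, smooth_on A (fun x => invmx (g x) i j).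
Proof.
move=> sg gu i j.
apply: smooth_on_ext (smooth_onM (smooth_onV _ (smooth_on_det sg)) (f := _)
  (g := fun x => cofactor (g x) j i) _).
- by move=> x Ax; rewrite /invmx gu// !mxE.
- by move=> x /gu; rewrite unitmxE unitfE.
- apply: smooth_onM; first exact: smooth_on_cst.
  apply: smooth_on_det => a b.
  by apply: smooth_on_ext (sg (lift j a) (lift i b)) => x _; rewrite !mxE.
Qed.

Lemma smooth_on_comp_continuous (R : realType) (m : nat) (A : set 'rV[R]_m.+1)
    f (T : topologicalType) (c : T -> 'rV[R]_m.+1) (p : T) :
  smooth_on A f -> {for p, continuous c} -> (\forall q \near p, A (c q)) ->
  {for p, continuous (f \o c)}.
Proof.
move=> sf cc Ac.
have [U [g [oU Ux /(_ [::] _ Ux)[/= gc _] fg]]] := sf _ (nbhs_singleton Ac).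
have gcc : {for p, continuous (g \o c)} by exact: continuous_comp cc gc.
have fgc : \forall q \near p, (g \o c) q = (f \o c) q.
  have cU : \forall q \near p, U (c q).
    by apply: cc; apply: open_nbhs_nbhs.
  by apply: filterS2 Ac cU => q Aq Uq /=; rewrite fg.
rewrite /prop_for /continuous_at -(nbhs_singleton fgc).
by apply: cvg_trans gcc; exact: near_eq_cvg.
Qed.

(** * Calculus on relatively open sets of the half-space *)

Section PartialRules.
Variables (R : realType) (m : nat) (A : set 'rV[R]_m.+1) (x : 'rV[R]_m.+1).
Hypotheses (rA : rel_open A) (Ax : A x).
Implicit Types (f g : 'rV[R]_m.+1 -> R) (a b : 'I_m.+1).

Let Hx : half_space x := smooth_on_half_space rA Ax.

Lemma eq_pd f g a : smooth_on A f -> (forall y, A y -> f y = g y) ->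
  pd a f x = pd a g x.
Proof.
move=> sf fg; apply/esym; apply: (has_partials_pd (d := fun a => pd a f x)) => //.
apply: has_partials_ext (smooth_on_has_partials rA sf Ax) => //.
by apply: filterS (rel_open_near rA Ax) => y + Hy => /(_ Hy)/fg.
Qed.

Lemma pd_cst (k : R) a : pd a (fun=> k) x = 0.
Proof. exact: has_partials_pd (has_partials_cst k x). Qed.

Lemma pdD f g a : smooth_on A f -> smooth_on A g ->
  pd a (fun y => f y + g y) x = pd a f x + pd a g x.
Proof.
move=> sf sg; apply: (has_partials_pd (d := fun a => pd a f x + pd a g x)) => //.
apply: (has_partialsD (d := fun a => pd a f x) (e := fun a => pd a g x));
  exact: (smooth_on_has_partials rA).
Qed.

Lemma pdM f g a : smooth_on A f -> smooth_on A g ->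
  pd a (fun y => f y * g y) x = pd a f x * g x + f x * pd a g x.
Proof.
move=> sf sg.
apply: (has_partials_pd (d := fun a => pd a f x * g x + f x * pd a g x)) => //.
apply: (has_partialsM (d := fun a => pd a f x) (e := fun a => pd a g x)) => //;
  exact: (smooth_on_has_partials rA).
Qed.

Lemma pdZ (k : R) f a : smooth_on A f -> pd a (fun y => k * f y) x = k * pd a f x.
Proof.
by move=> sf; rewrite pdM ?pd_cst ?mul0r ?add0r//; exact: smooth_on_cst.
Qed.

Lemma pdN f a : smooth_on A f -> pd a (fun y => - f y) x = - pd a f x.
Proof.
move=> sf; rewrite -mulN1r -pdZ//; apply: eq_pd; first exact: smooth_onN.
by move=> y _; rewrite mulN1r.
Qed.

Lemma pd_sum (I : Type) (r : seq I) (P : pred I) (f : I -> 'rV[R]_m.+1 -> R) a :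
  (forall i, P i -> smooth_on A (f i)) ->
  pd a (fun y => \sum_(i <- r | P i) f i y) x = \sum_(i <- r | P i) pd a (f i) x.
Proof.
move=> sf; elim: r => [|i r IH].
  rewrite big_nil -[RHS](pd_cst 0 a); congr (pd a _ x).
  by apply/funext => y; rewrite big_nil.
rewrite big_cons -IH.
have -> : (fun y => \sum_(j <- i :: r | P j) f j y) =
    (fun y => if P i then f i y + \sum_(j <- r | P j) f j y
              else \sum_(j <- r | P j) f j y).
  by apply/funext => y; rewrite big_cons.
by case Pi: (P i) => //; rewrite pdD//; [exact: sf|exact: smooth_on_sum].
Qed.

Lemma pd_comp1 (p : R -> R) (e : R) f a : smooth_on A f ->
  is_derive (f x) 1 p e -> pd a (p \o f) x = e * pd a f x.
Proof.
move=> sf pe; apply: (has_partials_pd (d := fun a => e * pd a f x)) => //.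
by apply: has_partials_comp1 => //; exact: (smooth_on_has_partials rA).
Qed.

End PartialRules.

(** * Derivative tests at a maximum, possibly on the boundary hyperplane *)

Section MaximumTest.
Variables (R : realType) (m : nat) (A : set 'rV[R]_m.+1) (x : 'rV[R]_m.+1).
Hypotheses (rA : rel_open A) (Ax : A x).
Variable (f : 'rV[R]_m.+1 -> R).
Hypotheses (sf : smooth_on A f) (fmax : forall y, A y -> f y <= f x).

Let line_cvg (w : 'rV[R]_m.+1) : (x + t *: w) @[t --> (0 : R)^'+] --> x.
Proof.
rewrite -[X in _ --> X]addr0 -(scale0r w); apply: cvgD; first exact: cvg_cst.
by apply: cvgZr_tmp; apply: cvg_at_right_filter; exact: cvg_id.
Qed.

Let near_inward (w : 'rV[R]_m.+1) : 0 <= w 0 ord0 \/ 0 < x 0 ord0 ->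
  \forall t \near 0^'+, A (x + t *: w).
Proof.
move=> w0.
have line := @line_cvg w.
have At : \forall t \near 0^'+, half_space (x + t *: w) -> A (x + t *: w).
  exact: line (rel_open_near rA Ax).
suff Ht : \forall t \near 0^'+, half_space (x + t *: w).
  by apply: filterS2 Ht At => t Ht; apply.
case: w0 => [w0|x0].
  apply: filterS (nbhs_right_gt (0 : R)) => t t0.
  rewrite /half_space /= !mxE addr_ge0//; last by rewrite mulr_ge0// ltW.
  exact: (smooth_on_half_space rA Ax).
have : \forall y \near x, half_space y.
  have := @matrix_normedtype.coord_continuous R 1 m.+1 0 ord0 x.
  move/cvgr_gt => /(_ _ x0); apply: filterS => y; exact: ltW.
exact: line.
Qed.

(** The extension is bounded by its value at [x] only inside the half-space, so the tests must
    follow rays that stay there. *)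
Let extension_max (U : set 'rV[R]_m.+1) g (w : 'rV[R]_m.+1) :
  open U -> U x -> (forall y, U y -> half_space y -> f y = g y) ->
  0 <= w 0 ord0 \/ 0 < x 0 ord0 ->
  \forall t \near 0^'+, g (x + t *: w) <= g x.
Proof.
move=> oU Ux fg w0.
have Ut : \forall t \near 0^'+, U (x + t *: w).
  by apply: (@line_cvg w); exact: open_nbhs_nbhs.
have H := @smooth_on_half_space _ _ A _ rA.
apply: filterS2 Ut (near_inward w0) => t Ut At.
by rewrite -!fg//; [exact: fmax|exact: H|exact: H].
Qed.

Lemma max_first_order (w : 'rV[R]_m.+1) : 0 <= w 0 ord0 \/ 0 < x 0 ord0 ->
  \sum_a w 0 a * pd a f x <= 0.
Proof.
move=> w0; have [U [g [oU Ux gk UA fg]]] := smooth_on_extension rA sf Ax.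
have Hx := smooth_on_half_space rA Ax.
have [dg Dg] := Ck_differentiable oU (gk 1%N) Ux.
have -> : \sum_a w 0 a * pd a f x = 'D_w g x.
  by rewrite Dg; apply: eq_bigr => a _; rewrite (extension_pd _ oU (gk 1%N) fg).
apply: first_order_max; first exact: diff_derivable.
exact: extension_max oU Ux fg w0.
Qed.

(* On the boundary hyperplane inward directions suffice, the Hessian form being
   even. *)
Lemma max_second_order (w : 'rV[R]_m.+1) : (forall a, pd a f x = 0) ->
  \sum_a \sum_b w 0 a * w 0 b * pd a (pd b f) x <= 0.
Proof.
move=> f0.
wlog w0 : w / 0 <= w 0 ord0.
  move=> H; have /orP[/H//|w0] := le_total 0 (w 0 ord0).
  have := H (- w); rewrite mxE oppr_ge0 => /(_ w0).
  congr (_ <= _); apply: eq_bigr => a _; apply: eq_bigr => b _.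
  by rewrite !mxE mulrNN.
have [U [g [oU Ux gk UA fg]]] := smooth_on_extension rA sf Ax.
have Hx := smooth_on_half_space rA Ax.
have Dg y : U y -> 'D_w g y = \sum_a w 0 a * 'D_(delta_mx 0 a) g y.
  by move=> Uy; have [_ ->] := Ck_differentiable oU (gk 1%N) Uy.
have dDg a : differentiable ('D_(delta_mx 0 a) g) x /\
    forall v, 'D_v ('D_(delta_mx 0 a) g) x =
      \sum_b v 0 b * 'D_(delta_mx 0 b) ('D_(delta_mx 0 a) g) x.
  have [_ [_ DDg]] := gk 2%N.
  by apply: (@Ck_differentiable _ _ 0 U); rewrite //; exact: DDg.
have DE a b : pd a (pd b f) x = 'D_(delta_mx 0 a) ('D_(delta_mx 0 b) g) x.
  apply: (@extension_pd _ _ 0 U) => //.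
    by have [_ [_]] := gk 2%N; exact.
  by move=> y Uy Hy; exact: (extension_pd _ oU (gk 1%N) fg).
pose S : 'rV[R]_m.+1 -> R := \sum_a (w 0 a *: 'D_(delta_mx 0 a) g).
have SE : \forall y \near x, S y = 'D_w g y.
  apply: (near_open oU Ux) => y Uy; rewrite Dg// /S fct_sumE.
  by apply: eq_bigr.
have dS : is_derive x w S (\sum_a (w 0 a *: 'D_w ('D_(delta_mx 0 a) g) x)).
  apply: is_derive_sum => a; apply: is_deriveZ; apply: DeriveDef => //.
  by apply: diff_derivable; have [] := dDg a.
have -> : \sum_a \sum_b w 0 a * w 0 b * pd a (pd b f) x = 'D_w ('D_w g) x.
  rewrite -(near_eq_derive _ SE) (derive_val (is_derive := dS)) exchange_big /=.
  apply: eq_bigr => b _; have [_ ->] := dDg b; rewrite scaler_sumr.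
  by apply: eq_bigr => a _; rewrite DE [w 0 a * _]mulrC -mulrA.
apply: second_order_max.
- apply: (near_open oU Ux) => y Uy; apply: diff_derivable.
  by have [] := Ck_differentiable oU (gk 1%N) Uy.
- by apply: near_eq_derivable SE _; exact: (ex_derive (is_derive := dS)).
- by apply: extension_max oU Ux fg _; left.
- by rewrite Dg// big1// => a _; rewrite -(extension_pd a oU (gk 1%N) fg)// f0 mulr0.
Qed.

End MaximumTest.

(** A ball intersected with the half-space is convex: the segment from [x] to [y] stays in [A], and
    the mean value theorem applies to the extension along it. *)
Lemma pd0_locally_constant (R : realType) (m : nat) (A : set 'rV[R]_m.+1) x f :
  rel_open A -> A x -> smooth_on A f -> (forall a y, A y -> pd a f y = 0) ->
  \forall y \near x, A y -> f y = f x.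
Proof.
move=> rA Ax sf f0.
have [U [g [oU Ux gk UA fg]]] := smooth_on_extension rA sf Ax.
have Hx := smooth_on_half_space rA Ax.
have /nbhs_ballP[r /= r0 rU] := open_nbhs_nbhs (conj oU Ux).
apply/nbhs_ballP; exists r => // y xy Ay.
have Hy := smooth_on_half_space rA Ay.
have seg t : 0 <= t <= 1 -> ball x r (x + t *: (y - x)).
  move=> /andP[t0 t1]; rewrite -ball_normE /= opprD addrA subrr sub0r normrN normrZ.
  rewrite ger0_norm//; apply: le_lt_trans (_ : `|y - x| < r); first by rewrite ler_piMl.
  by move: xy; rewrite -ball_normE /= distrC.
have segH t : 0 <= t <= 1 -> half_space (x + t *: (y - x)).
  move=> /andP[t0 t1]; rewrite /half_space /= !mxE.
  have -> : x 0 ord0 + t * (y 0 ord0 - x 0 ord0) =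
    (1 - t) * x 0 ord0 + t * y 0 ord0 by ring.
  by rewrite addr_ge0// mulr_ge0// subr_ge0.
have dg t : 0 <= t <= 1 -> differentiable g (x + t *: (y - x)) /\
    'D_(y - x) g (x + t *: (y - x)) = 0.
  move=> t01; have Uz := rU _ (seg t t01).
  have [dz Dz] := Ck_differentiable oU (gk 1%N) Uz; split=> //.
  rewrite Dz big1// => a _.
  rewrite -(extension_pd a oU (gk 1%N) fg Uz (segH t t01)) f0 ?mulr0//.
  by apply: UA; split => //; exact: segH.
have [|t t01] := @mvt_line R _ g x (y - x) 1.
  by move=> t; rewrite mulr1 => /dg[+ _]; exact: diff_derivable.
have [|_] := dg t; first by have /andP[/ltW -> /ltW ->] := t01.
rewrite mulr1 => -> /eqP; rewrite mulr0 scale1r addrCA subrr addr0 subr_eq0.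
by move=> /eqP E; rewrite !fg//; exact: rU.
Qed.

(** * Positive definite forms *)

(** Gram-Schmidt, by induction on the Schur complement of the first entry, which is again symmetric
    and positive definite. *)
Lemma orthonormal_frame (R : rcfType) (n : nat) (g : 'M[R]_n) :
  g^T = g -> (forall u : 'rV_n, u != 0 -> 0 < (u *m g *m u^T) 0 0) ->
  exists P : 'M[R]_n, P *m g *m P^T = 1%:M.
Proof.
elim: n g => [|n IH] g gs gp; first by exists 0; apply/matrixP => -[].
rewrite -[n.+1]/(1 + n)%N in g gs gp *.
set a := (ulsubmx g) 0 0; set b := ursubmx g; set c := drsubmx g.
have gE : g = block_mx a%:M b b^T c.
  by rewrite -[LHS]submxK -mx11_scalar /b trmx_ursub gs.
have a0 : 0 < a.
  have := gp (row_mx 1%:M 0); rewrite gE mul_row_block tr_row_mx mul_row_col.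
  rewrite !mul1mx !mul0mx !addr0 trmx0 mulmx0 addr0 trmx1 mulmx1 mxE eqxx; apply.
  rewrite -row_mx0; apply/eqP => /eq_row_mx[/matrixP/(_ 0 0)/eqP].
  by rewrite !mxE oner_eq0.
(* The elimination column: conjugation by [E] clears the off-diagonal blocks of [g]. *)
pose e : 'cV[R]_n := - a^-1 *: b^T.
pose E : 'M[R]_(1 + n) := block_mx 1%:M 0 e 1%:M.
have ae : e *m a%:M + b^T = 0.
  by rewrite mul_mx_scalar scalerA mulrN divff ?gt_eqF// scaleN1r addNr.
have cs : c^T = c by rewrite /c trmx_drsub gs.
have EgE : E *m g *m E^T = block_mx a%:M 0 0 (e *m b + c).
  rewrite gE mulmx_block !mul1mx !mul0mx !addr0 ae tr_block_mx trmx0 !trmx1.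
  rewrite mulmx_block !mulmx1 !mulmx0 !addr0 !mul0mx !add0r.
  congr block_mx; apply: trmx_inj; rewrite linearD /= trmx_mul trmxK tr_scalar_mx trmx0.
  exact: ae.
have [|v v0|P' P'E] := IH (e *m b + c).
- by rewrite linearD /= trmx_mul cs /e linearZ /= trmxK -scalemxAl -scalemxAr.
- have := gp (row_mx 0 v *m E); rewrite trmx_mul !mulmxA.
  rewrite -(mulmxA (row_mx 0 v) E g) -(mulmxA (row_mx 0 v)) EgE.
  have -> : row_mx (0 : 'rV[R]_1) v *m block_mx a%:M 0 0 (e *m b + c)
      *m (row_mx 0 v)^T = v *m (e *m b + c) *m v^T.
    rewrite mul_row_block !mul0mx !mulmx0 !add0r tr_row_mx mul_row_col.
    by rewrite mul0mx add0r.
  apply; rewrite /E mul_row_block !mul0mx !mulmx1 !add0r -row_mx0; apply: contra_neq v0.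
  by case/eq_row_mx.
pose D : 'M[R]_(1 + n) := block_mx (Num.sqrt a)^-1%:M 0 0 P'.
have DD : D *m block_mx a%:M 0 0 (e *m b + c) *m D^T = 1%:M.
  rewrite /D tr_block_mx !trmx0 tr_scalar_mx !mulmx_block.
  rewrite !(mul0mx, mulmx0, addr0, add0r) P'E -!scalar_mxM [RHS]scalar_mx_block.
  congr (block_mx _%:M _ _ _).
  by rewrite mulrAC -expr2 exprVn sqr_sqrtr ?ltW// mulVf ?gt_eqF.
exists (D *m E); rewrite trmx_mul !mulmxA.
by rewrite -(mulmxA D E g) -(mulmxA D) EgE.
Qed.

Section PositiveForm.
Variables (R : rcfType) (n : nat) (g : 'M[R]_n).
Hypotheses (gs : g^T = g) (gp : forall u : 'rV_n, u != 0 -> 0 < (u *m g *m u^T) 0 0).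

Lemma posdef_unitmx : g \in unitmx.
Proof.
rewrite -row_free_unit -kermx_eq0; apply/eqP/row_matrixP => i; rewrite row0.
apply/eqP/negPn/negP => /gp; rewrite -row_mul mulmx_ker row0 mul0mx mxE.
by rewrite ltxx.
Qed.

Lemma invmx_frame : exists P : 'M[R]_n, invmx g = P^T *m P.
Proof.
have [P PE] := orthonormal_frame gs gp; exists P.
have /mulmx1_unit[Pu _] : P *m (g *m P^T) = 1%:M by rewrite mulmxA.
have gu := posdef_unitmx.
have PPg : P^T *m P *m g = 1%:M.
  have H : g *m P^T *m P = 1%:M.
    by apply/(can_inj (mulKmx Pu)); rewrite !mulmxA PE mul1mx mulmx1.
  by apply: trmx_inj; rewrite !trmx_mul trmxK gs mulmxA H trmx1.
by rewrite -[LHS]mul1mx -PPg mulmxK.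
Qed.

(** Writing $g^{-1} = P^T P$, the trace is the sum of the squared entries of the symmetric matrix $P
    S P^T$. *)
Lemma tr_sym_sq_ge0 (S : 'M[R]_n) : S^T = S ->
  0 <= \tr (S *m invmx g *m (S *m invmx g)).
Proof.
move=> Ss; have [P ->] := invmx_frame; pose M := P *m S *m P^T.
have -> : \tr (S *m (P^T *m P) *m (S *m (P^T *m P))) = \tr (M *m M^T).
  rewrite /M !trmx_mul trmxK Ss -!mulmxA [RHS]mxtrace_mulC.
  by rewrite -!mulmxA.
rewrite /mxtrace; apply: sumr_ge0 => i _; rewrite mxE; apply: sumr_ge0 => j _.
by rewrite [M^T _ _]mxE -expr2 sqr_ge0.
Qed.

(** For [xi] the differential of a function, this is the inverse of the metric induced on its graph.
    As $K^T K$, its contraction with a bilinear form is a sum of values of the form on the rows of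
    [K]. *)
Lemma tangential_frame (xi : 'rV[R]_n) (X := xi *m invmx g)
    (w := 1 + (X *m xi^T) 0 0) :
  exists K : 'M[R]_n, invmx g - w^-1 *: (X^T *m X) = K^T *m K.
Proof.
have [P gP] := invmx_frame; pose z := xi *m P^T.
pose u := (z *m z^T) 0 0.
have XE : X = z *m P by rewrite /X gP mulmxA.
have wE : w = 1 + u by rewrite /w XE /u /z trmx_mul trmxK !mulmxA.
have u0 : 0 <= u.
  rewrite /u mxE; apply: sumr_ge0 => j _; rewrite [z^T _ _]mxE -expr2; exact: sqr_ge0.
have w0 : 0 < w by rewrite wE ltr_wpDr.
pose r := Num.sqrt w; have r0 : 0 < r by rewrite sqrtr_gt0.
have r2 : r ^+ 2 = 1 + u by rewrite sqr_sqrtr ?ltW.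
(* [C] is the square root of [1 - w^-1 z^T z]. *)
pose bt := (r * (r + 1))^-1.
pose C := 1%:M - bt *: (z^T *m z).
exists (C *m P).
have Cs : C^T = C by rewrite linearB /= trmx1 linearZ /= trmx_mul trmxK.
rewrite [(C *m P)^T]trmx_mul Cs gP XE [(z *m P)^T]trmx_mul [RHS]mulmxA.
rewrite -[P^T *m C *m C]mulmxA.
have -> : C *m C = 1%:M - w^-1 *: (z^T *m z).
  have ZZ : z^T *m z *m (z^T *m z) = u *: (z^T *m z).
    by rewrite -mulmxA [z *m _]mulmxA [z *m z^T]mx11_scalar -/u mul_scalar_mx -scalemxAr.
  rewrite /C mulmxBl mul1mx -scalemxAl mulmxBr mulmx1 -scalemxAr ZZ.
  (* This equation dictates [bt]: its root $(1 - 1/r)/u$ equals $1/(r(r+1))$ as $u = r^2 - 1$, and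
     the latter form makes sense for $u = 0$ too. *)
  have -> : w^-1 = bt * 2 - bt ^+ 2 * u.
    rewrite wE -r2 /bt; move: r0 r2; move: (r) (u) => r' u' r0 /eqP.
    rewrite [1 + _]addrC -subr_eq => /eqP <-; field.
    by rewrite !lt0r_neq0// addr_gt0.
  by apply/matrixP => a b; rewrite !mxE; ring.
by rewrite mulmxBr mulmx1 mulmxBl -scalemxAr -scalemxAl !mulmxA.
Qed.

(* [T - (lam / u) xi^T X] is again self-adjoint, so that the trace of its square
   is nonnegative. *)
Lemma eigenvalue_sq_le_tr (T : 'M[R]_n) (xi : 'rV[R]_n) (lam : R)
    (X := xi *m invmx g) (u := (X *m xi^T) 0 0) :
  (T *m g)^T = T *m g -> X *m T = lam *: X -> u != 0 ->
  lam ^+ 2 <= \tr (T *m T).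
Proof.
move=> Ts XT u0; have gu := posdef_unitmx.
pose k := lam / u; pose N := T - k *: (xi^T *m X).
have Ns : (N *m g)^T = N *m g.
  rewrite mulmxBl linearB /= Ts; congr (_ - _).
  rewrite -scalemxAl -mulmxA /X mulmxKV// linearZ /= trmx_mul trmxK //.
have := tr_sym_sq_ge0 Ns; rewrite mulmxK//.
have Xxi : X *m xi^T = u%:M by rewrite [LHS]mx11_scalar.
have t0 : \tr (xi^T *m X) = u by rewrite mxtrace_mulC Xxi mxtrace_scalar mulr1n.
have t1 : \tr (xi^T *m X *m T) = lam * u.
  by rewrite -mulmxA XT -scalemxAr mxtraceZ t0.
have t3 : \tr (xi^T *m X *m (xi^T *m X)) = u * u.
  by rewrite -mulmxA [X *m _]mulmxA Xxi mul_scalar_mx -scalemxAr mxtraceZ t0.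
have -> : \tr (N *m N) = \tr (T *m T) - lam ^+ 2.
  rewrite /N mulmxBl !mulmxBr -!scalemxAl -!scalemxAr.
  rewrite !raddfB /= !mxtraceZ [\tr (T *m (_ *m _))]mxtrace_mulC t1 t3 /k.
  by field.
by rewrite subr_ge0.
Qed.

End PositiveForm.

(** * The Bochner formula *)

Lemma exchange_big4 (R : nmodType) (I J K L : finType)
    (F : I -> J -> K -> L -> R) :
  \sum_i \sum_j \sum_k \sum_l F i j k l = \sum_k \sum_l \sum_i \sum_j F i j k l.
Proof.
transitivity (\sum_(p : I * J) \sum_(q : K * L) F p.1 p.2 q.1 q.2).
  by rewrite pair_bigA; apply: eq_bigr => p _; rewrite pair_bigA.
by rewrite exchange_big [RHS]pair_bigA; apply: eq_bigr => q _; rewrite pair_bigA.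
Qed.

(* [G a b k] stands for $\Gamma^k_{ab}$, [T l k] for $\nabla_l X^k$, and the
   prefixes [d], [dd] for partial derivatives, whose indices come first. *)
Lemma bochner_algebra (R : comNzRingType) (n : nat) (x : 'I_n -> R)
    (dX T S : 'I_n -> 'I_n -> R) (ddX G : 'I_n -> 'I_n -> 'I_n -> R)
    (dG : 'I_n -> 'I_n -> 'I_n -> 'I_n -> R) :
  (forall a b k, G a b k = G b a k) -> (forall a b k, ddX a b k = ddX b a k) ->
  (forall l k, S l k = \sum_m G l m k * x m) ->
  (forall l k, T l k = dX l k + S l k) ->
  \sum_l \sum_k (dX l k * T k l + x k *
       (ddX l k l + \sum_m (dG l k m l * x m + G k m l * dX l m)))
    + \sum_l \sum_m G l m l * (\sum_k x k * T k m)
  = \sum_l \sum_k T l k * T k l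
    + \sum_k x k * (\sum_l (ddX k l l + \sum_m (dG k l m l * x m + G l m l * dX k m)))
    + \sum_b \sum_c (\sum_a (dG a b c a - dG b a c a
        + \sum_e (G a e a * G b c e - G b e a * G a c e))) * x b * x c.
Proof.
move=> Gs ddXs SE TE.
have S' l k : S l k = \sum_m x m * G m l k.
  by rewrite SE; apply: eq_bigr => m _; rewrite Gs mulrC.
(* Both sides are expanded into these sums: [c1], [c2] contain derivatives of [G], [k1], [k2] are
   quadratic in [G], and [e1], [e2] mix [G] with [dX]. Once [T] is expanded as [dX + S] in [f1] and
   [q1], everything matches. *)
set r1 := \sum_l \sum_k T l k * T k l.
pose q1 := \sum_l \sum_k S l k * T k l.
pose d1 := \sum_l \sum_k x k * ddX l k l.
pose c1 := \sum_l \sum_k \sum_m x k * (dG l k m l * x m).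
pose e1 := \sum_l \sum_m S m l * dX l m.
pose f1 := \sum_l \sum_m \sum_k G l m l * (x k * T k m).
pose c2 := \sum_l \sum_k \sum_m x k * (dG k l m l * x m).
pose e2 := \sum_l \sum_m \sum_k G l m l * (x k * dX k m).
pose k1 := \sum_l \sum_m \sum_k G l m l * (x k * S k m).
pose k2 := \sum_l \sum_m S m l * S l m.
have L1 : \sum_l \sum_k (dX l k * T k l + x k *
       (ddX l k l + \sum_m (dG l k m l * x m + G k m l * dX l m)))
    = r1 - q1 + (d1 + (c1 + e1)).
  have -> : e1 = \sum_l \sum_k \sum_m x k * (G k m l * dX l m).
    apply: eq_bigr => l _; rewrite exchange_big; apply: eq_bigr => m _ /=.
    by rewrite S' mulr_suml; apply: eq_bigr => k _; rewrite mulrA.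
  rewrite /r1 /q1 /d1 /c1 -sumrB -!big_split /=; apply: eq_bigr => l _.
  rewrite -sumrB -!big_split /=; apply: eq_bigr => k _.
  rewrite mulrDr mulr_sumr -big_split /= (TE l k) mulrDl addrK; congr (_ + (_ + _)).
  by apply: eq_bigr => m _; rewrite mulrDr.
have L2 : \sum_l \sum_m G l m l * (\sum_k x k * T k m) = f1.
  by rewrite /f1; do 2! (apply: eq_bigr => ? _); rewrite mulr_sumr.
have R1 : \sum_k x k * (\sum_l (ddX k l l + \sum_m (dG k l m l * x m + G l m l * dX k m)))
    = d1 + (c2 + e2).
  have -> : e2 = \sum_l \sum_k \sum_m x k * (G l m l * dX k m).
    apply: eq_bigr => l _; rewrite exchange_big /=; do 2! (apply: eq_bigr => ? _).
    by rewrite mulrCA.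
  under [LHS]eq_bigr do rewrite mulr_sumr.
  rewrite exchange_big /d1 /c2 -!big_split /=; apply: eq_bigr => l _.
  rewrite -!big_split /=; apply: eq_bigr => k _.
  rewrite (ddXs k l) mulrDr mulr_sumr -big_split /=; congr (_ + _).
  by apply: eq_bigr => m _; rewrite mulrDr.
have R2 : \sum_b \sum_c (\sum_a (dG a b c a - dG b a c a
        + \sum_e (G a e a * G b c e - G b e a * G a c e))) * x b * x c
    = c1 - c2 + (k1 - k2).
  have -> : c1 = \sum_b \sum_c \sum_a dG a b c a * x b * x c.
    rewrite /c1; under eq_bigr do under eq_bigr do under eq_bigr do
      rewrite mulrCA mulrA.
    rewrite exchange_big /=; apply: eq_bigr => b _.
    by rewrite exchange_big.
  have -> : c2 = \sum_b \sum_c \sum_a dG b a c a * x b * x c.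
    rewrite /c2; under eq_bigr do under eq_bigr do under eq_bigr do
      rewrite mulrCA mulrA.
    rewrite exchange_big /=; apply: eq_bigr => b _.
    by rewrite exchange_big.
  have -> : k1 = \sum_b \sum_c \sum_a \sum_e G a e a * G b c e * x b * x c.
    rewrite exchange_big4 /k1; do 2! (apply: eq_bigr => ? _).
    apply: eq_bigr => k _; rewrite SE 2!mulr_sumr; apply: eq_bigr => p _.
    by ring.
  have -> : k2 = \sum_b \sum_c \sum_a \sum_e G b e a * G a c e * x b * x c.
    rewrite exchange_big4 /k2; apply: eq_bigr => l _; apply: eq_bigr => m _.
    rewrite S' mulr_suml; apply: eq_bigr => b _; rewrite SE mulr_sumr.
    by apply: eq_bigr => c _; ring.
  rewrite -!sumrB -big_split /=; apply: eq_bigr => b _.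
  rewrite -!sumrB -big_split /=; apply: eq_bigr => c _.
  rewrite -!sumrB -big_split /= !mulr_suml; apply: eq_bigr => a _.
  rewrite -sumrB !mulrDl !mulr_suml !mulNr; congr (_ + _).
  by apply: eq_bigr => e _; rewrite !mulrBl.
rewrite L1 L2 R1 R2.
have Q : f1 = k1 + e2.
  rewrite /f1 /k1 /e2 -big_split /=; apply: eq_bigr => l _.
  rewrite -big_split /=; apply: eq_bigr => m _.
  rewrite -big_split /=; apply: eq_bigr => k _.
  by rewrite TE; ring.
have Q' : q1 = e1 + k2.
  rewrite /q1 /e1 /k2 -big_split /= exchange_big /=; apply: eq_bigr => l _.
  rewrite -big_split /=; apply: eq_bigr => m _.
  by rewrite TE mulrDr.
by rewrite Q Q'; ring.
Qed.

Definition cov_deriv (R : realType) (m : nat) (g : 'rV[R]_m.+1 -> 'M[R]_m.+1)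
    (X : 'rV[R]_m.+1 -> 'rV[R]_m.+1) (l k : 'I_m.+1) (y : 'rV[R]_m.+1) : R :=
  pd l (fun z => X z 0 k) y + \sum_a christoffel g l a k y * X y 0 a.

Lemma covariantE (R : realType) (m : nat) (g : 'rV[R]_m.+1 -> 'M[R]_m.+1) X Y k y :
  covariant g X Y y 0 k = \sum_a X y 0 a * cov_deriv g Y a k y.
Proof.
rewrite mxE -big_split /=; apply: eq_bigr => a _.
rewrite mulrDr mulr_sumr; congr (_ + _); apply: eq_bigr => b _.
by rewrite mulrCA mulrA.
Qed.

Lemma gradE (R : realType) (m : nat) (g : 'rV[R]_m.+1 -> 'M[R]_m.+1) f y b :
  grad g f y 0 b = \sum_l pd l f y * invmx (g y) l b.
Proof. by rewrite mxE; apply: eq_bigr => l _; rewrite mxE. Qed.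

(** Gathers what a chart image and its Gram matrix provide, so that the local computations take
    place in the half-space without reference to a manifold. *)
Definition local_metric (R : realType) (m : nat) (A : set 'rV[R]_m.+1)
    (g : 'rV[R]_m.+1 -> 'M[R]_m.+1) : Prop :=
  [/\ rel_open A, forall a b, smooth_on A (fun y => g y a b),
    forall y, A y -> (g y)^T = g y &
    forall y u, A y -> u != 0 -> 0 < inner g y u u].

Section LocalGeometry.
Variables (R : realType) (m : nat) (A : set 'rV[R]_m.+1).
Variable (g : 'rV[R]_m.+1 -> 'M[R]_m.+1).
Hypothesis lm : local_metric A g.
Implicit Types (x y : 'rV[R]_m.+1) (a b k l : 'I_m.+1).

Let rA : rel_open A. Proof. by case: lm. Qed.
Let sg a b : smooth_on A (fun y => g y a b). Proof. by case: lm. Qed.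
Let gs y : A y -> (g y)^T = g y. Proof. by case: lm => _ _ + _; exact. Qed.
Let gp y u : A y -> u != 0 -> 0 < inner g y u u.
Proof. by case: lm => _ _ _; exact. Qed.

Lemma gram_unitmx y : A y -> g y \in unitmx.
Proof. by move=> Ay; apply: posdef_unitmx => u; exact: gp. Qed.

Let gu := gram_unitmx.

Let gsE y a b : A y -> g y a b = g y b a.
Proof. by move=> /gs/matrixP/(_ a b); rewrite mxE. Qed.

Lemma smooth_on_gram_inv a b : smooth_on A (fun y => invmx (g y) a b).
Proof. exact: smooth_on_invmx. Qed.

Lemma smooth_on_christoffel a b k : smooth_on A (christoffel g a b k).
Proof.
apply: smooth_onM; first exact: smooth_on_cst.
apply: smooth_on_sum => l _; apply: smooth_onM; first exact: smooth_on_gram_inv.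
apply: smooth_onD; last by apply: smooth_onN; exact: smooth_on_pd.
by apply: smooth_onD; exact: smooth_on_pd.
Qed.

Lemma smooth_on_cov_deriv X l k :
  smooth_row_on A X -> smooth_on A (cov_deriv g X l k).
Proof.
move=> sX; apply: smooth_onD; first exact: smooth_on_pd.
by apply: smooth_on_sum => a _; apply: smooth_onM => //; exact: smooth_on_christoffel.
Qed.

Lemma smooth_on_grad f : smooth_on A f -> smooth_row_on A (grad g f).
Proof.
move=> sf b.
apply: (@smooth_on_ext _ _ _ (fun y => \sum_a pd a f y * invmx (g y) a b)).
  by move=> y _; rewrite gradE.
apply: smooth_on_sum => a _; apply: smooth_onM; first exact: smooth_on_pd.
exact: smooth_on_gram_inv.
Qed.

Lemma christoffelC a b k x : A x -> christoffel g a b k x = christoffel g b a k x.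
Proof.
move=> Ax; rewrite /christoffel; congr (_ * _); apply: eq_bigr => l _.
congr (_ * _); rewrite [pd a _ x + _]addrC; congr (_ - _).
by apply: (eq_pd rA Ax) => // y Ay; exact: gsE.
Qed.

(** Contraction with [g] undoes the inverse matrix in [christoffel] and leaves the Koszul formula in
    coordinates. *)
Lemma christoffel_lower a b c x : A x ->
  \sum_k christoffel g a b k x * g x k c =
  2^-1 * (pd a (fun y => g y b c) x + pd b (fun y => g y a c) x
          - pd c (fun y => g y a b) x).
Proof.
move=> Ax; pose D l := pd a (fun y => g y b l) x + pd b (fun y => g y a l) x
  - pd l (fun y => g y a b) x.
rewrite -/(D c).
have -> : D c = \sum_l (\sum_k g x c k * invmx (g x) k l) * D l.
  rewrite (bigD1 c)//= [X in _ + X]big1 => [|l lc].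
    have /matrixP/(_ c c) := mulmxV (gu Ax); rewrite !mxE eqxx => ->.
    by rewrite mul1r addr0.
  have /matrixP/(_ c l) := mulmxV (gu Ax); rewrite !mxE eq_sym (negbTE lc) => ->.
  by rewrite mul0r.
rewrite mulr_sumr; under [RHS]eq_bigr do rewrite mulr_suml mulr_sumr.
rewrite exchange_big /=; apply: eq_bigr => k _.
rewrite /christoffel -mulrA mulr_suml mulr_sumr; apply: eq_bigr => l _.
by rewrite -/(D l) (gsE k c Ax); ring.
Qed.

Lemma grad_lower f b y : A y -> \sum_k grad g f y 0 k * g y k b = pd b f y.
Proof.
move=> Ay; have := congr1 (fun M : 'rV_ _ => M 0 b) (mulmxKV (gu Ay) (\row_a pd a f y)).
by rewrite !mxE.
Qed.

Lemma inner_grad f u y : A y -> inner g y (grad g f y) u = \sum_b pd b f y * u 0 b.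
Proof.
move=> Ay; rewrite /inner mulmxKV ?gu// mxE; apply: eq_bigr => b _.
by rewrite !mxE.
Qed.

(** This is $\mathrm{div}(D_X X) = \mathrm{tr}((\nabla X)^2) + X(\mathrm{div} X) +
    \mathrm{Ric}(X,X)$, valid for every field $X$; it becomes the usual formula once $D_X X =
    \nabla(|X|^2/2)$ is known for gradients. *)
Lemma bochner X x : smooth_row_on A X -> A x ->
  \sum_l pd l (fun y => covariant g X X y 0 l) x
    + \sum_l \sum_k christoffel g l k l x * covariant g X X x 0 k
  = \sum_l \sum_k cov_deriv g X l k x * cov_deriv g X k l x
    + \sum_k X x 0 k * pd k (fun y => \sum_l cov_deriv g X l l y) x
    + ricci g x (X x) (X x).
Proof.
move=> sX Ax.
have sG := smooth_on_christoffel; have sT l k := smooth_on_cov_deriv l k sX.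
have dT l k p : pd l (cov_deriv g X k p) x =
    pd l (pd k (fun y => X y 0 p)) x + \sum_c
      (pd l (christoffel g k c p) x * X x 0 c
       + christoffel g k c p x * pd l (fun y => X y 0 c) x).
  rewrite (pdD rA Ax); last first.
  - by apply: smooth_on_sum => c _; apply: smooth_onM.
  - exact: smooth_on_pd.
  rewrite (pd_sum rA Ax); last by move=> c _; apply: smooth_onM.
  by congr (_ + _); apply: eq_bigr => c _; rewrite (pdM rA Ax).
have dY l : pd l (fun y => covariant g X X y 0 l) x =
    \sum_k (pd l (fun y => X y 0 k) x * cov_deriv g X k l x
            + X x 0 k * pd l (cov_deriv g X k l) x).
  transitivity (pd l (fun y => \sum_k X y 0 k * cov_deriv g X k l y) x).
    by congr (pd l _ x); apply/funext => y; rewrite covariantE.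
  rewrite (pd_sum rA Ax); last by move=> k _; apply: smooth_onM.
  by apply: eq_bigr => k _; rewrite (pdM rA Ax).
have dtr k : pd k (fun y => \sum_l cov_deriv g X l l y) x
    = \sum_l (pd k (pd l (fun y => X y 0 l)) x + \sum_c
      (pd k (christoffel g l c l) x * X x 0 c
       + christoffel g l c l x * pd k (fun y => X y 0 c) x)).
  by rewrite (pd_sum rA Ax)//; apply: eq_bigr => l _; rewrite dT.
under eq_bigr do rewrite dY.
under [X in _ + X = _]eq_bigr do under eq_bigr do rewrite covariantE.
under [X in _ = _ + X + _]eq_bigr do rewrite dtr.
rewrite /ricci /curvature.
have GC a b k : christoffel g a b k x = christoffel g b a k x.
  exact: christoffelC.
have XC a b k : pd a (pd b (fun y => X y 0 k)) x = pd b (pd a (fun y => X y 0 k)) x.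
  exact: pdC rA (sX k) Ax.
rewrite -(bochner_algebra (T := fun l k => cov_deriv g X l k x)
  (fun l a b k => pd l (christoffel g a b k) x) GC XC
  (fun _ _ => erefl) (fun _ _ => erefl)).
congr (_ + _); apply: eq_bigr => l _; apply: eq_bigr => k _.
by rewrite dT.
Qed.

End LocalGeometry.

(** * Gradient fields and the derivative of their squared norm *)

Definition gradient_energy (R : realType) (m : nat)
    (g : 'rV[R]_m.+1 -> 'M[R]_m.+1) (f : 'rV[R]_m.+1 -> R) (y : 'rV[R]_m.+1) : R :=
  2^-1 * inner g y (grad g f y) (grad g f y).

Section GradientField.
Variables (R : realType) (m : nat) (A : set 'rV[R]_m.+1).
Variables (g : 'rV[R]_m.+1 -> 'M[R]_m.+1) (f : 'rV[R]_m.+1 -> R).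
Hypotheses (lm : local_metric A g) (sf : smooth_on A f).
Implicit Types (x y : 'rV[R]_m.+1) (a b k l : 'I_m.+1).

Let rA : rel_open A. Proof. by case: lm. Qed.
Let sg a b : smooth_on A (fun y => g y a b). Proof. by case: lm. Qed.
Let gsE y a b : A y -> g y a b = g y b a.
Proof. by case: lm => _ _ /(_ y) + _ Ay => /(_ Ay)/matrixP/(_ a b); rewrite mxE. Qed.
Let X := grad g f.
Let sX : smooth_row_on A X := smooth_on_grad lm sf.
Let T := cov_deriv g X.

Lemma gradient_energyE y : A y ->
  gradient_energy g f y = 2^-1 * \sum_k X y 0 k * pd k f y.
Proof.
move=> Ay; rewrite /gradient_energy (inner_grad lm)//; congr (_ * _).
by apply: eq_bigr => k _; rewrite mulrC.
Qed.

Lemma smooth_on_gradient_energy : smooth_on A (gradient_energy g f).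
Proof.
apply: (smooth_on_ext (f := fun y => 2^-1 * \sum_k X y 0 k * pd k f y)).
  by move=> y Ay; rewrite gradient_energyE.
apply: smooth_onM; first exact: smooth_on_cst.
by apply: smooth_on_sum => k _; apply: smooth_onM => //; exact: smooth_on_pd.
Qed.

Let dgC a b c x : A x -> pd c (fun y => g y a b) x = pd c (fun y => g y b a) x.
Proof. by move=> Ax; apply: (eq_pd rA Ax) => // y Ay; exact: gsE. Qed.

Let christoffel_term a b x : A x ->
  \sum_k (\sum_c christoffel g a c k x * X x 0 c) * g x k b =
  \sum_c X x 0 c * (2^-1 * (pd a (fun y => g y c b) x + pd c (fun y => g y a b) x
     - pd b (fun y => g y a c) x)).
Proof.
move=> Ax; under [LHS]eq_bigr do rewrite mulr_suml.
rewrite exchange_big /=; apply: eq_bigr => c _.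
rewrite -(christoffel_lower lm)// mulr_sumr; apply: eq_bigr => k _.
by rewrite mulrCA mulrA.
Qed.

Let cov_deriv_lower a b x : A x ->
  \sum_k T a k x * g x k b = \sum_k pd a (fun y => X y 0 k) x * g x k b
    + \sum_c X x 0 c * (2^-1 * (pd a (fun y => g y c b) x + pd c (fun y => g y a b) x
     - pd b (fun y => g y a c) x)).
Proof.
move=> Ax; rewrite -christoffel_term// -big_split /=; apply: eq_bigr => k _.
by rewrite mulrDl.
Qed.

(** Differentiating $X^k g_{kd} = \partial_d f$ shows that $\nabla X$ with its index lowered is
    $\partial_c\partial_d f$ minus a Christoffel term, and both are symmetric in [c] and [d]. *)
Lemma hessian_symmetric a b x : A x ->
  \sum_k T a k x * g x k b = \sum_k T b k x * g x k a.
Proof.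
move=> Ax.
have E c d : \sum_k T c k x * g x k d = pd c (pd d f) x - \sum_k X x 0 k *
    (2^-1 * (pd c (fun y => g y k d) x + pd d (fun y => g y k c) x
      - pd k (fun y => g y c d) x)).
  have -> : pd c (pd d f) x = pd c (fun y => \sum_k X y 0 k * g y k d) x.
    apply: (eq_pd rA Ax); first exact: smooth_on_pd.
    by move=> y Ay; rewrite (grad_lower lm).
  rewrite (pd_sum rA Ax); last by move=> k _; apply: smooth_onM.
  rewrite cov_deriv_lower// -sumrB -big_split /=; apply: eq_bigr => k _.
  by rewrite (pdM rA Ax)// (dgC c k d Ax); field.
rewrite !E (pdC _ _ rA sf Ax); congr (_ - _); apply: eq_bigr => k _.
by rewrite (dgC a b k Ax); ring.
Qed.

(** Compatibility of the connection with the metric: the right side is $\langle\nabla_b X,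
    X\rangle$. *)
Lemma pd_gradient_energy b x : A x ->
  pd b (gradient_energy g f) x = \sum_k T b k x * pd k f x.
Proof.
move=> Ax.
have -> : pd b (gradient_energy g f) x
    = pd b (fun y => 2^-1 * \sum_k \sum_l X y 0 k * X y 0 l * g y l k) x.
  apply: (eq_pd rA Ax); first exact: smooth_on_gradient_energy.
  move=> y Ay; rewrite gradient_energyE//; congr (_ * _); apply: eq_bigr => k _.
  rewrite -(grad_lower lm)// mulr_sumr; apply: eq_bigr => l _.
  by rewrite mulrA.
have s1 k l : smooth_on A (fun y => X y 0 k * X y 0 l * g y l k).
  by apply: smooth_onM => //; exact: smooth_onM.
rewrite (pdZ rA Ax); last by apply: smooth_on_sum => k _; apply: smooth_on_sum.
rewrite (pd_sum rA Ax); last by move=> k _; apply: smooth_on_sum.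
have -> : \sum_k T b k x * pd k f x = \sum_l X x 0 l * \sum_k T b k x * g x k l.
  under [RHS]eq_bigr do rewrite mulr_sumr.
  rewrite exchange_big /=; apply: eq_bigr => k _.
  rewrite -(grad_lower lm)// mulr_sumr; apply: eq_bigr => l _.
  by rewrite (gsE k l Ax); ring.
under [RHS]eq_bigr do rewrite cov_deriv_lower// mulrDr mulr_sumr mulr_sumr.
(* The product rule gives [d1] plus half of [d2]. The connection gives the same plus the two other
   derivatives of the metric, which cancel after contraction with $X \otimes X$: both contractions
   are [d3]. *)
pose d1 := \sum_l \sum_k X x 0 l * (pd b (fun y => X y 0 k) x * g x k l).
pose d2 := \sum_l \sum_k X x 0 l * (X x 0 k * pd b (fun y => g y k l) x).
pose d3 := \sum_l \sum_k X x 0 l * (X x 0 k * pd k (fun y => g y b l) x).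
have -> : \sum_k pd b (fun y => \sum_l X y 0 k * X y 0 l * g y l k) x = 2 * d1 + d2.
  have -> : 2 * d1 = d1 + \sum_l \sum_k X x 0 k * (pd b (fun y => X y 0 l) x * g x l k).
    by rewrite mulr_natl mulr2n [X in _ = _ + X]exchange_big.
  rewrite /d1 /d2 -!big_split /=; apply: eq_bigr => k _.
  rewrite (pd_sum rA Ax)// -!big_split /=; apply: eq_bigr => l _.
  rewrite (pdM rA Ax)//; last exact: smooth_onM.
  by rewrite (pdM rA Ax)// (gsE k l Ax); ring.
have d3' : d3 = \sum_l \sum_k X x 0 l * (X x 0 k * pd l (fun y => g y b k) x).
  by rewrite /d3 exchange_big; do 2! (apply: eq_bigr => ? _); rewrite mulrCA.
transitivity (d1 + (2^-1 * d2 + (2^-1 * d3 - 2^-1 * d3))); first by field.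
rewrite {2}d3' /d1 /d2 /d3 !mulr_sumr -sumrB -!big_split /=; apply: eq_bigr => l _.
rewrite !mulr_sumr -sumrB -!big_split /=; apply: eq_bigr => k _.
by ring.
Qed.

(** Since the Hessian is symmetric, $\langle D_X X, \partial_b\rangle = \langle \nabla_b X,
    X\rangle$, which is $\partial_b s$. This identity links both the Bochner formula and the
    convexity of the boundary to $\nabla s$. *)
Lemma covariant_grad x : A x -> covariant g X X x = grad g (gradient_energy g f) x.
Proof.
move=> Ax; have gu := gram_unitmx lm Ax.
rewrite -[LHS](mulmxK gu) /grad; congr (_ *m _); apply/rowP => b; rewrite !mxE.
rewrite pd_gradient_energy//.
under eq_bigr do rewrite covariantE mulr_suml.
rewrite exchange_big /=.
transitivity (\sum_k X x 0 k * \sum_l T b l x * g x l k).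
  apply: eq_bigr => k _; rewrite (hessian_symmetric b k Ax) mulr_sumr.
  by apply: eq_bigr => l _; rewrite mulrA.
under [LHS]eq_bigr do rewrite mulr_sumr.
rewrite exchange_big /=; apply: eq_bigr => l _.
rewrite -(grad_lower lm)// mulr_sumr; apply: eq_bigr => k _.
by rewrite (gsE k l Ax); ring.
Qed.

End GradientField.

(** * The maximum principle *)

(* At a critical point of $s + \varepsilon e^{Kf}$, where $X = \nabla f$ and
   $s = |X|^2/2$: here [u] is $|X|^2$, [tr] is $|\nabla^2 f|^2$, [D] is
   $\mathrm{div} X$, [P] is $X(s)$, [ric] is $\mathrm{Ric}(X,X)$, [hess] is
   $\nabla^2 h(X,X)$, [chi] is $\varepsilon K e^{Kf}$, [vp] and [vpp] are
   $v'(f)$ and $v''(f)$; [Xh], [XD] and [XP] are derivatives along $X$. *)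
Lemma maximum_inequality (R : rcfType) (u w r tr XD ric hess Xh P XP D c vp vpp H
    chi K : R) :
  0 < u -> w = 1 + u -> r = Num.sqrt w -> 0 < chi ->
  chi ^+ 2 <= tr -> P = - chi * u -> c * u <= ric - hess -> - vpp <= c ->
  D - P / w + Xh = vp - H * r ->
  XD - (XP / w - P * (2 * P) / w ^+ 2) + (hess - chi * Xh) = vpp * u - H * (P / r) ->
  (tr + XD + ric) + K * chi * u + chi * D
    - (XP + K * chi * u ^+ 2 + 2 * chi * P) / w <= 0 ->
  vp - H / r + K * (u / w) <= 0.
Proof.
move=> u0 wE rE chi0 trge PE BE cge E1 E2 Q.
have w0 : 0 < w by rewrite wE addr_gt0.
have r0 : 0 < r by rewrite rE sqrtr_gt0.
have r2 : w = r ^+ 2 by rewrite rE sqr_sqrtr ?ltW.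
have uE : u = r ^+ 2 - 1 by rewrite -r2 wE addrC addKr.
have {}E1 : D = vp - H * r - Xh + P / w by lra.
have {}E2 : XD = vpp * u - H * (P / r) + (XP / w - P * (2 * P) / w ^+ 2)
    - (hess - chi * Xh).
  by lra.
pose z := u / w.
have z0 : 0 <= z by rewrite divr_ge0 ?ltW.
have z1 : z <= 1 by rewrite ler_pdivrMr// mul1r wE lerDr.
(* Substitution eliminates [XP] and [Xh]. The first three groups are nonnegative by the eigenvalue
   bound and the two curvature bounds, the fourth because its quadratic factors as $(1-z)(1+2z)$
   with $0 \leq z \leq 1$; so the last one, [chi] times the quantity to be bounded, is
   nonpositive. *)
have QE : (tr + XD + ric) + K * chi * u + chi * D
    - (XP + K * chi * u ^+ 2 + 2 * chi * P) / w
  = (tr - chi ^+ 2) + (ric - hess - c * u) + (c + vpp) * u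
    + chi ^+ 2 * (1 + z - 2 * z ^+ 2) + chi * (vp - H / r + K * z).
  rewrite E1 E2 PE /z r2 uE.
  by field; rewrite lt0r_neq0.
rewrite QE in Q.
have h1 : 0 <= (c + vpp) * u by apply: mulr_ge0; [lra|exact: ltW].
have h2 : 0 <= chi ^+ 2 * (1 + z - 2 * z ^+ 2).
  apply: mulr_ge0; first exact: sqr_ge0.
  have -> : 1 + z - 2 * z ^+ 2 = (1 - z) * (1 + 2 * z) by ring.
  by apply: mulr_ge0; lra.
have : chi * (vp - H / r + K * z) <= 0 by lra.
by rewrite pmulr_rle0.
Qed.

Section MaximumPrinciple.
Variables (R : realType) (m : nat) (A : set 'rV[R]_m.+1).
Variables (g : 'rV[R]_m.+1 -> 'M[R]_m.+1) (f h : 'rV[R]_m.+1 -> R).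
Hypotheses (lm : local_metric A g) (sf : smooth_on A f) (sh : smooth_on A h).
Implicit Types (x y : 'rV[R]_m.+1) (a b k l : 'I_m.+1).

Let rA : rel_open A. Proof. by case: lm. Qed.
Let X := grad g f.
Let sX : smooth_row_on A X := smooth_on_grad lm sf.
Let T := cov_deriv g X.
Let s := gradient_energy g f.
Let ss : smooth_on A s := smooth_on_gradient_energy lm sf.
Let D y := \sum_l T l l y.
Let sT l k : smooth_on A (T l k) := smooth_on_cov_deriv lm l k sX.
Let sD : smooth_on A D.
Proof. exact: smooth_on_sum. Qed.
Let along (p : 'rV[R]_m.+1 -> R) y := \sum_b X y 0 b * pd b p y.
Let s_along (p : 'rV[R]_m.+1 -> R) : smooth_on A p -> smooth_on A (along p).
Proof.
move=> sp; apply: smooth_on_sum => b _; apply: smooth_onM => //.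
exact: smooth_on_pd.
Qed.
Let along_f y : A y -> along f y = 2 * s y.
Proof.
by move=> Ay; rewrite /s (gradient_energyE f lm)// mulrA divff ?mul1r ?pnatr_eq0.
Qed.
Let Y l y := covariant g X X y 0 l.
Let sY l : smooth_on A (Y l).
Proof.
apply: (smooth_on_ext (f := fun y => \sum_a X y 0 a * T a l y)).
  by move=> y _; rewrite -covariantE.
by apply: smooth_on_sum => a _; exact: smooth_onM.
Qed.

Variables (x : 'rV[R]_m.+1) (Ax : A x).

(** Brings in the Hessian of the weight. At a critical point the correction $(D_X X)(h)$ will be
    $-\chi X(h)$, which $\chi\,\mathrm{div} X$ compensates through the mean curvature equation. *)
Lemma along_along_hessian :
  along (along h) x = hessian g h x (X x) (X x)
    + \sum_b covariant g X X x 0 b * pd b h x.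
Proof.
have dal a : pd a (along h) x = \sum_b (pd a (fun y => X y 0 b) x * pd b h x
    + X x 0 b * pd a (pd b h) x).
  rewrite (pd_sum rA Ax); last first.
    by move=> b _; apply: smooth_onM => //; exact: smooth_on_pd.
  by apply: eq_bigr => b _; rewrite (pdM rA Ax)//; exact: smooth_on_pd.
rewrite /along -/along; under eq_bigr do rewrite dal mulr_sumr.
under [X in _ = _ + X]eq_bigr do rewrite covariantE mulr_suml.
rewrite [X in _ = _ + X]exchange_big /=.
rewrite /hessian.
have -> : \sum_a \sum_b (pd a (pd b h) x - \sum_k christoffel g a b k x * pd k h x)
     * X x 0 a * X x 0 b =
  \sum_a (\sum_b pd a (pd b h) x * X x 0 a * X x 0 b -
   \sum_b X x 0 a * (\sum_c christoffel g a c b x * X x 0 c) * pd b h x).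
  apply: eq_bigr => a _.
  have -> : \sum_b X x 0 a * (\sum_c christoffel g a c b x * X x 0 c) * pd b h x
    = \sum_b (\sum_k christoffel g a b k x * pd k h x) * X x 0 a * X x 0 b.
    under eq_bigr do rewrite mulr_sumr mulr_suml.
    rewrite exchange_big /=; apply: eq_bigr => b _.
    by rewrite !mulr_suml; apply: eq_bigr => k _; ring.
  by rewrite -sumrB; apply: eq_bigr => b _; ring.
rewrite -big_split /=; apply: eq_bigr => a _.
rewrite -sumrB -big_split /=; apply: eq_bigr => b _.
by rewrite /cov_deriv; ring.
Qed.

(** The hypothesis makes the nonzero vector $X$ an eigenvector of $\nabla X$, which is self-adjoint
    for [g]; the trace of its square bounds the square of any eigenvalue. *)
Lemma eigenvalue_trace (chi : R) : 0 < 2 * s x ->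
  (forall b, covariant g X X x 0 b = - chi * X x 0 b) ->
  chi ^+ 2 <= \sum_l \sum_k T l k x * T k l x.
Proof.
move=> u0 Ye; pose Tm := \matrix_(l, k) T l k x; pose xi := \row_a pd a f x.
have -> : \sum_l \sum_k T l k x * T k l x = \tr (Tm *m Tm).
  rewrite /mxtrace; apply: eq_bigr => l _; rewrite mxE; apply: eq_bigr => k _.
  by rewrite !mxE.
have gs : (g x)^T = g x by case: lm => _ _ + _; exact.
have gp : forall u : 'rV_m.+1, u != 0 -> 0 < (u *m g x *m u^T) 0 0.
  by case: lm => _ _ _ gp u; exact: gp.
rewrite -[chi ^+ 2]sqrrN; apply: (@eigenvalue_sq_le_tr _ _ (g x) gs gp Tm xi).
- apply/matrixP => a b; rewrite !mxE.
  under eq_bigr do rewrite mxE; under [RHS]eq_bigr do rewrite mxE.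
  exact: hessian_symmetric Ax.
- rewrite -[xi *m _]/(X x); apply/rowP => b; rewrite [LHS]mxE [RHS]mxE -Ye covariantE.
  by apply: eq_bigr => a _; rewrite [Tm _ _]mxE.
- rewrite -[xi *m _]/(X x) mxE.
  have -> : \sum_j X x 0 j * xi^T j 0 = 2 * s x.
    by rewrite -(along_f Ax); apply: eq_bigr => j _; rewrite !mxE.
  by rewrite gt_eqF.
Qed.

(** By [tangential_frame] the left side is the sum of the values of [B] on the rows of a matrix. *)
Lemma tangential_trace_le0 (B : 'I_m.+1 -> 'I_m.+1 -> R) :
  (forall w : 'rV[R]_m.+1, \sum_a \sum_b w 0 a * w 0 b * B a b <= 0) ->
  \sum_a \sum_b invmx (g x) a b * B a b
    - (\sum_a \sum_b X x 0 a * X x 0 b * B a b) / (1 + 2 * s x) <= 0.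
Proof.
move=> Bn; pose xi := \row_a pd a f x.
have gs : (g x)^T = g x by case: lm => _ _ + _; exact.
have gp : forall u : 'rV_m.+1, u != 0 -> 0 < (u *m g x *m u^T) 0 0.
  by case: lm => _ _ _ gp u; exact: gp.
have [K] := tangential_frame gs gp xi.
rewrite -[xi *m _]/(X x).
have -> : (X x *m xi^T) 0 0 = 2 * s x.
  by rewrite -(along_f Ax) mxE; apply: eq_bigr => j _; rewrite !mxE.
move=> KE.
have -> : \sum_a \sum_b invmx (g x) a b * B a b
    - (\sum_a \sum_b X x 0 a * X x 0 b * B a b) / (1 + 2 * s x)
  = \sum_a \sum_b (\sum_i K i a * K i b) * B a b.
  rewrite mulr_suml -sumrB; apply: eq_bigr => a _.
  rewrite mulr_suml -sumrB; apply: eq_bigr => b _.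
  have /matrixP/(_ a b) := KE; rewrite !mxE big_ord1 !mxE.
  under [X in _ = X -> _]eq_bigr do rewrite mxE.
  by move=> <-; ring.
have -> : \sum_a \sum_b (\sum_i K i a * K i b) * B a b
  = \sum_i \sum_a \sum_b K i a * K i b * B a b.
  rewrite [RHS]exchange_big; apply: eq_bigr => a _.
  by rewrite [RHS]exchange_big; apply: eq_bigr => b _; rewrite mulr_suml.
apply: sumr_le0 => i _; have := Bn (row i K).
by under eq_bigr do under eq_bigr do rewrite !mxE.
Qed.

Variables (eps K : R).
Let chi y := eps * K * expR (K * f y).
Let F y := s y + eps * expR (K * f y).
Let sKf : smooth_on A (fun y => K * f y).
Proof. by apply: smooth_onM => //; exact: smooth_on_cst. Qed.
Let sexp : smooth_on A (fun y => expR (K * f y)).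
Proof. exact: smooth_on_expR. Qed.
Let schi : smooth_on A chi.
Proof. by apply: smooth_onM => //; exact: smooth_on_cst. Qed.
Lemma smooth_on_barrier : smooth_on A F.
Proof. by apply: smooth_onD => //; apply: smooth_onM => //; exact: smooth_on_cst. Qed.

Let pd_exp a y : A y ->
  pd a (fun z => expR (K * f z)) y = expR (K * f y) * (K * pd a f y).
Proof.
move=> Ay; rewrite -(pdZ rA Ay)//.
exact: (pd_comp1 (p := expR) rA Ay a sKf (is_derive_expR (K * f y))).
Qed.

Let pd_chi a : pd a chi x = K * chi x * pd a f x.
Proof. by rewrite (pdZ rA Ax)// pd_exp// /chi; ring. Qed.

Lemma pd_barrier a y : A y -> pd a F y = pd a s y + chi y * pd a f y.
Proof.
move=> Ay; rewrite (pdD rA Ay)//; last by apply: smooth_onM => //; exact: smooth_on_cst.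
by rewrite (pdZ rA Ay)// pd_exp// /chi; congr (_ + _); ring.
Qed.

Hypothesis F0 : forall a, pd a F x = 0.

(** $0 = \nabla F = \nabla s + \chi X$, and $\nabla s = D_X X$. *)
Lemma critical_eigenvalue b : Y b x = - chi x * X x 0 b.
Proof.
rewrite /Y (covariant_grad lm)// !gradE mulr_sumr; apply: eq_bigr => l _.
have := F0 l; rewrite pd_barrier// => /eqP; rewrite addr_eq0 => /eqP ->.
by rewrite !mulNr mulrA.
Qed.

Lemma along_energy_critical : along s x = - chi x * (2 * s x).
Proof.
rewrite -along_f// mulr_sumr; apply: eq_bigr => l _.
have := F0 l; rewrite pd_barrier// => /eqP; rewrite addr_eq0 => /eqP ->.
by ring.
Qed.

(** Since $\nabla F$ vanishes at [x], derivatives of $g^{-1}$ do not contribute, and the coordinate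
    trace is the sum of the $\partial_l(\nabla F)^l$, where $\nabla F = D_X X + \chi X$ on all of
    [A]. *)
Lemma laplacian_critical :
  \sum_a \sum_b invmx (g x) a b * pd a (pd b F) x =
  \sum_l pd l (Y l) x + \sum_l \sum_k christoffel g l k l x * Y k x
  + K * chi x * (2 * s x) + chi x * D x.
Proof.
have E l : \sum_b invmx (g x) b l * pd b (pd l F) x
    = pd l (Y l) x + (K * chi x * (X x 0 l * pd l f x)
      + chi x * pd l (fun y => X y 0 l) x).
  have sgi b : smooth_on A (fun y => invmx (g y) b l) by exact: smooth_on_gram_inv.
  have sdF b : smooth_on A (pd b F) by exact: smooth_on_pd rA smooth_on_barrier.
  transitivity (pd l (fun y => \sum_b pd b F y * invmx (g y) b l) x).
    rewrite (pd_sum rA Ax); last by move=> b _; exact: smooth_onM.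
    apply: eq_bigr => b _; rewrite (pdM rA Ax)// F0 mul0r addr0 mulrC.
    by rewrite (pdC _ _ rA smooth_on_barrier Ax).
  transitivity (pd l (fun y => Y l y + chi y * X y 0 l) x).
    apply: (eq_pd rA Ax).
      by apply: smooth_on_sum => b _; exact: smooth_onM.
    move=> y Ay; rewrite /Y (covariant_grad lm)// !gradE mulr_sumr.
    rewrite -big_split /=; apply: eq_bigr => b _.
    by rewrite pd_barrier// mulrDl mulrA.
  rewrite (pdD rA Ax)//; last exact: smooth_onM.
  by rewrite (pdM rA Ax)// pd_chi; congr (_ + _); ring.
rewrite exchange_big /=; under eq_bigr do rewrite E.
rewrite !big_split /= -!mulr_sumr -/(along f x) along_f//.
(* The Christoffel terms of $\mathrm{div}(D_X X)$ and $\chi\,\mathrm{div} X$ are opposite, so the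
   partial derivatives can be completed to divergences. *)
have -> : \sum_l \sum_k christoffel g l k l x * Y k x
    = - (chi x * \sum_l \sum_k christoffel g l k l x * X x 0 k).
  rewrite mulr_sumr -sumrN; apply: eq_bigr => l _.
  rewrite mulr_sumr -sumrN; apply: eq_bigr => k _.
  by rewrite critical_eigenvalue; ring.
by rewrite /D /T /cov_deriv big_split /=; ring.
Qed.

(** As $F$ is critical, derivatives of $X$ do not contribute and the left side is $X(X(F))$, where
    $X(F) = X(s) + 2\chi s$. *)
Lemma second_derivative_along_critical :
  \sum_a \sum_b X x 0 a * X x 0 b * pd a (pd b F) x =
  along (along s) x + K * chi x * (2 * s x) ^+ 2 + 2 * chi x * along s x.
Proof.
have sdF b : smooth_on A (pd b F) by exact: smooth_on_pd rA smooth_on_barrier.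
have E a : \sum_b X x 0 b * pd a (pd b F) x = pd a (along s) x
    + (K * chi x * (2 * s x) * pd a f x + 2 * chi x * pd a s x).
  transitivity (pd a (along F) x).
    rewrite (pd_sum rA Ax); last by move=> b _; exact: smooth_onM.
    by apply: eq_bigr => b _; rewrite (pdM rA Ax)// F0 mulr0 add0r.
  transitivity (pd a (fun y => along s y + chi y * (2 * s y)) x).
    apply: (eq_pd rA Ax); first exact: (s_along smooth_on_barrier).
    move=> y Ay; rewrite -along_f// /along mulr_sumr -big_split /=.
    by apply: eq_bigr => b _; rewrite pd_barrier//; ring.
  have s2 : smooth_on A (fun y => 2 * s y).
    by apply: smooth_onM => //; exact: smooth_on_cst.
  rewrite (pdD rA Ax) //; [|exact: s_along|exact: smooth_onM].
  by rewrite (pdM rA Ax)// (pdZ rA Ax)// pd_chi; congr (_ + _); ring.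
transitivity (\sum_a X x 0 a * \sum_b X x 0 b * pd a (pd b F) x).
  by apply: eq_bigr => a _; rewrite mulr_sumr; apply: eq_bigr => b _; rewrite mulrA.
under eq_bigr do rewrite E !mulrDr.
rewrite !big_split /= -addrA; congr (_ + (_ + _)).
  rewrite (_ : K * chi x * _ ^+ 2 = K * chi x * (2 * s x) * along f x).
    by rewrite mulr_sumr; apply: eq_bigr => a _; ring.
  by rewrite along_f// expr2 mulrA.
by rewrite mulr_sumr; apply: eq_bigr => a _; ring.
Qed.

Variables (vp : R -> R) (vpp H c : R).
Hypothesis mean_curvature_eq : forall y, A y ->
  D y - along s y / (1 + 2 * s y) + along h y
  = vp (f y) - H * Num.sqrt (1 + 2 * s y).
Hypothesis dvp : is_derive (f x) 1 vp vpp.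
Hypothesis s0 : 0 < 2 * s x.

Let w0 : 0 < 1 + 2 * s x. Proof. by rewrite addr_gt0. Qed.

(** The mean curvature equation differentiated along $X$; it replaces $X(\mathrm{div} X)$ in the
    Bochner formula. *)
Lemma along_mean_curvature_eq :
  along D x - (along (along s) x / (1 + 2 * s x)
    - along s x * (2 * along s x) / (1 + 2 * s x) ^+ 2) + along (along h) x
  = vpp * (2 * s x) - H * (along s x / Num.sqrt (1 + 2 * s x)).
Proof.
have sw : smooth_on A (fun y => 1 + 2 * s y).
  by apply: smooth_onD; [|apply: smooth_onM => //]; exact: smooth_on_cst.
have w_gt0 y : A y -> 0 < 1 + 2 * s y.
  move=> Ay; rewrite /s /gradient_energy mulrA divff ?pnatr_eq0// mul1r.
  rewrite ltr_wpDr//; have [->|Xn0] := eqVneq (grad g f y) 0.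
    by rewrite /inner !mul0mx mxE.
  by case: lm => _ _ _ gp; rewrite ltW// gp.
have sV : smooth_on A (fun y => (1 + 2 * s y)^-1).
  by apply: smooth_onV => // y Ay; rewrite gt_eqF// w_gt0.
pose L y := D y + (- (along s y * (1 + 2 * s y)^-1) + along h y).
have dw a : pd a (fun y => 1 + 2 * s y) x = 2 * pd a s x.
  rewrite (pdD rA Ax); last 2 first.
  - exact: smooth_on_cst.
  - by apply: smooth_onM => //; exact: smooth_on_cst.
  by rewrite (pd_cst rA Ax) add0r (pdZ rA Ax).
have dV a : pd a (fun y => (1 + 2 * s y)^-1) x
    = - (2 * pd a s x) / (1 + 2 * s x) ^+ 2.
  have w1 y : A y -> (1 + 2 * s y) * (1 + 2 * s y)^-1 = 1.
    by move=> Ay; rewrite divff// gt_eqF// w_gt0.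
  have : pd a (fun y => (1 + 2 * s y) * (1 + 2 * s y)^-1) x = 0.
    rewrite -[RHS](pd_cst rA Ax 1 a); apply: (eq_pd rA Ax) => //.
    exact: smooth_onM.
  rewrite (pdM rA Ax)// dw => /eqP; rewrite addrC addr_eq0 => /eqP E.
  by apply: (mulfI (lt0r_neq0 w0)); rewrite E; field; rewrite lt0r_neq0.
have dL a : pd a L x = pd a D x - (pd a (along s) x / (1 + 2 * s x)
    - along s x * (2 * pd a s x) / (1 + 2 * s x) ^+ 2) + pd a (along h) x.
  have sP := s_along ss; have sQ := s_along sh.
  have s1 : smooth_on A (fun y => along s y * (1 + 2 * s y)^-1) by exact: smooth_onM.
  rewrite (pdD rA Ax)//; last by apply: smooth_onD => //; exact: smooth_onN.
  rewrite (pdD rA Ax)//; last exact: smooth_onN.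
  by rewrite (pdN rA Ax)// (pdM rA Ax)// dV; ring.
have sL : smooth_on A L.
  have sP := s_along ss; have sQ := s_along sh.
  apply: smooth_onD => //; apply: smooth_onD => //.
  by apply: smooth_onN; exact: smooth_onM.
(* Here [vp] is only known to be derivable at [f x], so the right side of the equation is
   differentiated through [has_partials] and not by the rules for smooth functions. *)
have rL a : pd a L x = vpp * pd a f x - H * (pd a s x / Num.sqrt (1 + 2 * s x)).
  have Hx := smooth_on_half_space rA Ax.
  pose d a := vpp * pd a f x + - H * ((2 * Num.sqrt (1 + 2 * s x))^-1 * (2 * pd a s x)).
  transitivity (d a); last first.
    rewrite /d; have r0 : Num.sqrt (1 + 2 * s x) != 0 by rewrite gt_eqF// sqrtr_gt0.
    by field.
  pose root := Num.sqrt \o (fun y => 1 + 2 * s y).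
  apply: (has_partials_pd (d := d)) => //.
  apply: (@has_partials_ext _ _ (fun y => (vp \o f) y + - H * root y) _ _ d) => //.
    apply: filterS (rel_open_near rA Ax) => y + Hy => /(_ Hy) Ay.
    by rewrite /L addrA mean_curvature_eq// mulNr.
  apply: has_partialsD.
    by apply: has_partials_comp1 => //; exact: (smooth_on_has_partials rA sf Ax).
  apply: (@has_partials_ext _ _ (fun y => (fun=> - H) y * root y) _ _ (fun a =>
    0 * root x + - H * ((2 * Num.sqrt (1 + 2 * s x))^-1 * (2 * pd a s x)))).
    exact: filterE.
    by move=> b; rewrite mul0r add0r.
  apply: has_partialsM => //; first exact: has_partials_cst.
  apply: (has_partials_comp1 (d := fun a => 2 * pd a s x)) => //.
    apply: has_partials_ext (smooth_on_has_partials rA sw Ax); first exact: filterE.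
    exact: dw.
  exact: is_derive1_sqrt.
have lin (p q r t : 'I_m.+1 -> R) (c1 c2 : R) :
    \sum_a X x 0 a * (p a + c1 * q a + c2 * r a + t a) =
    \sum_a X x 0 a * p a + c1 * (\sum_a X x 0 a * q a)
    + c2 * (\sum_a X x 0 a * r a) + \sum_a X x 0 a * t a.
  by rewrite !mulr_sumr -!big_split /=; apply: eq_bigr => a _; ring.
transitivity (\sum_a X x 0 a * pd a L x).
  rewrite (eq_bigr (fun a => X x 0 a * (pd a D x
    + - (1 + 2 * s x)^-1 * pd a (along s) x
    + 2 * along s x / (1 + 2 * s x) ^+ 2 * pd a s x + pd a (along h) x))).
    by rewrite lin -!/(along _ x); ring.
  by move=> a _; rewrite dL; ring.
rewrite (eq_bigr (fun a => X x 0 a * (0 + vpp * pd a f x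
  + - H / Num.sqrt (1 + 2 * s x) * pd a s x + 0))).
  rewrite (lin (fun=> 0) _ _ (fun=> 0)) -!/(along _ x) along_f//.
  by rewrite !big1 => *; rewrite ?mulr0//; ring.
by move=> a _; rewrite rL; ring.
Qed.

Lemma maximum_principle : 0 < eps -> 0 < K -> - vpp <= c ->
  (forall u, c * inner g x u u <= bakry_emery g h x u u) ->
  (forall u : 'rV[R]_m.+1, \sum_a \sum_b u 0 a * u 0 b * pd a (pd b F) x <= 0) ->
  vp (f x) - H / Num.sqrt (1 + 2 * s x) + K * (2 * s x / (1 + 2 * s x)) <= 0.
Proof.
move=> eps0 K0 cge BE F2.
have chi0 : 0 < chi x by rewrite !mulr_gt0// expR_gt0.
have uE : inner g x (X x) (X x) = 2 * s x.
  by rewrite /s /gradient_energy mulrA divff ?pnatr_eq0// mul1r.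
apply: (@maximum_inequality R (2 * s x) (1 + 2 * s x) (Num.sqrt (1 + 2 * s x))
  (\sum_l \sum_k T l k x * T k l x) (along D x) (ricci g x (X x) (X x))
  (hessian g h x (X x) (X x)) (along h x) (along s x) (along (along s) x) (D x)
  c _ vpp H (chi x)) => //.
- exact: eigenvalue_trace critical_eigenvalue.
- exact: along_energy_critical.
- by rewrite -uE; exact: BE.
- exact: mean_curvature_eq.
- rewrite -along_mean_curvature_eq along_along_hessian; congr (_ + (_ + _)).
  rewrite /along -mulNr mulr_sumr; apply: eq_bigr => b _.
  by rewrite -/(Y b x) critical_eigenvalue mulrA.
- have := tangential_trace_le0 F2.
  rewrite laplacian_critical second_derivative_along_critical.
  by rewrite (bochner lm sX Ax).
Qed.

End MaximumPrinciple.

(** * The mean curvature of a graph *)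

Lemma invmx_right (R : comUnitRingType) (n : nat) (A B : 'M[R]_n) :
  A *m B = 1%:M -> invmx A = B.
Proof.
move=> AB; have [Au _] := mulmx1_unit AB.
by rewrite -[B](mulKmx Au) AB mulmx1.
Qed.

(** The Sherman-Morrison formula; [g + xi^T *m xi] is the first fundamental form of a graph whose
    function has differential [xi]. *)
Lemma invmx_rank1_update (R : fieldType) (n : nat) (g : 'M[R]_n) (xi : 'rV[R]_n)
    (X := xi *m invmx g) (w := 1 + (X *m xi^T) 0 0) :
  g^T = g -> g \in unitmx -> w != 0 ->
  invmx (g + xi^T *m xi) = invmx g - w^-1 *: (X^T *m X).
Proof.
move=> gs gu w0; apply: invmx_right.
have gX : g *m X^T = xi^T by rewrite /X trmx_mul trmx_inv gs mulmxA mulmxV// mul1mx.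
rewrite mulmxDl !mulmxBr mulmxV// -!scalemxAr mulmxA gX.
rewrite -[xi^T *m xi *m _]mulmxA -/X.
have -> : xi^T *m xi *m (X^T *m X) = (w - 1) *: (xi^T *m X).
  rewrite -mulmxA [xi *m _]mulmxA.
  have -> : xi *m X^T = (w - 1)%:M.
    rewrite /w [1 + _]addrC addrK -[LHS]trmxK trmx_mul trmxK.
    by rewrite -tr_scalar_mx -mx11_scalar.
  by rewrite mul_scalar_mx -scalemxAr.
apply/matrixP => a b; rewrite !mxE; field.
exact: w0.
Qed.

(** The normal is the normalized gradient of the coordinate 0, that is row 0 of $g^{-1}$ divided by
    $\sqrt{g^{00}}$; pairing with it reads off the component 0. *)
Lemma inner_unit_normal_coframe (R : realType) (m : nat)
    (g : 'rV[R]_m.+1 -> 'M[R]_m.+1) (x : 'rV[R]_m.+1) :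
  (g x)^T = g x -> g x \in unitmx -> 0 < invmx (g x) ord0 ord0 ->
  exists k eta, [/\ 0 < k, inner_unit_normal g x eta &
    forall u, inner g x u eta = k * u 0 ord0].
Proof.
move=> gs gu g0; pose k := (Num.sqrt (invmx (g x) ord0 ord0))^-1.
have k0 : 0 < k by rewrite invr_gt0 sqrtr_gt0.
pose eta := k *: row ord0 (invmx (g x)).
have etaE u : inner g x u eta = k * u 0 ord0.
  rewrite /inner /eta linearZ /= -scalemxAr mxE rowE trmx_mul trmx_inv gs.
  by rewrite mulmxA mulmxK// trmx_delta -colE mxE.
have eta0 : eta 0 ord0 = k * invmx (g x) ord0 ord0 by rewrite !mxE.
exists k, eta; split=> //; split.
- move=> u u0; have -> : inner g x eta u = inner g x u eta; last by rewrite etaE u0 mulr0.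
  transitivity (((u *m g x *m eta^T)^T) 0 0); last by rewrite mxE.
  by rewrite /inner !trmx_mul trmxK gs mulmxA.
- by rewrite etaE eta0 mulrA -expr2 exprVn sqr_sqrtr ?ltW// mulVf ?gt_eqF.
- by rewrite eta0 mulr_gt0.
Qed.

(** This entry is the squared norm of the gradient of the coordinate [a]. *)
Lemma gram_inv_diag_gt0 (R : realType) (m : nat) (A : set 'rV[R]_m.+1)
    (g : 'rV[R]_m.+1 -> 'M[R]_m.+1) x a :
  local_metric A g -> A x -> 0 < invmx (g x) a a.
Proof.
move=> lm Ax; have gu := gram_unitmx lm Ax.
have gs : (g x)^T = g x by case: lm => _ _ + _; exact.
have gp := let: And4 _ _ _ gp := lm in gp x (row a (invmx (g x))) Ax.
have E : inner g x (row a (invmx (g x))) (row a (invmx (g x))) = invmx (g x) a a.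
  by rewrite /inner -row_mul mulVmx// row1 tr_row trmx_inv gs -rowE !mxE.
rewrite -E; apply: gp; apply/eqP => r0.
have := congr1 (mulmx^~ (g x)) r0; rewrite -row_mul mulVmx// mul0mx => /rowP/(_ a).
by rewrite !mxE eqxx => /eqP; rewrite oner_eq0.
Qed.

Section GraphMeanCurvature.
Variables (R : realType) (m : nat) (A : set 'rV[R]_m.+1).
Variables (g : 'rV[R]_m.+1 -> 'M[R]_m.+1) (f h : 'rV[R]_m.+1 -> R).
Hypotheses (lm : local_metric A g) (sf : smooth_on A f) (sh : smooth_on A h).
Variables (x : 'rV[R]_m.+1) (Ax : A x).
Implicit Types (a b k l : 'I_m.+1) (p : 'rV[R]_m.+1 -> R).

Let rA : rel_open A. Proof. by case: lm. Qed.
Let Hx : half_space x := smooth_on_half_space rA Ax.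
Let X := grad g f.
Let sX : smooth_row_on A X := smooth_on_grad lm sf.
Let T := cov_deriv g X.
Let s := gradient_energy g f.
Let ss : smooth_on A s := smooth_on_gradient_energy lm sf.
Let G : 'rV[R]_(m.+1 + 1) -> 'M[R]_(m.+1 + 1) := product_metric g.
Let z : 'rV[R]_(m.+1 + 1) := graph_param f x.

(** The block index type ['I_(m.+1 + 1)] is convertible to ['I_(m + 1).+1], the form in which [pd]
    and [christoffel] take the product as a space of dimension [(m + 1).+1]. *)
Local Notation lsh a := (lshift 1 (a : 'I_m.+1) : 'I_(m + 1).+1).
Local Notation rsh := (rshift m.+1 ord0 : 'I_(m + 1).+1).

Let half_space_lsubmx (y : 'rV[R]_(m + 1).+1) :
  half_space y = half_space (lsubmx (y : 'rV[R]_(m.+1 + 1))).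
Proof.
rewrite /half_space /= mxE; congr (is_true (0 <= y _ _)).
exact: val_inj.
Qed.

Let lsubmx_z : lsubmx z = x. Proof. by rewrite /z row_mxKl. Qed.
Let Hz : @half_space R (m + 1) z. Proof. by rewrite half_space_lsubmx lsubmx_z. Qed.

Let has_partials_lsubmx p : smooth_on A p ->
  @has_partials R (m + 1) (fun y => p (lsubmx (y : 'rV[R]_(m.+1 + 1)))) z
    (fun c => \sum_(j < m.+1) (c == lsh j)%:R * pd j p x).
Proof.
move=> sp.
apply: (@has_partials_comp R (m + 1) m p (fun y => lsubmx (y : 'rV[R]_(m.+1 + 1)))
  z (fun j => pd j p x) (fun c (j : 'I_m.+1) => (c == lsh j)%:R)) => //.
- by rewrite lsubmx_z; exact: (smooth_on_has_partials rA).
- move=> j; apply: has_partials_ext (has_partials_coord (lsh j) z) => //.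
  by apply: filterE => y _; rewrite mxE.
- by apply: filterE => y; rewrite half_space_lsubmx.
Qed.

Let pd_left_lsubmx p a : smooth_on A p ->
  @pd R (m + 1) (lsh a) (fun y => p (lsubmx (y : 'rV[R]_(m.+1 + 1)))) z = pd a p x.
Proof.
move=> sp; rewrite (has_partials_pd _ Hz (has_partials_lsubmx sp)).
rewrite (bigD1 a)//= eqxx mul1r big1 ?addr0// => j ja.
by rewrite -val_eqE /= val_eqE eq_sym (negbTE ja) mul0r.
Qed.

Let pd_right_lsubmx p : smooth_on A p ->
  @pd R (m + 1) rsh (fun y => p (lsubmx (y : 'rV[R]_(m.+1 + 1)))) z = 0.
Proof.
move=> sp; rewrite (has_partials_pd _ Hz (has_partials_lsubmx sp)).
by rewrite big1// => j _; rewrite -val_eqE /= addn0 gtn_eqF ?mul0r// ltn_ord.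
Qed.

Let ord_cases (i : 'I_(m + 1).+1) : (exists a, i = lsh a) \/ i = rsh.
Proof.
case: (split_ordP (i : 'I_(m.+1 + 1))) => a ->; first by left; exists a.
by right; rewrite (ord1 a).
Qed.

Let sum_split (E : 'I_(m + 1).+1 -> R) : \sum_i E i = \sum_a E (lsh a) + E rsh.
Proof. by rewrite -[LHS]/(\sum_(i < m.+1 + 1) E i) big_split_ord big_ord1. Qed.

Let G_ll y a b : G y (lsh a) (lsh b) = g (lsubmx y) a b.
Proof. by rewrite /G /product_metric block_mxEul. Qed.

Let G_lr y a : G y (lsh a) rsh = 0.
Proof. by rewrite /G /product_metric block_mxEur mxE. Qed.

Let G_rl y a : G y rsh (lsh a) = 0.
Proof. by rewrite /G /product_metric block_mxEdl mxE. Qed.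

Let G_rr y : G y rsh rsh = 1.
Proof. by rewrite /G /product_metric block_mxEdr mxE. Qed.

Let sg a b : smooth_on A (fun y => g y a b). Proof. by case: lm. Qed.

Let pd_G_l (c : 'I_m.+1) a b : @pd R (m + 1) (lsh c) (fun y => G y (lsh a) (lsh b)) z
  = pd c (fun y => g y a b) x.
Proof. by rewrite -pd_left_lsubmx//; under eq_fun do rewrite G_ll. Qed.

Let pd_G_r (i j : 'I_(m + 1).+1) : @pd R (m + 1) rsh (fun y => G y i j) z = 0.
Proof.
have cst0 (k : R) : @pd R (m + 1) rsh (fun=> k) z = 0.
  exact: has_partials_pd Hz (has_partials_cst k z).
case: (ord_cases i) => [[a ->]|->]; case: (ord_cases j) => [[b ->]|->].
- by under eq_fun do rewrite G_ll; exact: (pd_right_lsubmx (sg a b)).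
- by under eq_fun do rewrite G_lr.
- by under eq_fun do rewrite G_rl.
- by under eq_fun do rewrite G_rr.
Qed.

Let pd_G_side (c i : 'I_(m + 1).+1) : @pd R (m + 1) c (fun y => G y i rsh) z = 0 /\
  @pd R (m + 1) c (fun y => G y rsh i) z = 0.
Proof.
have cst0 (k : R) : @pd R (m + 1) c (fun=> k) z = 0.
  exact: has_partials_pd Hz (has_partials_cst k z).
case: (ord_cases i) => [[a ->]|->].
  by split; under eq_fun do rewrite ?G_lr ?G_rl.
by split; under eq_fun do rewrite G_rr.
Qed.

Let mulG : G z *m block_mx (invmx (g x)) 0 0 1%:M = 1%:M.
Proof.
rewrite /G /product_metric lsubmx_z mulmx_block.
rewrite !mulmx0 !mul0mx !addr0 add0r mulmx1 mulmxV ?(gram_unitmx lm)//.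
by rewrite -scalar_mx_block.
Qed.

Let invG : invmx (G z) = block_mx (invmx (g x)) 0 0 1%:M.
Proof. exact: invmx_right mulG. Qed.

Let invG_ll a b : @invmx R (m + 1).+1 (G z) (lsh a) (lsh b) = invmx (g x) a b.
Proof.
by rewrite -[LHS]/(@invmx R (m.+1 + 1) (G z) (lshift 1 a) (lshift 1 b)) invG block_mxEul.
Qed.

Let invG_lr a : @invmx R (m + 1).+1 (G z) (lsh a) rsh = 0.
Proof.
rewrite -[LHS]/(@invmx R (m.+1 + 1) (G z) (lshift 1 a) (rshift _ ord0)) invG.
by rewrite block_mxEur mxE.
Qed.

Let invG_rl a : @invmx R (m + 1).+1 (G z) rsh (lsh a) = 0.
Proof.
rewrite -[LHS]/(@invmx R (m.+1 + 1) (G z) (rshift _ ord0) (lshift 1 a)) invG.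
by rewrite block_mxEdl mxE.
Qed.

Let christoffel_lll a b k :
  @christoffel R (m + 1) G (lsh a) (lsh b) (lsh k) z = christoffel g a b k x.
Proof.
rewrite /christoffel sum_split invG_lr mul0r addr0; congr (_ * _).
by apply: eq_bigr => l _; rewrite invG_ll !pd_G_l.
Qed.

Let christoffel_r (i j : 'I_(m + 1).+1) : @christoffel R (m + 1) G i j rsh z = 0.
Proof.
rewrite /christoffel sum_split big1 => [|l _]; last by rewrite invG_rl mul0r.
by rewrite add0r !(pd_G_side _ _).1 pd_G_r addr0 subr0 !mulr0.
Qed.

Let christoffel_side (i k : 'I_(m + 1).+1) : @christoffel R (m + 1) G i rsh k z = 0 /\
  @christoffel R (m + 1) G rsh i k z = 0.
Proof.
split; rewrite /christoffel big1 ?mulr0// => l _.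
  by rewrite pd_G_r (pd_G_side _ _).1 (pd_G_side _ _).2 !addr0 subr0 mulr0.
by rewrite pd_G_r (pd_G_side _ _).2 (pd_G_side _ _).2 !addr0 subr0 mulr0.
Qed.

Let w := 1 + 2 * s x.
Let r := Num.sqrt w.
Let w0 : 0 < w.
Proof.
rewrite /w /s /gradient_energy mulrA divff ?pnatr_eq0// mul1r.
rewrite ltr_wpDr//; have [->|Xn0] := eqVneq (grad g f x) 0.
  by rewrite /inner !mul0mx mxE.
by case: lm => _ _ _ gp; rewrite ltW// gp.
Qed.
Let r0 : 0 < r. Proof. by rewrite sqrtr_gt0. Qed.

Let rinv y := (Num.sqrt (1 + inner g y (X y) (X y)))^-1.

Let energyE y : inner g y (X y) (X y) = 2 * s y.
Proof. by rewrite /s /gradient_energy mulrA divff ?pnatr_eq0// mul1r. Qed.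

Let rinvE : rinv x = r^-1. Proof. by rewrite /rinv energyE. Qed.

(** The value of the derivative of $1/W$ is left open: it multiplies a multiple of the normal and
    drops out against tangent vectors. *)
Let rinv_partials : exists d, has_partials rinv x d.
Proof.
have dr := is_derive1_sqrt w0.
have dq : derivable (fun t : R => (Num.sqrt t)^-1) (1 + 2 * s x) 1.
  by apply: derivableV; [rewrite gt_eqF|exact: (ex_derive (is_derive := dr))].
have sw : smooth_on A (fun y => 1 + 2 * s y).
  by apply: smooth_onD; [|apply: smooth_onM => //]; exact: smooth_on_cst.
have := has_partials_comp1 Hx (smooth_on_has_partials rA sw Ax) (derivableP dq).
move=> H; eexists; apply: has_partials_ext H; last by [].
by apply: filterE => y _ /=; rewrite /rinv energyE.
Qed.

Let tangent_l a k : @tangent R m (m + 1) (graph_param f) a x 0 (lsh k) = (a == k)%:R.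
Proof.
rewrite mxE; apply: (has_partials_pd (d := fun a => (a == k)%:R)) => //.
apply: has_partials_ext (has_partials_coord k x) => //.
apply: filterE => y _.
by rewrite -[RHS]/(row_mx y (const_mx (f y)) 0 (lshift 1 k)) row_mxEl.
Qed.

Let tangent_r a : @tangent R m (m + 1) (graph_param f) a x 0 rsh = pd a f x.
Proof.
rewrite mxE; congr (pd a _ x); apply/funext => y.
by rewrite -[LHS]/(row_mx y (const_mx (f y)) 0 (rshift _ ord0)) row_mxEr mxE.
Qed.

Let normal_l y k : graph_normal g f y 0 (lsh k) = rinv y * X y 0 k.
Proof. by rewrite mxE row_mxEl. Qed.

Let normal_r y : graph_normal g f y 0 rsh = - rinv y.
Proof. by rewrite mxE row_mxEr mxE mulrN1. Qed.

Let inner_product (u t : 'rV[R]_(m + 1).+1) : @inner R (m + 1) G z u t =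
  \sum_a \sum_b u 0 (lsh a) * g x a b * t 0 (lsh b) + u 0 rsh * t 0 rsh.
Proof.
rewrite /inner mxE sum_split; congr (_ + _).
  rewrite exchange_big; apply: eq_bigr => b _; rewrite mxE sum_split mulrDl mulr_suml.
  rewrite G_rl mulr0 mul0r addr0; apply: eq_bigr => a _.
  by rewrite G_ll lsubmx_z [t^T _ _]mxE.
rewrite mxE sum_split big1 => [|a _]; last by rewrite G_lr mulr0.
by rewrite add0r G_rr mulr1 mxE.
Qed.

Let sum_delta (n : nat) (a : 'I_n) (E : 'I_n -> R) : \sum_k (a == k)%:R * E k = E a.
Proof.
rewrite (bigD1 a)//= eqxx mul1r big1 ?addr0// => k ka.
by rewrite eq_sym (negbTE ka) mul0r.
Qed.

Let first_formE : first_form G (graph_param f) x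
  = g x + (\row_a pd a f x)^T *m (\row_a pd a f x).
Proof.
apply/matrixP => a b; rewrite !mxE big_ord1 !mxE inner_product !tangent_r.
congr (_ + _).
transitivity (\sum_p (a == p)%:R * \sum_q (b == q)%:R * g x p q).
  apply: eq_bigr => p _; rewrite mulr_sumr; apply: eq_bigr => q _.
  by rewrite !tangent_l; ring.
by rewrite sum_delta sum_delta.
Qed.

Let first_form_inv a b : invmx (first_form G (graph_param f) x) a b
  = invmx (g x) a b - w^-1 * (X x 0 a * X x 0 b).
Proof.
have gs : (g x)^T = g x by case: lm => _ _ + _; exact.
have wE : 1 + ((\row_a pd a f x) *m invmx (g x) *m (\row_a pd a f x)^T) 0 0 = w.
  rewrite /w /s (gradient_energyE f lm)// mulrA divff ?pnatr_eq0// mul1r.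
  rewrite -[_ *m invmx (g x)]/(X x) mxE; congr (1 + _).
  by apply: eq_bigr => k _; rewrite !mxE.
rewrite first_formE invmx_rank1_update ?(gram_unitmx lm)//; last by rewrite wE gt_eqF.
by rewrite wE mxE [X in _ + X = _]mxE [X in _ - X = _]mxE mxE big_ord1 [_^T _ _]mxE.
Qed.

(** Up to a multiple of $N$, which is orthogonal to the graph, $D_a N$ is $(\nabla_a X, 0)/W$.
    Contraction with the inverse $g^{-1} - X \otimes X/w$ of the induced metric then gives
    $\mathrm{div} X - X(s)/w$, divided by $W$. *)
Let div_normal : div_along G (graph_param f) (graph_normal g f) x =
  r^-1 * (\sum_l T l l x - (\sum_b X x 0 b * pd b s x) / w).
Proof.
have [d dP] := rinv_partials.
have dN_l a l : pd a (fun y => graph_normal g f y 0 (lsh l)) x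
    = d a * X x 0 l + r^-1 * pd a (fun y => X y 0 l) x.
  rewrite -rinvE.
  apply: (has_partials_pd (d := fun a =>
    d a * X x 0 l + rinv x * pd a (fun y => X y 0 l) x)) => //.
  have hX := smooth_on_has_partials rA (sX l) Ax.
  apply: has_partials_ext (has_partialsM Hx dP hX) => //.
  by apply: filterE => y _; rewrite normal_l.
have dN_r a : pd a (fun y => graph_normal g f y 0 rsh) x = - d a.
  apply: (has_partials_pd (d := fun a => - d a)) => //.
  apply: has_partials_ext (has_partialsM Hx (has_partials_cst (-1) x) dP).
    by apply: filterE => y _; rewrite normal_r mulN1r.
  by move=> b; rewrite mul0r add0r mulN1r.
have cov_l a l : covariant_along G (graph_param f) (graph_normal g f) a x 0 (lsh l)
    = d a * X x 0 l + r^-1 * T a l x.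
  rewrite mxE dN_l -addrA; congr (_ + _); rewrite /T /cov_deriv mulrDr; congr (_ + _).
  rewrite sum_split [X in _ + X]big1 ?addr0; last first.
    by move=> j _; rewrite (christoffel_side _ _).2 !mul0r.
  transitivity (\sum_i (a == i)%:R * \sum_j christoffel g i j l x * (r^-1 * X x 0 j)).
    apply: eq_bigr => i _; rewrite sum_split (christoffel_side _ _).1 !mul0r addr0.
    rewrite mulr_sumr; apply: eq_bigr => j _.
    by rewrite christoffel_lll tangent_l normal_l rinvE; ring.
  by rewrite sum_delta mulr_sumr; apply: eq_bigr => j _; ring.
have cov_r a : covariant_along G (graph_param f) (graph_normal g f) a x 0 rsh = - d a.
  rewrite mxE dN_r big1 ?addr0// => i _; rewrite big1// => j _.
  by rewrite christoffel_r !mul0r.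
have innerE a b : inner G z (covariant_along G (graph_param f) (graph_normal g f) a x)
    (tangent (graph_param f) b x) = r^-1 * \sum_k T a k x * g x k b.
  rewrite inner_product tangent_r cov_r.
  transitivity (\sum_k (d a * X x 0 k + r^-1 * T a k x) * g x k b - d a * pd b f x).
    rewrite mulNr; congr (_ - _); apply: eq_bigr => k _.
    under eq_bigr do rewrite cov_l tangent_l mulrC.
    by rewrite sum_delta.
  rewrite -(grad_lower lm f b Ax) !mulr_sumr -sumrB; apply: eq_bigr => k _.
  by rewrite -/X; ring.
rewrite /div_along; under eq_bigr do under eq_bigr do rewrite first_form_inv innerE.
have gu := gram_unitmx lm Ax.
have gsE k b : g x k b = g x b k.
  by have /matrixP/(_ b k) : (g x)^T = g x; [case: lm => _ _ + _; exact|rewrite mxE].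
have trE a : \sum_b invmx (g x) a b * \sum_k T a k x * g x k b = T a a x.
  transitivity (\sum_k (a == k)%:R * T a k x); last exact: sum_delta.
  under eq_bigr do rewrite mulr_sumr.
  rewrite exchange_big /=; apply: eq_bigr => k _.
  have /matrixP/(_ a k) := mulVmx gu; rewrite !mxE => <-.
  rewrite mulr_suml; apply: eq_bigr => b _.
  by rewrite (gsE k b); ring.
have dsE a : \sum_b X x 0 b * \sum_k T a k x * g x k b = pd a s x.
  rewrite /s (pd_gradient_energy lm sf)//.
  under eq_bigr do rewrite mulr_sumr.
  rewrite exchange_big /=; apply: eq_bigr => k _.
  rewrite -(grad_lower lm f k Ax) mulr_sumr; apply: eq_bigr => b _.
  by rewrite (gsE k b) -/X -/T; ring.
rewrite mulr_suml -sumrB mulr_sumr; apply: eq_bigr => a _.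
rewrite -trE -dsE mulr_sumr mulr_suml -sumrB mulr_sumr; apply: eq_bigr => b _.
by ring.
Qed.

Variables (v : R -> R) (Psi : 'rV[R]_(m.+1 + 1) -> R) (H dv : R).
Hypotheses (PsiE : forall y, Psi y = h (lsubmx y) + v (rsubmx y 0 0))
  (dvE : is_derive (f x) 1 v dv).

Let has_partials_v : @has_partials R (m + 1) (fun y => v (y 0 rsh)) z
  (fun c => dv * (c == rsh)%:R).
Proof.
apply: (has_partials_comp1 (p := v) Hz (has_partials_coord rsh z)).
by rewrite -[z 0 rsh]/(z 0 (rshift m.+1 ord0)) /z row_mxEr mxE.
Qed.

Let has_partials_Psi : @has_partials R (m + 1) Psi z
  (fun c => \sum_(j < m.+1) (c == lsh j)%:R * pd j h x + dv * (c == rsh)%:R).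
Proof.
apply: has_partials_ext (has_partialsD (has_partials_lsubmx sh) has_partials_v) => //.
by apply: filterE => y _; rewrite PsiE [rsubmx _ _ _]mxE.
Qed.

Let inner_grad_Psi : @inner R (m + 1) G z (@grad R (m + 1) G Psi z) (graph_normal g f x)
  = r^-1 * (\sum_b X x 0 b * pd b h x - dv).
Proof.
have Gu : G z \in (@unitmx R (m + 1).+1).
  by have [] := mulmx1_unit mulG.
rewrite /inner /grad mulmxKV// mxE sum_split.
have nE i : (graph_normal g f x)^T i 0 = graph_normal g f x 0 i by rewrite mxE.
have pE (i : 'I_(m + 1).+1) :
    (\row_c @pd R (m + 1) c Psi z) 0 i = @pd R (m + 1) i Psi z by rewrite mxE.
have pl a : @pd R (m + 1) (lsh a) Psi z = pd a h x.
  rewrite (has_partials_pd _ Hz has_partials_Psi).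
  rewrite -[lsh a == rsh]val_eqE /= addn0 ltn_eqF ?ltn_ord// mulr0 addr0.
  rewrite (eq_bigr (fun j => (a == j)%:R * pd j h x)) ?sum_delta//.
have pr : @pd R (m + 1) rsh Psi z = dv.
  rewrite (has_partials_pd _ Hz has_partials_Psi) eqxx mulr1 big1 ?add0r// => j _.
  by rewrite -val_eqE /= addn0 gtn_eqF ?mul0r// ltn_ord.
rewrite pE nE pr normal_r rinvE mulrBr mulr_sumr mulrN [dv * _]mulrC; congr (_ - _).
by apply: eq_bigr => a _; rewrite pE nE pl normal_l rinvE; ring.
Qed.

Lemma graph_mean_curvature_eq :
  @weighted_mean_curvature R m (m + 1) (product_metric g) Psi (graph_param f)
    (graph_normal g f) x = H ->
  \sum_l T l l x - (\sum_b X x 0 b * pd b s x) / (1 + 2 * s x)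
    + \sum_b X x 0 b * pd b h x = dv - H * Num.sqrt (1 + 2 * s x).
Proof.
rewrite /weighted_mean_curvature -/G -/z div_normal inner_grad_Psi => <-.
rewrite -/w -/r; field.
by rewrite lt0r_neq0// lt0r_neq0.
Qed.

(** The coordinates of $M$ come first, so the coordinate 0 of the product is that of $M$.
    Orthogonality annihilates the component 0 of $N$, which is that of $X$ divided by $W$. *)
Lemma free_boundary_grad :
  (forall eta, @inner_unit_normal R (m + 1) (product_metric g) (graph_param f x) eta ->
     @inner R (m + 1) (product_metric g) (graph_param f x) (graph_normal g f x) eta = 0) ->
  X x 0 ord0 = 0.
Proof.
move=> fb.
have gs : (g x)^T = g x by case: lm => _ _ + _; exact.
have Gs : (G z)^T = G z.
  by rewrite /G /product_metric lsubmx_z tr_block_mx !trmx0 trmx1 gs.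
have Gu : G z \in (@unitmx R (m + 1).+1) by have [] := mulmx1_unit mulG.
have G0 : 0 < @invmx R (m + 1).+1 (G z) ord0 ord0.
  rewrite (_ : ord0 = lsh ord0); last exact: val_inj.
  by rewrite invG_ll (gram_inv_diag_gt0 _ lm Ax).
have [k [eta [k0 /fb + etaE]]] := inner_unit_normal_coframe Gs Gu G0.
rewrite etaE (_ : ord0 = lsh ord0); last exact: val_inj.
rewrite normal_l rinvE => /eqP; rewrite !mulf_eq0 (gt_eqF k0) invr_eq0 (gt_eqF r0) /=.
by move=> /eqP.
Qed.

End GraphMeanCurvature.

(** * Charts *)

Local Notation coord := Defs.coord.

Section Manifold.
Variables (R : realType) (n : nat) (M : manifold R n) (g : riemannian_metric M).
Implicit Types (i j : chart M) (p q : M).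

Lemma rel_open_chart_image i : rel_open (chart_image i).
Proof. by have [ O oO OE] := coord_image_open i; exists O. Qed.

Lemma local_metric_chart i : local_metric (chart_image i) (g i).
Proof.
split; first exact: rel_open_chart_image.
- exact: gram_smooth.
- exact: gram_sym.
- by move=> y u; exact: gram_posdef.
Qed.

Lemma coord_continuous_at i p : dom i p -> {for p, continuous (coord i)}.
Proof.
move=> ip; have := @Defs.coord_continuous _ _ M i.
by rewrite continuous_open_subspace ?inE; [apply; rewrite inE|exact: dom_open].
Qed.

Lemma near_dom i p : dom i p -> \forall q \near p, dom i q.
Proof. by move=> ip; apply: (near_open (dom_open i) ip). Qed.

Lemma chart_continuous i (f : 'rV[R]_n.+1 -> R) (F : M -> R) p :
  smooth_on (chart_image i) f -> (forall q, dom i q -> F q = f (coord i q)) ->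
  dom i p -> {for p, continuous F}.
Proof.
move=> sf Ff ip.
have fc : {for p, continuous (f \o coord i)}.
  apply: (smooth_on_comp_continuous sf (coord_continuous_at ip)).
  by apply: filterS (near_dom ip) => q iq; exists q.
rewrite /prop_for /continuous_at Ff//.
apply: cvg_trans fc; apply: near_eq_cvg.
by apply: filterS (near_dom ip) => q /Ff.
Qed.

Lemma overlap_near i j x : overlap i j x ->
  \forall y \near x, half_space y -> overlap i j y.
Proof.
move=> [Ax jx].
have rA := rel_open_chart_image i.
have /subspace_continuousP/(_ x Ax) := @param_continuous _ _ M i.
move=> /(_ _ (open_nbhs_nbhs (conj (dom_open j) jx))); rewrite /= => pj.
apply: filterS2 (rel_open_near rA Ax) pj => y Ay jy Hy.
by split; [exact: Ay|exact/jy/Ay].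
Qed.

(** The differential changes by $J^T$ and the metric by $J g J^T$, so half the squared norm of the
    differential is invariant. *)
Lemma gradient_energy_change (phi : M -> R) i j p : smooth_fun phi ->
  dom i p -> dom j p ->
  gradient_energy (g i) (phi \o param i) (coord i p)
  = gradient_energy (g j) (phi \o param j) (coord j p).
Proof.
move=> sphi ip jp; set x := coord i p; set y := coord j p.
have Ax : chart_image i x by exists p.
have Ay : chart_image j y by exists p.
have pE : param i x = p by exact: coordK.
have yE : coord j (param i x) = y by rewrite pE.
have ox : overlap i j x by split=> //; rewrite pE.
have Hx := smooth_on_half_space (rel_open_chart_image i) Ax.
have nox := overlap_near ox.
set J := transition_jacobian i j x.
have JE : (\row_a pd a (phi \o param i) x) = (\row_a pd a (phi \o param j) y) *m J^T.
  have hj : has_partials (phi \o param j) (coord j (param i x))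
      (fun b => pd b (phi \o param j) y).
    rewrite yE; apply: (smooth_on_has_partials (rel_open_chart_image j) (sphi j) Ay).
  have htr b : has_partials (fun z => coord j (param i z) 0 b) x (fun a => J a b).
    apply: has_partials_ext (near_has_partials (transition_smooth b) ox Hx nox).
      exact: filterE.
    by move=> a; rewrite !mxE.
  have Hy : \forall z \near x, half_space z -> half_space (coord j (param i z)).
    apply: filterS nox => z + Hz => /(_ Hz) [_ jz].
    apply: (smooth_on_half_space (rel_open_chart_image j)).
    by exists (param i z).
  have := has_partials_comp Hx hj htr Hy.
  move=> H; have {}H : has_partials (phi \o param i) x
      (fun a => \sum_b J a b * pd b (phi \o param j) y).
    apply: has_partials_ext H => //; apply: filterS nox => z + Hz => /(_ Hz) [_ jz] /=.
    by rewrite coordK.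
  apply/rowP => a; rewrite [LHS]mxE (has_partials_pd _ Hx H) mxE.
  by apply: eq_bigr => b _; rewrite [in RHS]mxE [J^T _ _]mxE mulrC.
have gE : g i x = J *m g j y *m J^T by rewrite -yE; exact: gram_change.
have gi_u := gram_unitmx (local_metric_chart i) Ax.
have gj_u := gram_unitmx (local_metric_chart j) Ay.
have Ju : J \in unitmx.
  by move: gi_u; rewrite gE -mulmxA unitmx_mul => /andP[].
rewrite /gradient_energy; congr (_ * _).
rewrite /inner /grad !mulmxKV// JE gE.
have -> : invmx (J *m g j y *m J^T) = invmx J^T *m invmx (g j y) *m invmx J.
  apply: invmx_right; rewrite !mulmxA mulmxK ?unitmx_tr//.
  by rewrite (mulmxK gj_u) mulmxV.
rewrite !mulmxA mulmxK ?unitmx_tr//.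
rewrite -[_ *m J^T *m _]mulmxA.
by rewrite -trmx_mul mulmxKV.
Qed.

(** The extreme value theorem needs a function on $M$ itself; any choice of charts gives it, by
    invariance. *)
Lemma energy_globalization (phi : M -> R) : smooth_fun phi ->
  exists S : M -> R, forall i p, dom i p ->
    S p = gradient_energy (g i) (phi \o param i) (coord i p).
Proof.
move=> sphi; have [c cP] := choice (@dom_cover _ _ M).
exists (fun p => gradient_energy (g (c p)) (phi \o param (c p)) (coord (c p) p)).
by move=> i p ip; exact: gradient_energy_change.
Qed.

Lemma gradient_energy_ge0 i (f : 'rV[R]_n.+1 -> R) y : chart_image i y ->
  0 <= gradient_energy (g i) f y.
Proof.
move=> Ay; rewrite /gradient_energy mulr_ge0//.
have [->|Xn0] := eqVneq (grad (g i) f y) 0; first by rewrite /inner !mul0mx mxE.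
by rewrite ltW// gram_posdef.
Qed.

Lemma gradient_energy_eq0 i (f : 'rV[R]_n.+1 -> R) y : chart_image i y ->
  gradient_energy (g i) f y = 0 -> forall a, pd a f y = 0.
Proof.
move=> Ay E a; rewrite -(grad_lower (local_metric_chart i))// big1// => k _.
have [->|Xn0] := eqVneq (grad (g i) f y) 0; first by rewrite mxE mul0r.
have := gram_posdef g Ay Xn0; move/eqP: E; rewrite mulf_eq0 invr_eq0 pnatr_eq0 /=.
by move=> /eqP ->; rewrite ltxx.
Qed.

(** The fibres are open and closed. *)
Lemma locally_constant_constant (phi : M -> R) : connected [set: M] ->
  (forall p, \forall q \near p, phi q = phi p) -> forall p q, phi p = phi q.
Proof.
move=> Mc lc p q; pose B := [set z | phi z = phi q].
suff : B = [set: M] by move=> BT; have : [set: M] p by []; rewrite -BT.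
apply: Mc; first by exists q.
- exists B; last by rewrite setTI.
  rewrite openE => z Bz; apply: filterS (lc z) => z' E.
  by rewrite /B /= E.
- exists B; last by rewrite setTI.
  rewrite -openC openE => z Bz; apply: filterS (lc z) => z' E.
  by rewrite /B /= E.
Qed.

Lemma energy0_constant (phi : M -> R) : smooth_fun phi -> connected [set: M] ->
  (forall i p, dom i p -> gradient_energy (g i) (phi \o param i) (coord i p) = 0) ->
  forall p q, phi p = phi q.
Proof.
move=> sphi Mc E0; apply: locally_constant_constant Mc _ => p.
have [i ip] := dom_cover p.
have Ax : chart_image i (coord i p) by exists p.
have f0 a y : chart_image i y -> pd a (phi \o param i) y = 0.
  by move=> Ay; apply: gradient_energy_eq0 (Ay) _ _; case: Ay => q iq <-; exact: E0.
have := pd0_locally_constant (rel_open_chart_image i) Ax (sphi i) f0.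
move=> /(coord_continuous_at ip) /= lc.
apply: filterS2 (near_dom ip) lc => q iq.
rewrite /= !coordK//; apply; by exists q.
Qed.

(* The free boundary condition makes the gradient tangent to the boundary, so
   that local convexity applies to the gradient field itself. *)
Lemma boundary_critical (phi : M -> R) i x : smooth_fun phi ->
  locally_convex_boundary g -> free_boundary g phi ->
  chart_image i x -> x 0 ord0 = 0 ->
  grad (g i) (phi \o param i) x 0 ord0 = 0 /\
  0 <= grad (g i) (gradient_energy (g i) (phi \o param i)) x 0 ord0.
Proof.
move=> sphi convex [_ fb] Ax x0.
have lm := local_metric_chart i.
have X0 y : chart_image i y -> y 0 ord0 = 0 ->
    grad (g i) (phi \o param i) y 0 ord0 = 0.
  by move=> Ay y0; apply: (free_boundary_grad lm Ay) => eta; exact: fb.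
split; first exact: X0.
have gs : (g i x)^T = g i x by exact: gram_sym.
have [k [eta [k0 etan etaE]]] :=
  inner_unit_normal_coframe gs (gram_unitmx lm Ax) (gram_inv_diag_gt0 _ lm Ax).
have := convex i _ (smooth_on_grad lm (sphi i)) X0 x eta Ax x0 etan.
by rewrite etaE (covariant_grad lm (sphi i))// pmulr_rge0.
Qed.

End Manifold.

(** * Vanishing of the gradient *)

Section Conclusion.
Variables (R : realType) (n : nat) (M : manifold R n) (g : riemannian_metric M).
Hypotheses (Mcomp : compact [set: M]) (Mconv : locally_convex_boundary g).
Variables (h phi : M -> R) (v : R -> R) (psi : M * R -> R) (H c : R).
Hypotheses (hh : smooth_fun h) (hv : smooth_line v) (hphi : smooth_fun phi).
Hypothesis psiE : forall p t, psi (p, t) = h p + v t.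
Hypotheses (Ricv : bakry_emery_line_le v c) (Rich : bakry_emery_ge g h c).
Hypothesis Hconst : forall (i : chart M) x, chart_image i x ->
  graph_mean_curvature g psi phi i x = H.
Hypothesis Hfree : free_boundary g phi.
Implicit Types (i : chart M) (p q : M).

Let dv (t : R) : is_derive t 1 v (derive1 v t).
Proof. by rewrite derive1E; apply: derivableP; exact: (@hv 0%N t). Qed.

Let ddv (t : R) : is_derive t 1 (derive1 v) (derive1n 2 v t).
Proof.
have := derivableP (@hv 1%N t); rewrite -derive1E.
by rewrite (_ : derive1n 1 v = derive1 v).
Qed.

Lemma chart_equation i y : chart_image i y ->
  let f := phi \o param i in let s := gradient_energy (g i) f in
  \sum_l cov_deriv (g i) (grad (g i) f) l l y
    - (\sum_b grad (g i) f y 0 b * pd b s y) / (1 + 2 * s y)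
    + \sum_b grad (g i) f y 0 b * pd b (h \o param i) y
  = derive1 v (f y) - H * Num.sqrt (1 + 2 * s y).
Proof.
move=> Ay f s.
have PsiE z : product_local psi i z
    = (h \o param i) (lsubmx z) + v (rsubmx z 0 0) by rewrite /product_local psiE.
have dvf : is_derive (f y) 1 v (derive1 v (f y)) := dv (f y).
have := graph_mean_curvature_eq (local_metric_chart g i) (@hphi i) (@hh i) Ay PsiE dvf.
by move=> /(_ _ (Hconst Ay)).
Qed.

(** The pointwise inequality at a global maximum [q]. The work lies in showing that $F$ is critical
    there even if [q] is on the boundary; a suitable [K] will later make the inequality fail. *)
Lemma barrier_contradiction (S : M -> R) (K eps : R) q :
  (forall i p, dom i p ->
    S p = gradient_energy (g i) (phi \o param i) (Defs.coord i p)) ->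
  0 < K -> 0 < eps -> 0 < S q ->
  (forall p, S p + eps * expR (K * phi p) <= S q + eps * expR (K * phi q)) ->
  derive1 v (phi q) - H / Num.sqrt (1 + 2 * S q) + K * (2 * S q / (1 + 2 * S q)) <= 0.
Proof.
move=> SE K0 eps0 Sq qmax; have [i iq] := dom_cover q.
pose A := chart_image i; pose x := Defs.coord i q.
have lm := local_metric_chart g i; have rA : rel_open A by case: lm.
have Ax : A x by exists q.
have sf := @hphi i; pose f := phi \o param i; pose s := gradient_energy (g i) f.
pose F y := s y + eps * expR (K * f y).
have sF : smooth_on A F by exact: smooth_on_barrier.
have fx : f x = phi q by rewrite /f /= coordK.
have sx : S q = s x by exact: SE.
have Fmax y : A y -> F y <= F x.
  move=> [p ip <-]; have := qmax p.
  by rewrite (SE i p ip) (SE i q iq) /F /s /f /= !coordK.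
have dirs a (e : R) : 0 <= e * (a == ord0)%:R \/ 0 < x 0 ord0 -> e * pd a F x <= 0.
  have := max_first_order rA Ax sF Fmax (w := e *: delta_mx 0 a).
  rewrite !mxE eqxx /= eq_sym => /[apply].
  rewrite (bigD1 a)//= big1 ?addr0 => [|b ba]; rewrite !mxE eqxx ?eqxx ?mulr1//=.
  by rewrite (negbTE ba) mulr0 mul0r.
have F_le0 a : pd a F x <= 0.
  by rewrite -[pd a F x]mul1r; apply: dirs; left; rewrite mul1r ler0n.
have F_ge0 a : a != ord0 \/ 0 < x 0 ord0 -> 0 <= pd a F x.
  move=> ax; rewrite -oppr_le0 -mulN1r; apply: dirs.
  by case: ax => [/negbTE ->|x0]; [left; rewrite mulr0|right].
have F0 a : pd a F x = 0.
  apply: le_anti; rewrite F_le0 /=.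
  have [a0|an0] := eqVneq a ord0; last by apply: F_ge0; left.
  have /orP[/eqP x0|x0] : (0 == x 0 ord0) || (0 < x 0 ord0).
    by rewrite -le_eqVlt; exact: smooth_on_half_space Ax.
  2: by apply: F_ge0; right.
  have [X0 Y0] := boundary_critical hphi Mconv Hfree Ax (esym x0).
  have gi0 := gram_inv_diag_gt0 ord0 lm Ax.
  (* At a boundary maximum the derivatives along the boundary vanish, so $(\nabla F)^0 =
     g^{00}\,\partial_0 F$. Since $X^0 = 0$, it also equals $(\nabla s)^0$, which convexity makes
     nonnegative. *)
  have E : pd ord0 F x * invmx (g i x) ord0 ord0 = grad (g i) s x 0 ord0.
    transitivity (\sum_b pd b F x * invmx (g i x) b ord0).
      rewrite (bigD1 ord0)//= big1 ?addr0// => b b0.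
      suff -> : pd b F x = 0 by rewrite mul0r.
      by apply: le_anti; rewrite F_le0 /=; apply: F_ge0; left.
    transitivity (grad (g i) s x 0 ord0
      + eps * K * expR (K * f x) * grad (g i) f x 0 ord0); last by rewrite X0 mulr0 addr0.
    rewrite !gradE mulr_sumr -big_split /=; apply: eq_bigr => b _.
    by rewrite (pd_barrier lm sf _ _ _ Ax) mulrDl mulrA.
  by rewrite a0 -(pmulr_lge0 _ gi0) E.
have F2 := max_second_order rA Ax sF Fmax _ F0.
rewrite sx -fx.
apply: (maximum_principle lm sf (@hh i) Ax F0 (vp := derive1 v)
  (vpp := derive1n 2 v (f x)) (c := c)) => //.
- by move=> y Ay; exact: chart_equation.
- by rewrite -/s -sx mulr_gt0.
- by move=> u; exact: Rich.
Qed.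

Lemma phi_continuous : continuous phi.
Proof.
move=> p; have [i ip] := dom_cover p.
apply: (chart_continuous (@hphi i)) ip => q iq /=.
by rewrite coordK.
Qed.

Lemma gradient_energy_vanishes i p : dom i p ->
  gradient_energy (g i) (phi \o param i) (Defs.coord i p) = 0.
Proof.
move=> ip0; have [S SE] := energy_globalization g hphi.
rewrite -SE//; apply/eqP/negPn/negP => Sp0.
have S_ge0 q : 0 <= S q.
  by have [j jq] := dom_cover q; rewrite (SE j)// gradient_energy_ge0//; exists q.
have {Sp0}Sp0 : 0 < S p by rewrite lt_neqAle eq_sym Sp0 S_ge0.
have M0 : [set: M] !=set0 by exists p.
have phic := phi_continuous.
have [q1 _ q1max] := compact_EVT_max M0 Mcomp (continuous_subspaceT phic).
have dvc : continuous (derive1 v \o phi).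
  move=> q; apply: continuous_comp; first exact: phic.
  apply: differentiable_continuous; apply/derivable1_diffP.
  exact: (ex_derive (is_derive := ddv _)).
(* Bounds $v'(\varphi)$ below on $M$; the summand 1 in [B] provides the final strict inequality. *)
have [q2 _ q2min] := compact_EVT_min M0 Mcomp (continuous_subspaceT dvc).
pose sg := S p; pose B := `|derive1 v (phi q2)| + `|H| + 1.
have B0 : 0 < B by rewrite ltr_wpDl// addr_ge0.
(* The function $2t/(1+2t)$ is increasing in $t \geq 0$ and equals [sg / (1 + sg)] at [sg / 2], the
   lower bound to be obtained for [S q]; so [K] times it is at least [B]. *)
pose K := B * ((1 + sg) / sg).
have K0 : 0 < K by rewrite mulr_gt0// divr_gt0// addr_gt0.
(* As [phi] is maximal at [q1], the exponential term of [F] is at most [sg / 2] everywhere. *)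
pose eps := sg / 2 / expR (K * phi q1).
have eps0 : 0 < eps by rewrite !divr_gt0// expR_gt0.
pose F q := S q + eps * expR (K * phi q).
have Fc : continuous F.
  move=> q; have [j jq] := dom_cover q.
  have sF := smooth_on_barrier (local_metric_chart g j) (@hphi j) eps K.
  apply: (chart_continuous sF _ jq).
  by move=> r jr; rewrite /F (SE j)//= coordK.
have [q _ qmax] := compact_EVT_max M0 Mcomp (continuous_subspaceT Fc).
have {}qmax r : F r <= F q by apply: qmax; rewrite inE.
have small r : eps * expR (K * phi r) <= sg / 2.
  rewrite /eps -mulrA ler_piMr ?divr_ge0 ?(ltW Sp0)// mulrC ler_pdivrMr ?expR_gt0// mul1r.
  by rewrite ler_expR ler_pM2l//; apply: q1max; rewrite inE.
(* $F(q) \geq F(p) \geq$ [sg], and the exponential term accounts for at most half of it. *)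
have Sq : sg / 2 <= S q.
  have h1 := qmax p; have h2 := small q.
  have h3 : 0 <= eps * expR (K * phi p) by rewrite mulr_ge0 ?ltW// expR_gt0.
  rewrite /F in h1; rewrite -/sg in h1.
  have -> : sg / 2 = sg - sg / 2 by field.
  rewrite lerBlDr; apply: le_trans (lerD (lexx _) h2).
  by apply: le_trans h1; rewrite lerDl.
have Sq0 : 0 < S q by apply: lt_le_trans Sq; rewrite divr_gt0.
have := barrier_contradiction SE K0 eps0 Sq0 qmax; apply/negP; rewrite -ltNge.
set w := 1 + 2 * S q.
have w1 : 1 <= w by rewrite lerDl mulr_ge0// ltW.
have w0 : 0 < w by exact: lt_le_trans w1.
have hH : H / Num.sqrt w <= `|H|.
  apply: (le_trans (ler_norm _)); rewrite normrM ler_piMr//.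
  rewrite ger0_norm ?invr_ge0 ?sqrtr_ge0//.
  by rewrite invf_le1 ?sqrtr_gt0// -[leLHS]sqrtr1 ler_sqrt// ltW.
have hv' : - `|derive1 v (phi q2)| <= derive1 v (phi q).
  apply: (@le_trans _ _ (derive1 v (phi q2))); last by apply: q2min; rewrite inE.
  by rewrite lerNl -normrN ler_norm.
have hK : B <= K * (2 * S q / w).
  rewrite /K -mulrA ler_peMr ?(ltW B0)// mulf_div ler_pdivlMr ?mulr_gt0// mul1r /w.
  rewrite mulrDr [(1 + sg) * _]mulrDl mulr1 mul1r lerD2r.
  by move: Sq; rewrite ler_pdivrMr// mulrC.
apply: lt_le_trans (_ : 0 < - `|derive1 v (phi q2)| - `|H| + B) _.
  by rewrite /B addrA addrC -!addrA addrCA; lra.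
by apply: lerD => //; apply: lerD => //; rewrite lerN2.
Qed.

End Conclusion.

Theorem corollary4p6 (R : realType) (n : nat) (M : manifold R n)
  (o : chart M -> M -> bool) (Mor : orientation o)
  (g : riemannian_metric M)
  (Mconn : connected [set: M]) (Mcomp : compact [set: M])
  (Mconv : locally_convex_boundary g)
  (h : M -> R) (v : R -> R) (psi : M * R -> R)
  (hh : smooth_fun h) (hv : smooth_line v)
  (hpsi : forall p t, expR (psi (p, t)) = expR (h p) * expR (v t))
  (c : R) (Ricv : bakry_emery_line_le v c) (Rich : bakry_emery_ge g h c)
  (Sigma : set (M * R)) (phi : M -> R) (hphi : smooth_fun phi)
  (hSigma : Sigma = graph phi)
  (Hconst : constant_mean_curvature g psi phi)
  (Hfree : free_boundary g phi) :
  exists s : R, Sigma = slice M s.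
Proof.
have psiE p t : psi (p, t) = h p + v t by apply: expR_inj; rewrite hpsi expRD.
have [H curvE] := Hconst.
have phi_cst : forall p q, phi p = phi q.
  apply: (energy0_constant hphi Mconn) => i p ip.
  exact: (gradient_energy_vanishes Mcomp Mconv hh hv hphi psiE Ricv Rich curvE Hfree).
(* The empty space counts as connected here; its graph and all its slices are empty, so any height
   will do. *)
have [[p0 _]|M0] := pselect ([set: M] !=set0); last first.
  exists 0; rewrite hSigma; apply/seteqP.
  by split=> -[p t] _; exfalso; apply: M0; exists p.
by exists (phi p0); rewrite hSigma; apply/seteqP; split=> -[p t] E;
  apply: (etrans E); exact: phi_cst.
Qed.
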